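(* Let $k,l,n\ge1$ be integers and $m:=\max\{k,l\}$. In $\mathscr{PD}_{m\times n}$ put $\tilde t_{i,j}:=t_{m+1-i,n+1-j}$ and $\tilde\partial_{i,j}:=\partial_{m+1-i,n+1-j}$. Let $\mathscr{A}_{k,l,n}$ be the subalgebra of $\mathscr{PD}_{m\times n}$ generated by the $\tilde t_{i,j}$ and $\tilde\partial_{i',j}$ with $1\le i\le k$, $1\le i'\le l$, $1\le j\le n$; it is a $U_R$-module algebra for $U_R=U_q(\mathfrak{gl}_n)$. Let $\mathrm{gr}(\mathscr{A}_{k,l,n})$ be the associated graded algebra for the degree filtration (with $\deg\tilde t_{i,j}=\deg\tilde\partial_{i',j}=1$), which is $U_R$-stable, so that $\mathrm{gr}(\mathscr{A}_{k,l,n})$ is also a $U_R$-module algebra. For $1\le i\le k$, $1\le j\le l$ set $\tilde{\mathsf{L}}_{i,j}:=\sum_{r=1}^n\tilde t_{i,r}\tilde\partial_{j,r}\in\mathscr{A}_{k,l,n}$, and let $\mathrm{gr}(\tilde{\mathsf{L}}_{i,j})\in\mathrm{gr}(\mathscr{A}_{k,l,n})$ be the element given by the same formula (using the images of the $\tilde t_{i,r}$ and $\tilde\partial_{j,r}$ in degree $1$ of $\mathrm{gr}(\mathscr{A}_{k,l,n})$). Let $(\mathscr{A}_{k,l,n})_{(\epsilon_R)}$ and $(\mathrm{gr}(\mathscr{A}_{k,l,n}))_{(\epsilon_R)}$ be the subalgebras of $U_R$-invariants. Then $(\mathscr{A}_{k,l,n})_{(\epsilon_R)}$ is generated as an algebra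 by the $\tilde{\mathsf{L}}_{i,j}$, and $(\mathrm{gr}(\mathscr{A}_{k,l,n}))_{(\epsilon_R)}$ is generated as an algebra by the $\mathrm{gr}(\tilde{\mathsf{L}}_{i,j})$, for $1\le i\le k$ and $1\le j\le l$.
   Context: Let $\Bbbk=\mathbb{C}(q)$. For $n\ge1$, $U_q(\mathfrak{gl}_n)$ is the $\Bbbk$-algebra generated by $E_i,F_i$ ($1\le i\le n-1$) and $K_{\varepsilon_i}^{\pm1}$ ($1\le i\le n$) subject to: the $K_{\varepsilon_i}^{\pm1}$ commute, $K_{\varepsilon_i}K_{\varepsilon_i}^{-1}=1$, $K_{\varepsilon_i}E_jK_{\varepsilon_i}^{-1}=q^{\delta_{i,j}-\delta_{i,j+1}}E_j$, $K_{\varepsilon_i}F_jK_{\varepsilon_i}^{-1}=q^{-\delta_{i,j}+\delta_{i,j+1}}F_j$, $E_iF_j-F_jE_i=\delta_{i,j}\frac{K_i-K_i^{-1}}{q-q^{-1}}$ with $K_i:=K_{\varepsilon_i}K_{\varepsilon_{i+1}}^{-1}$, and the quantum Serre relations. It is a Hopf algebra with $\Delta(E_i)=E_i\otimes K_i+1\otimes E_i$, $\Delta(F_i)=F_i\otimes 1+K_i^{-1}\otimes F_i$, $\Delta(K_{\varepsilon_i})=K_{\varepsilon_i}\otimes K_{\varepsilon_i}$, counit $\epsilon(E_i)=\epsilon(F_i)=0$, $\epsilon(K_{\varepsilon_i}^{\pm1})=1$. The counit of $U_R:=U_q(\mathfrak{gl}_n)$ is denoted $\epsilon_R$. For a $U_R$-module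 $V$, $V_{(\epsilon_R)}:=\{v\in V: x\cdot v=\epsilon_R(x)v\ \forall x\in U_R\}$. The quantized Weyl algebra $\mathscr{PD}_{m\times n}$ is the $\Bbbk$-algebra generated by $t_{i,j},\partial_{i,j}$ ($1\le i\le m$, $1\le j\le n$) with relations: (R1) $t_{k,i}t_{k,j}=qt_{k,j}t_{k,i}$ and $t_{i,k}t_{j,k}=qt_{j,k}t_{i,k}$ for $i<j$; (R2) $t_{i,l}t_{k,j}=t_{k,j}t_{i,l}$ and $t_{i,j}t_{k,l}-t_{k,l}t_{i,j}=(q-q^{-1})t_{i,l}t_{k,j}$ for $i<k$, $j<l$; (R1$'$) $\partial_{k,j}\partial_{k,i}=q\partial_{k,i}\partial_{k,j}$ and $\partial_{j,k}\partial_{i,k}=q\partial_{i,k}\partial_{j,k}$ for $i<j$; (R2$'$) $\partial_{k,j}\partial_{i,l}=\partial_{i,l}\partial_{k,j}$ and $\partial_{k,l}\partial_{i,j}-\partial_{i,j}\partial_{k,l}=(q-q^{-1})\partial_{k,j}\partial_{i,l}$ for $i<k$, $j<l$; (R3) $\partial_{c,b}t_{d,a}=t_{d,a}\partial_{c,b}$ if $b\ne a$ and $c\ne d$; (R4) $\partial_{c,b}t_{c,a}=qt_{c,a}\partial_{c,b}+(q-q^{-1})\sum_{c'>c}t_{c',a}\partial_{c',b}$ if $b\ne a$; (R5) $\partial_{c,a}t_{d,a}=qt_{d,a}\partial_{c,a}+(q-q^{-1})\sum_{a'>a}t_{d,a'}\partial_{c,a'}$ if $c\neq d$; (R6) $\partial_{c,d}t_{c,d}=1+\sum_{c'\ge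 c}\sum_{d'\ge d}q^{\delta_{c,c'}+\delta_{d,d'}}(q-q^{-1})^{2-\delta_{c,c'}-\delta_{d,d'}}t_{c',d'}\partial_{c',d'}$. $\mathscr{PD}_{m\times n}$ is a $U_R$-module algebra ($x\cdot(DD')=\sum(x_1\cdot D)(x_2\cdot D')$, $x\cdot1=\epsilon_R(x)1$), with action on generators $E_k\cdot\partial_{i,j}=\delta_{k+1,j}\partial_{i,k}$, $F_k\cdot\partial_{i,j}=\delta_{k,j}\partial_{i,k+1}$, $K_{\varepsilon_k}\cdot\partial_{i,j}=q^{\delta_{k,j}}\partial_{i,j}$, $E_k\cdot t_{i,j}=-\delta_{k,j}q^{-1}t_{i,k+1}$, $F_k\cdot t_{i,j}=-\delta_{k+1,j}qt_{i,k}$, $K_{\varepsilon_k}\cdot t_{i,j}=q^{-\delta_{k,j}}t_{i,j}$; $\mathscr{A}_{k,l,n}$ is $U_R$-stable. *)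

(* Defs.v *)
From HB Require Import structures.
From mathcomp Require Import all_boot all_order all_algebra.
From mathcomp Require Import generic_quotient fraction complex.
From mathcomp Require Import boolp reals.
From mathcomp.multinomials Require Import monalg.
From mathcomp Require Import ring zify.

Set Implicit Arguments.
Unset Strict Implicit.
Unset Printing Implicit Defensive.

Import GRing.Theory.
Local Open Scope ring_scope.
Local Open Scope quotient_scope.

(* Properness is part of the structure because MathComp algebras are nonzero. *)
Record proper_ideal2 (A : nzRingType) := ProperIdeal2 {
  ideal2_mem :> A -> Prop;
  ideal2_0 : ideal2_mem 0;
  ideal2_B : forall x y, ideal2_mem x -> ideal2_mem y -> ideal2_mem (x - y);
  ideal2_Ml : forall a x, ideal2_mem x -> ideal2_mem (a * x);
  ideal2_Mr : forall a x, ideal2_mem x -> ideal2_mem (x * a);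
  ideal2_1 : ~ ideal2_mem 1 }.

Section AlgebraQuotient.
Variables (K : fieldType) (A : algType K) (J : proper_ideal2 A).

Definition ideal2_equiv (x y : A) : bool := `[< J (x - y) >].

Lemma ideal2_equiv_is_equiv : equiv_class_of ideal2_equiv.
Proof.
split=> [x|x y|y x z].
- by apply/asboolP; rewrite subrr; apply: ideal2_0.
- have sym u v : ideal2_equiv u v -> ideal2_equiv v u.
    move=> /asboolP Juv; apply/asboolP; rewrite -opprB -[- _]add0r.
    by apply: ideal2_B => //; apply: ideal2_0.
  by apply/idP/idP => /sym.
- move=> /asboolP Jxy /asboolP Jyz; apply/asboolP.
  have J0yz : J (- (y - z)).
    by rewrite -[- _]add0r; apply: ideal2_B => //; apply: ideal2_0.
  by rewrite -[x](subrK y) -addrA -[y - z]opprK; apply: ideal2_B.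
Qed.

Canonical ideal2_equivRel := EquivRelPack ideal2_equiv_is_equiv.
Canonical ideal2_encModRel := defaultEncModRel ideal2_equiv.

Definition quot_alg : Type := {eq_quot ideal2_equiv}.

HB.instance Definition _ : EqQuotient A ideal2_equiv quot_alg :=
  EqQuotient.on quot_alg.
HB.instance Definition _ := Choice.on quot_alg.

Definition quot_pi (x : A) : quot_alg := \pi_quot_alg x.

Lemma quot_piP x y : quot_pi x = quot_pi y <-> J (x - y).
Proof. split=> [pixy|Jxy]; first exact/asboolP/(eqmodP ideal2_equivRel x y).
exact/eqmodP/asboolP. Qed.

Lemma quot_reprK (g : quot_alg) : quot_pi (repr g) = g.
Proof. exact: reprK. Qed.

Lemma quot_repr_pi x : J (repr (quot_pi x) - x).
Proof. by apply/quot_piP; rewrite quot_reprK. Qed.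

Lemma ideal2_D x y : J x -> J y -> J (x + y).
Proof.
move=> Jx Jy; rewrite -[y]opprK; apply: ideal2_B => //.
by rewrite -[- y]add0r; apply: ideal2_B => //; apply: ideal2_0.
Qed.

Lemma ideal2_Z (c : K) x : J x -> J (c *: x).
Proof. by move=> Jx; rewrite -mulr_algl; apply: ideal2_Ml. Qed.

Definition quot_add (g h : quot_alg) := quot_pi (repr g + repr h).
Definition quot_opp (g : quot_alg) := quot_pi (- repr g).
Definition quot_mul (g h : quot_alg) := quot_pi (repr g * repr h).
Definition quot_scale (c : K) (g : quot_alg) := quot_pi (c *: repr g).

Lemma quot_addE x y : quot_add (quot_pi x) (quot_pi y) = quot_pi (x + y).
Proof.
apply/quot_piP; rewrite opprD addrACA.
by apply: ideal2_D; apply: quot_repr_pi.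
Qed.

Lemma quot_oppE x : quot_opp (quot_pi x) = quot_pi (- x).
Proof.
apply/quot_piP; rewrite -opprD -[- _]add0r.
by apply: ideal2_B; [apply: ideal2_0 | apply: quot_repr_pi].
Qed.

Lemma quot_mulE x y : quot_mul (quot_pi x) (quot_pi y) = quot_pi (x * y).
Proof.
apply/quot_piP; set x' := repr _; set y' := repr _.
have -> : x' * y' - x * y = (x' - x) * y' + x * (y' - y).
  by rewrite mulrBl mulrBr addrA subrK.
by apply: ideal2_D; [apply: ideal2_Mr | apply: ideal2_Ml]; apply: quot_repr_pi.
Qed.

Lemma quot_scaleE c x : quot_scale c (quot_pi x) = quot_pi (c *: x).
Proof.
by apply/quot_piP; rewrite -scalerBr; apply: ideal2_Z; apply: quot_repr_pi.
Qed.

Let quotE := (quot_addE, quot_oppE, quot_mulE, quot_scaleE).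

Lemma quot_ind (P : quot_alg -> Prop) :
  (forall x, P (quot_pi x)) -> forall g, P g.
Proof. by move=> Ppi g; rewrite -(quot_reprK g). Qed.

Lemma quot_addA : associative quot_add.
Proof. by do 3!elim/quot_ind=> ?; rewrite !quotE addrA. Qed.
Lemma quot_addC : commutative quot_add.
Proof. by do 2!elim/quot_ind=> ?; rewrite !quotE addrC. Qed.
Lemma quot_add0 : left_id (quot_pi 0) quot_add.
Proof. by elim/quot_ind=> ?; rewrite !quotE add0r. Qed.
Lemma quot_addN : left_inverse (quot_pi 0) quot_opp quot_add.
Proof. by elim/quot_ind=> ?; rewrite !quotE addNr. Qed.

HB.instance Definition _ :=
  GRing.isZmodule.Build quot_alg quot_addA quot_addC quot_add0 quot_addN.

Lemma quot_mulA : associative quot_mul.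
Proof. by do 3!elim/quot_ind=> ?; rewrite !quotE mulrA. Qed.
Lemma quot_mul1 : left_id (quot_pi 1) quot_mul.
Proof. by elim/quot_ind=> ?; rewrite !quotE mul1r. Qed.
Lemma quot_mulr1 : right_id (quot_pi 1) quot_mul.
Proof. by elim/quot_ind=> ?; rewrite !quotE mulr1. Qed.
Lemma quot_mulDl : left_distributive quot_mul +%R.
Proof. by do 3!elim/quot_ind=> ?; rewrite /+%R /= !quotE mulrDl. Qed.
Lemma quot_mulDr : right_distributive quot_mul +%R.
Proof. by do 3!elim/quot_ind=> ?; rewrite /+%R /= !quotE mulrDr. Qed.
Lemma quot_1neq0 : quot_pi 1 != 0.
Proof. by apply/eqP => /quot_piP; rewrite subr0; apply: ideal2_1. Qed.

HB.instance Definition _ := GRing.Zmodule_isNzRing.Build quot_alg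
  quot_mulA quot_mul1 quot_mulr1 quot_mulDl quot_mulDr quot_1neq0.

Lemma quot_scaleA a b g : quot_scale a (quot_scale b g) = quot_scale (a * b) g.
Proof. by elim/quot_ind: g => ?; rewrite !quotE scalerA. Qed.
Lemma quot_scale1 : left_id 1 quot_scale.
Proof. by elim/quot_ind=> ?; rewrite !quotE scale1r. Qed.
Lemma quot_scaleDr : right_distributive quot_scale +%R.
Proof. by move=> c; do 2!elim/quot_ind=> ?; rewrite /+%R /= !quotE scalerDr. Qed.
Lemma quot_scaleDl g :
  {morph quot_scale^~ g : a b / a + b >-> a + b}.
Proof.
by elim/quot_ind: g => x a b; rewrite !quotE scalerDl [RHS]quot_addE.
Qed.

HB.instance Definition _ := GRing.Zmodule_isLmodule.Build K quot_alg
  quot_scaleA quot_scale1 quot_scaleDr quot_scaleDl.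

Lemma quot_scaleAl (c : K) (g h : quot_alg) : c *: (g * h) = (c *: g) * h.
Proof.
elim/quot_ind: g => x; elim/quot_ind: h => y.
by rewrite /*:%R /*%R /= !quotE scalerAl.
Qed.

HB.instance Definition _ := GRing.Lmodule_isLalgebra.Build K quot_alg
  quot_scaleAl.

Lemma quot_scaleAr (c : K) (g h : quot_alg) : c *: (g * h) = g * (c *: h).
Proof.
elim/quot_ind: g => x; elim/quot_ind: h => y.
by rewrite /*:%R /*%R /= !quotE scalerAr.
Qed.

HB.instance Definition _ := GRing.Lalgebra_isAlgebra.Build K quot_alg
  quot_scaleAr.

Lemma quot_piD : {morph quot_pi : x y / x + y}.
Proof. by move=> x y; rewrite -quot_addE. Qed.
Lemma quot_piM : {morph quot_pi : x y / x * y}.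
Proof. by move=> x y; rewrite -quot_mulE. Qed.
Lemma quot_piZ c : {morph quot_pi : x / c *: x}.
Proof. by move=> x; rewrite -quot_scaleE. Qed.
Lemma quot_pi1 : quot_pi 1 = 1.
Proof. by []. Qed.
Lemma quot_pi0 : quot_pi 0 = 0.
Proof. by []. Qed.

End AlgebraQuotient.

Section FreeAlgebra.
Variables (K : fieldType) (I : choiceType).

(* The free associative algebra: [{fmonom I}] is the free monoid on [I]. *)
Definition free_alg : Type := {malg K[{fmonom I}]}.

HB.instance Definition _ := GRing.Lalgebra.on free_alg.

Lemma free_mulUU (a b : K) (v w : {fmonom I}) :
  << a *g v >> * << b *g w >> = << a * b *g mmul v w >> :> {malg K[{fmonom I}]}.
Proof. by rewrite malgM_def fgmulUU. Qed.

Lemma free_scaleU (a b : K) (w : {fmonom I}) :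
  a *: << b *g w >> = << a * b *g w >> :> {malg K[{fmonom I}]}.
Proof. by apply/malgP => v; rewrite mcoeffZ !mcoeffU mulrnAr. Qed.

Lemma free_scaleAr (c : K) (x y : free_alg) : c *: (x * y) = x * (c *: y).
Proof.
rewrite [x]monalgE [y]monalgE !mulr_suml !scaler_sumr.
apply: eq_bigr => v _; rewrite !mulr_sumr !scaler_sumr.
by apply: eq_bigr => w _; rewrite !(free_mulUU, free_scaleU) mulrCA.
Qed.

HB.instance Definition _ :=
  GRing.Lalgebra_isAlgebra.Build K free_alg free_scaleAr.

Definition free_gen (i : I) : free_alg := << fmu i >>.

Variable f : I -> K.

Definition word_eval (w : {fmonom I}) : K := \prod_(i <- (w : seq I)) f i.

Lemma word_eval_mmorphism : mmorphism word_eval.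
Proof.
split=> [v w|]; rewrite /word_eval; first by rewrite fmM big_cat.
by rewrite fm1 big_nil.
Qed.

HB.instance Definition _ :=
  monalg.isMultiplicative.Build {fmonom I} K word_eval word_eval_mmorphism.

Definition free_eval (x : free_alg) : K := mmap idfun word_eval x.

Lemma free_evalD : {morph free_eval : x y / x + y}.
Proof. exact: mmapD. Qed.
Lemma free_evalB : {morph free_eval : x y / x - y}.
Proof. exact: mmapB. Qed.
Lemma free_evalN : {morph free_eval : x / - x}.
Proof. exact: mmapN. Qed.
Lemma free_evalM : {morph free_eval : x y / x * y}.
Proof. by move=> x y; rewrite /free_eval -rmorphM. Qed.
Lemma free_evalZ c : {morph free_eval : x / c *: x >-> c * x}.
Proof. by move=> x; rewrite /free_eval mmapZ. Qed.
Lemma free_eval1 : free_eval 1 = 1.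
Proof. by rewrite /free_eval mmap1. Qed.
Lemma free_eval0 : free_eval 0 = 0.
Proof. by rewrite /free_eval mmap0. Qed.
Lemma free_eval_gen i : free_eval (free_gen i) = f i.
Proof. by rewrite /free_eval mmapU mul1r /word_eval fmU big_seq1. Qed.

End FreeAlgebra.

(* Carrier of the (unital) subalgebra of [A] generated by [S]. *)
Inductive subalg_gen (K : fieldType) (A : algType K) (S : A -> Prop) : A -> Prop :=
| subalg_gen_in x : S x -> subalg_gen S x
| subalg_gen_1 : subalg_gen S 1
| subalg_gen_D x y : subalg_gen S x -> subalg_gen S y -> subalg_gen S (x + y)
| subalg_gen_Z c x : subalg_gen S x -> subalg_gen S (c *: x)
| subalg_gen_M x y : subalg_gen S x -> subalg_gen S y -> subalg_gen S (x * y).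

Inductive ideal2_gen (A : nzRingType) (S : A -> Prop) : A -> Prop :=
| ideal2_gen_in x : S x -> ideal2_gen S x
| ideal2_gen_0 : ideal2_gen S 0
| ideal2_gen_B x y : ideal2_gen S x -> ideal2_gen S y -> ideal2_gen S (x - y)
| ideal2_gen_Ml a x : ideal2_gen S x -> ideal2_gen S (a * x)
| ideal2_gen_Mr a x : ideal2_gen S x -> ideal2_gen S (x * a).

(* A set of relations on free generators, together with a character of the     *)
(* free algebra killing them. The character does not affect the presented      *)
(* algebra; it only certifies that the latter is nonzero.                      *)
Record presentation (K : fieldType) (I : choiceType) := Presentation {
  pres_rel : free_alg K I -> Prop;
  pres_chi : I -> K;
  pres_chiP : forall r, pres_rel r -> free_eval pres_chi r = 0 }.

Section PresentedAlgebra.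
Variables (K : fieldType) (I : choiceType) (P : presentation K I).

Lemma pres_chi_ideal x : ideal2_gen (pres_rel P) x -> free_eval (pres_chi P) x = 0.
Proof.
elim=> {x} [x /pres_chiP //||x y _ x0 _ y0|a x _ x0|a x _ x0].
- exact: free_eval0.
- by rewrite free_evalB x0 y0 subr0.
- by rewrite free_evalM x0 mulr0.
- by rewrite free_evalM x0 mul0r.
Qed.

Lemma pres_ideal_1 : ~ ideal2_gen (pres_rel P) 1.
Proof. by move/pres_chi_ideal/eqP; rewrite free_eval1 oner_eq0. Qed.

Definition pres_ideal : proper_ideal2 (free_alg K I) :=
  ProperIdeal2 (ideal2_gen_0 _) (@ideal2_gen_B _ _) (@ideal2_gen_Ml _ _)
    (@ideal2_gen_Mr _ _) pres_ideal_1.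

Definition presented : Type := quot_alg pres_ideal.

HB.instance Definition _ := GRing.Algebra.on presented.

Definition pgen (i : I) : presented := quot_pi pres_ideal (free_gen K i).

Lemma presented_gen x : subalg_gen (fun y => exists i, y = pgen i) x.
Proof.
elim/quot_ind: x => x.
have s0 : subalg_gen (fun y => exists i, y = pgen i) 0.
  by rewrite -(scale0r 1); apply/subalg_gen_Z/subalg_gen_1.
rewrite [x]monalgE.
elim/big_rec: _ => [|w y _ IHy]; first exact: s0.
rewrite quot_piD; apply: subalg_gen_D => //.
move: (x@_w) => c; rewrite -[c]mulr1 -free_scaleU quot_piZ; apply: subalg_gen_Z.
case: w => w; elim: w => [|i w IHw].
  by rewrite -fmoneE; apply: subalg_gen_1.
have -> : FMonom (i :: w) = mmul (fmu i) (FMonom w).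
  by apply/val_inj; rewrite /= fmM fmU.
rewrite -[X in << X *g _ >>]mulr1 -free_mulUU quot_piM; apply: subalg_gen_M => //.
by apply: subalg_gen_in; exists i.
Qed.

(* The character of the presented algebra induced by [pres_chi]. *)
Definition pchar (x : presented) : K := free_eval (pres_chi P) (repr x).

Lemma pchar_pi x : pchar (quot_pi pres_ideal x) = free_eval (pres_chi P) x.
Proof.
apply/eqP; rewrite -subr_eq0 -free_evalB; apply/eqP/pres_chi_ideal.
exact: (quot_repr_pi pres_ideal).
Qed.

Lemma pchar_gen i : pchar (pgen i) = pres_chi P i.
Proof. by rewrite pchar_pi free_eval_gen. Qed.

Lemma pcharM x y : pchar (x * y) = pchar x * pchar y.
Proof.
elim/quot_ind: x => x; elim/quot_ind: y => y.
by rewrite -quot_piM !pchar_pi free_evalM.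
Qed.

Lemma pcharD x y : pchar (x + y) = pchar x + pchar y.
Proof.
elim/quot_ind: x => x; elim/quot_ind: y => y.
by rewrite -quot_piD !pchar_pi free_evalD.
Qed.

Lemma pcharZ c x : pchar (c *: x) = c * pchar x.
Proof. by elim/quot_ind: x => x; rewrite -quot_piZ !pchar_pi free_evalZ. Qed.

Lemma pchar1 : pchar 1 = 1.
Proof. by rewrite -[1]/(quot_pi pres_ideal 1) pchar_pi free_eval1. Qed.

End PresentedAlgebra.

(* [Delta x s] means that the coproduct of [x] is the sum of the tensors of the *)
(* pairs in [s], so that [mact_Delta] is the compatibility of the action with   *)
(* products in Sweedler notation.                                               *)
Record module_algebra (K : fieldType) (H : algType K)
    (Delta : H -> seq (H * H) -> Prop) (eps : H -> K) (A : algType K) :=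
  ModuleAlgebra {
    mact :> H -> A -> A;
    mact_linearl : forall v c x y,
      mact (c *: x + y) v = c *: mact x v + mact y v;
    mact_linearr : forall x c u v,
      mact x (c *: u + v) = c *: mact x u + mact x v;
    mact_1 : forall v, mact 1 v = v;
    mact_M : forall x y v, mact (x * y) v = mact x (mact y v);
    mact_Delta : forall x s, Delta x s -> forall u v,
      mact x (u * v) = \sum_(p <- s) mact p.1 u * mact p.2 v;
    mact_eps : forall x, mact x 1 = eps x *: 1 }.

Definition action_invariant (K : fieldType) (H : algType K) Delta eps (A : algType K)
    (act : @module_algebra K H Delta eps A) (v : A) : Prop :=
  forall x : H, act x v = eps x *: v.

Section Filtrations.
Variables (K : fieldType) (A : algType K).

Record filtration := Filtration {
  filt :> nat -> A -> Prop;
  filt_0 : forall d, filt d 0;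
  filt_D : forall d x y, filt d x -> filt d y -> filt d (x + y);
  filt_Z : forall d c x, filt d x -> filt d (c *: x);
  filt_S : forall d x, filt d x -> filt d.+1 x;
  filt_1 : filt 0 1;
  filt_M : forall d e x y, filt d x -> filt e y -> filt (d + e)%N (x * y) }.

Variable F : filtration.

Lemma filt_N d x : F d x -> F d (- x).
Proof. by rewrite -scaleN1r; apply: filt_Z. Qed.

Lemma filt_sum d (J : Type) (r : seq J) (f : J -> A) :
  (forall j, F d (f j)) -> F d (\sum_(j <- r) f j).
Proof.
move=> Ff; elim/big_rec: _ => [|j x _ Fx]; first exact: filt_0.
exact: filt_D.
Qed.

Definition filt_pred (d : nat) (x : A) : Prop :=
  if d is d'.+1 then F d' x else x = 0.

(* The Rees algebra: polynomials whose coefficient of degree [d] lies in       *)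
(* [F d]. The associated graded algebra is its quotient by the ideal of those  *)
(* whose coefficient of degree [d] lies in [F (d - 1)]; as a vector space this *)
(* is the direct sum of the [F d / F (d - 1)].                                 *)
Definition rees_mem : {pred {poly A}} := fun p => `[< forall d, F d p`_d >].

Lemma rees_subring : subring_closed rees_mem.
Proof.
split=> [|p r /asboolP Fp /asboolP Fr|p r /asboolP Fp /asboolP Fr]; apply/asboolP => d.
- by rewrite coef1; case: d => [|d]; [apply: filt_1 | apply: filt_0].
- by rewrite coefB; apply: filt_D => //; apply: filt_N.
- rewrite coefM; apply: filt_sum => i.
  by rewrite -[X in F X](subnKC (ltn_ord i : (i <= d)%N)); apply: filt_M.
Qed.

HB.instance Definition _ := GRing.isSubringClosed.Build {poly A} rees_mem
  rees_subring.

Record rees := Rees { rees_val : {poly A}; rees_valP : rees_val \in rees_mem }.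

HB.instance Definition _ := [isSub for rees_val].
HB.instance Definition _ := [Choice of rees by <:].
HB.instance Definition _ := [SubChoice_isSubNzRing of rees by <:].

Lemma reesP (p : rees) d : F d (rees_val p)`_d.
Proof. by case: p => p /= /asboolP. Qed.

Lemma rees_scale_subproof (c : K) (p : rees) :
  c%:A *: rees_val p \in rees_mem.
Proof.
apply/asboolP => d; rewrite coefZ mulr_algl.
exact/filt_Z/reesP.
Qed.

Definition rees_scale c p : rees := Rees (rees_scale_subproof c p).

Lemma rees_scaleA a b p : rees_scale a (rees_scale b p) = rees_scale (a * b) p.
Proof.
by apply/val_inj; rewrite /= scalerA mulr_algl scalerA.
Qed.
Lemma rees_scale1 : left_id 1 rees_scale.
Proof. by move=> p; apply/val_inj; rewrite /= !scale1r. Qed.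
Lemma rees_scaleDr : right_distributive rees_scale +%R.
Proof. by move=> c p r; apply/val_inj; rewrite /= scalerDr. Qed.
Lemma rees_scaleDl p : {morph rees_scale^~ p : a b / a + b >-> a + b}.
Proof. by move=> a b; apply/val_inj; rewrite /= !scalerDl. Qed.

HB.instance Definition _ := GRing.Zmodule_isLmodule.Build K rees
  rees_scaleA rees_scale1 rees_scaleDr rees_scaleDl.

Lemma rees_scaleAl (c : K) (p r : rees) : c *: (p * r) = (c *: p) * r.
Proof. by apply/val_inj; rewrite /= scalerAl. Qed.

HB.instance Definition _ := GRing.Lmodule_isLalgebra.Build K rees rees_scaleAl.

Lemma rees_scaleAr (c : K) (p r : rees) : c *: (p * r) = p * (c *: r).
Proof.
apply/val_inj/polyP => d; rewrite /= coefZ !coefM mulr_sumr.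
by apply: eq_bigr => i _; rewrite coefZ !mulr_algl scalerAr.
Qed.

HB.instance Definition _ := GRing.Lalgebra_isAlgebra.Build K rees rees_scaleAr.

Definition gr_ideal_mem (p : rees) : Prop :=
  forall d, filt_pred d (rees_val p)`_d.

Lemma filt_pred_0 d : filt_pred d 0.
Proof. by case: d => // d; apply: filt_0. Qed.

Lemma filt_predD d x y : filt_pred d x -> filt_pred d y -> filt_pred d (x + y).
Proof. by case: d => [->->|d]; [rewrite addr0 | apply: filt_D]. Qed.

Lemma filt_predN d x : filt_pred d x -> filt_pred d (- x).
Proof. by case: d => [->|d]; [rewrite /= oppr0 | apply: filt_N]. Qed.

Lemma filt_predMr d e x y : filt_pred d x -> F e y -> filt_pred (d + e)%N (x * y).
Proof.
by case: d => [-> _|d Fx Fy]; [rewrite mul0r; apply: filt_pred_0 | apply: filt_M].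
Qed.

Lemma filt_predMl d e x y : F d x -> filt_pred e y -> filt_pred (d + e)%N (x * y).
Proof.
case: e => [_ ->|e Fx Fy]; first by rewrite mulr0; apply: filt_pred_0.
by rewrite addnS; apply: filt_M.
Qed.

Lemma filt_pred_sum d (J : Type) (r : seq J) (f : J -> A) :
  (forall j, filt_pred d (f j)) -> filt_pred d (\sum_(j <- r) f j).
Proof.
move=> Ff; elim/big_rec: _ => [|j x _ Fx]; first exact: filt_pred_0.
exact: filt_predD.
Qed.

Lemma gr_ideal_0 : gr_ideal_mem 0.
Proof. by move=> d; rewrite coef0; apply: filt_pred_0. Qed.
Lemma gr_ideal_B p r : gr_ideal_mem p -> gr_ideal_mem r -> gr_ideal_mem (p - r).
Proof.
by move=> Jp Jr d; rewrite coefB; apply: filt_predD => //; apply: filt_predN.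
Qed.
Lemma gr_ideal_Ml a p : gr_ideal_mem p -> gr_ideal_mem (a * p).
Proof.
move=> Jp d; rewrite coefM; apply: filt_pred_sum => i.
rewrite -[X in filt_pred X](subnKC (ltn_ord i : (i <= d)%N)).
by apply: filt_predMl; first exact: reesP.
Qed.
Lemma gr_ideal_Mr a p : gr_ideal_mem p -> gr_ideal_mem (p * a).
Proof.
move=> Jp d; rewrite coefM; apply: filt_pred_sum => i.
rewrite -[X in filt_pred X](subnKC (ltn_ord i : (i <= d)%N)).
by apply: filt_predMr; last exact: reesP.
Qed.
Lemma gr_ideal_1 : ~ gr_ideal_mem 1.
Proof. by move/(_ 0%N); rewrite coef1 /=; apply/eqP/oner_neq0. Qed.

Definition gr_ideal : proper_ideal2 rees :=
  ProperIdeal2 gr_ideal_0 gr_ideal_B gr_ideal_Ml gr_ideal_Mr gr_ideal_1.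

Definition gr : Type := quot_alg gr_ideal.

HB.instance Definition _ := GRing.Algebra.on gr.

Lemma rees_monomial_subproof d x : F d x -> x *: 'X^d \in rees_mem.
Proof.
move=> Fx; apply/asboolP => e; rewrite coefZ coefXn.
by case: eqP => [->|_]; rewrite ?mulr1 ?mulr0 //; apply: filt_0.
Qed.

(* The class of [x] in [F d / F (d - 1)]. *)
Definition gr_class d x (Fx : F d x) : gr :=
  quot_pi gr_ideal (Rees (rees_monomial_subproof Fx)).

Lemma gr_class_eq d x y (Fx : F d x) (Fy : F d y) :
  gr_class Fx = gr_class Fy <-> filt_pred d (x - y).
Proof.
rewrite quot_piP; split=> [/(_ d)|Fxy e] /=; rewrite coefB !coefZ !coefXn.
  by rewrite eqxx !mulr1.
by case: eqP => [->|_]; rewrite ?mulr1 // !mulr0 subr0; apply: filt_pred_0.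
Qed.

End Filtrations.

Section GradedAction.
Variables (K : fieldType) (H : algType K) (Delta : H -> seq (H * H) -> Prop).
Variables (eps : H -> K) (A : algType K) (F : filtration A).
Variable act : module_algebra Delta eps A.
Hypothesis actF : forall x d v, F d v -> F d (act x v).

Lemma mact_0 x : act x 0 = 0.
Proof. by have := mact_linearr act x (-1) 0 0; rewrite scaler0 addr0 scaleN1r addNr. Qed.

Lemma mact_D x : {morph act x : u v / u + v}.
Proof. by move=> u v; rewrite -[u]scale1r mact_linearr !scale1r. Qed.

Lemma mact_Z x c v : act x (c *: v) = c *: act x v.
Proof. by rewrite -[c *: v]addr0 mact_linearr mact_0 addr0. Qed.

Lemma mact_B x : {morph act x : u v / u - v}.
Proof. by move=> u v; rewrite mact_D -scaleN1r mact_Z scaleN1r. Qed.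

Lemma mact_sum x (J : Type) (r : seq J) (f : J -> A) :
  act x (\sum_(j <- r) f j) = \sum_(j <- r) act x (f j).
Proof. exact: (big_morph _ (mact_D x) (mact_0 x)). Qed.

Lemma mact_inv x y u c :
  y * x = 1 -> c != 0 -> act x u = c *: u -> act y u = c^-1 *: u.
Proof.
move=> yx c0 xu; rewrite -[RHS](mact_1 act) -yx mact_M mact_Z xu.
by rewrite scalerA mulVf // scale1r.
Qed.

Lemma mact_0l v : act 0 v = 0.
Proof. by have := mact_linearl act v (-1) 1 1; rewrite !scaleN1r !addNr. Qed.

Lemma rees_act_subproof x (p : rees F) : map_poly (act x) (rees_val p) \in rees_mem F.
Proof.
apply/asboolP => d; rewrite coef_map_id0; last exact: mact_0.
exact/actF/reesP.
Qed.

Definition rees_act x p : rees F := Rees (rees_act_subproof x p).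

Lemma rees_actE x p d : (rees_val (rees_act x p))`_d = act x (rees_val p)`_d.
Proof. by rewrite coef_map_id0 //; apply: mact_0. Qed.

Definition gr_mact x (g : gr F) : gr F := quot_pi (gr_ideal F) (rees_act x (repr g)).

Lemma gr_mactE x p :
  gr_mact x (quot_pi (gr_ideal F) p) = quot_pi (gr_ideal F) (rees_act x p).
Proof.
apply/quot_piP => d; rewrite coefB !rees_actE.
have := quot_repr_pi (gr_ideal F) p => /(_ d); rewrite coefB.
set u := (rees_val _)`_d; set v := (rees_val p)`_d.
rewrite -mact_B.
by case: d @u @v => [u v /= ->|d u v /= /actF //]; apply: mact_0.
Qed.

Lemma gr_mact_linearl g c x y :
  gr_mact (c *: x + y) g = c *: gr_mact x g + gr_mact y g.
Proof.
elim/quot_ind: g => p; rewrite !gr_mactE -quot_piZ -quot_piD; congr quot_pi.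
apply/val_inj/polyP => d.
by rewrite rees_actE coefD /= coefZ !rees_actE mact_linearl mulr_algl.
Qed.

Lemma gr_mact_linearr x c g h :
  gr_mact x (c *: g + h) = c *: gr_mact x g + gr_mact x h.
Proof.
elim/quot_ind: g => p; elim/quot_ind: h => r.
rewrite -quot_piZ -quot_piD !gr_mactE -quot_piZ -quot_piD; congr quot_pi.
apply/val_inj/polyP => d.
by rewrite rees_actE /= !coefD !coefZ !rees_actE !mulr_algl mact_linearr.
Qed.

Lemma gr_mact_1 g : gr_mact 1 g = g.
Proof.
elim/quot_ind: g => p; rewrite gr_mactE; congr quot_pi.
by apply/val_inj/polyP => d; rewrite rees_actE mact_1.
Qed.

Lemma gr_mact_M x y g : gr_mact (x * y) g = gr_mact x (gr_mact y g).
Proof.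
elim/quot_ind: g => p; rewrite !gr_mactE; congr quot_pi.
by apply/val_inj/polyP => d; rewrite !rees_actE mact_M.
Qed.

Lemma gr_mact_Delta x s : Delta x s -> forall g h,
  gr_mact x (g * h) = \sum_(p <- s) gr_mact p.1 g * gr_mact p.2 h.
Proof.
move=> Dxs; elim/quot_ind=> p; elim/quot_ind=> r.
under eq_bigr do rewrite !gr_mactE -quot_piM.
rewrite -quot_piM gr_mactE.
rewrite -(big_morph _ (quot_piD (gr_ideal F)) (quot_pi0 _)); congr quot_pi.
apply/val_inj/polyP => d; rewrite rees_actE /= coefM mact_sum.
rewrite (big_morph (@rees_val K A F) (id1 := 0) (op1 := +%R)) // coef_sum.
under eq_bigr do rewrite (mact_Delta act Dxs).
rewrite exchange_big; apply: eq_bigr => j _ /=.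
by rewrite coefM; apply: eq_bigr => i _; rewrite !rees_actE.
Qed.

Lemma gr_mact_eps x : gr_mact x 1 = eps x *: 1.
Proof.
rewrite -[1]/(quot_pi (gr_ideal F) 1) gr_mactE -quot_piZ; congr quot_pi.
apply/val_inj/polyP => d; rewrite rees_actE /= coefZ !coef1 mulr_algl.
by case: d => [|d]; [rewrite mact_eps | rewrite mact_0 scaler0].
Qed.

Definition gr_act : module_algebra Delta eps (gr F) :=
  ModuleAlgebra gr_mact_linearl gr_mact_linearr gr_mact_1 gr_mact_M
    gr_mact_Delta gr_mact_eps.

Lemma gr_act_class x d v (Fv : F d v) :
  gr_act x (gr_class Fv) = gr_class (actF x Fv).
Proof.
rewrite /= gr_mactE; congr quot_pi; apply/val_inj/polyP => e.
rewrite rees_actE /= !coefZ !coefXn.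
by case: eqP => _; rewrite ?mulr1 // !mulr0 mact_0.
Qed.

End GradedAction.

(* The span of the products of at most [d] elements of [S]. *)
Inductive degree_le (K : fieldType) (A : algType K) (S : A -> Prop) (d : nat) :
    A -> Prop :=
| degree_le_0 : degree_le S d 0
| degree_le_D x y : degree_le S d x -> degree_le S d y -> degree_le S d (x + y)
| degree_le_Z c x : degree_le S d x -> degree_le S d (c *: x)
| degree_le_prod (s : seq A) : (size s <= d)%N -> {in s, forall x, S x} ->
    degree_le S d (\prod_(x <- s) x).

Section DegreeFiltration.
Variables (K : fieldType) (A : algType K) (S : A -> Prop).

Lemma degree_le_S d x : degree_le S d x -> degree_le S d.+1 x.
Proof.
elim=> {x} [|x y _ ? _ ?|c x _ ?|s sd sS].
- exact: degree_le_0.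
- exact: degree_le_D.
- exact: degree_le_Z.
- exact/degree_le_prod/sS/leqW.
Qed.

Lemma degree_le_1 : degree_le S 0 1.
Proof. by have := @degree_le_prod K A S 0 [::]; rewrite big_nil; apply. Qed.

Lemma degree_le_M d e x y :
  degree_le S d x -> degree_le S e y -> degree_le S (d + e)%N (x * y).
Proof.
move=> Sx Sy; elim: Sx => {x} [|x x' _ ? _ ?|c x _ ?|s sd sS].
- by rewrite mul0r; apply: degree_le_0.
- by rewrite mulrDl; apply: degree_le_D.
- by rewrite -scalerAl; apply: degree_le_Z.
elim: Sy => {y} [|y y' _ ? _ ?|c y _ ?|s' s'e s'S].
- by rewrite mulr0; apply: degree_le_0.
- by rewrite mulrDr; apply: degree_le_D.
- by rewrite -scalerAr; apply: degree_le_Z.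
rewrite -big_cat; apply: degree_le_prod; first by rewrite size_cat leq_add.
by move=> x; rewrite mem_cat => /orP[/sS|/s'S].
Qed.

Definition degree_filtration : filtration A :=
  Filtration (degree_le_0 S) (@degree_le_D K A S) (@degree_le_Z K A S)
    degree_le_S degree_le_1 degree_le_M.

Lemma degree_le_gen x : S x -> degree_filtration 1 x.
Proof.
move=> Sx; have -> : x = \prod_(y <- [:: x]) y by rewrite big_seq1.
apply: degree_le_prod => // y.
by rewrite inE => /eqP->.
Qed.

Lemma degree_filtrationE x :
  subalg_gen S x <-> exists d, degree_filtration d x.
Proof.
split.
  elim=> {x} [x Sx||x y _ [d Fx] _ [e Fy]|c x _ [d Fx]|x y _ [d Fx] _ [e Fy]].
  - by exists 1%N; apply: degree_le_gen.
  - by exists 0%N; apply: filt_1.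
  - have up z i j : degree_filtration i z -> degree_filtration (i + j)%N z.
      by move=> Fz; elim: j => [|j]; rewrite ?addn0 ?addnS // => /degree_le_S.
    by exists (d + e)%N; apply: filt_D; [|rewrite addnC]; apply: up.
  - by exists d; apply: filt_Z.
  - by exists (d + e)%N; apply: filt_M.
case=> d; elim=> {x} [|x y _ ? _ ?|c x _ ?|s _ sS].
- by rewrite -(scale0r 1); apply/subalg_gen_Z/subalg_gen_1.
- exact: subalg_gen_D.
- exact: subalg_gen_Z.
rewrite big_seq; elim/big_rec: _ => [|y z /sS Sy Sz]; first exact: subalg_gen_1.
by apply: subalg_gen_M => //; apply: subalg_gen_in.
Qed.

End DegreeFiltration.

Lemma degree_filtration_coproduct (K : fieldType) (H : algType K)
    (Delta : H -> seq (H * H) -> Prop) (eps : H -> K) (A : algType K)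
    (S : A -> Prop) (act : module_algebra Delta eps A) x s : Delta x s ->
  (forall p, p \in s ->
     (forall u, S u -> degree_filtration S 1 (act p.1 u)) /\
     (p.2 = x \/ forall d v,
        degree_filtration S d v -> degree_filtration S d (act p.2 v))) ->
  forall d v, degree_filtration S d v -> degree_filtration S d (act x v).
Proof.
move=> Dxs Hs d v; elim=> {v} [|u v _ ? _ ?|c v _ ?|r rd rS].
- by rewrite mact_0; apply: degree_le_0.
- by rewrite mact_D; apply: degree_le_D.
- by rewrite mact_Z; apply: degree_le_Z.
elim: r d rd rS => [|u r IHr] d rd rS.
  rewrite big_nil mact_eps; apply: degree_le_Z.
  by have := @degree_le_prod _ _ S d [::]; rewrite big_nil; apply.
case: d rd => // d rd.
have rS' : {in r, forall v, S v} by move=> v vr; apply: rS; rewrite inE vr orbT.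
have uS : S u by apply: rS; rewrite inE eqxx.
rewrite big_cons (mact_Delta act Dxs) big_seq.
elim/big_rec: _ => [|p v ps Fv]; first exact: degree_le_0.
apply: degree_le_D => //; have [Fp1 Fp2] := Hs p ps; rewrite -add1n.
apply: degree_le_M; first exact: Fp1.
by case: Fp2 => [->|Fp2]; [apply: IHr | apply: Fp2; apply: degree_le_prod].
Qed.

(* Generators of U_q(gl_n), with indices starting from 0: [UE i] and [UF i]    *)
(* stand for E_(i+1), F_(i+1); [UK false i] and [UK true i] stand for          *)
(* K_(eps_(i+1)) and its inverse.                                               *)
Inductive Uq_index (n : nat) : Type :=
| UE of 'I_n.-1
| UF of 'I_n.-1
| UK of bool & 'I_n.
Arguments UE {n}. Arguments UF {n}. Arguments UK {n}.

Definition Uq_index_code n (g : Uq_index n) : 'I_n.-1 + 'I_n.-1 + bool * 'I_n :=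
  match g with UE i => inl (inl i) | UF i => inl (inr i) | UK b i => inr (b, i) end.
Definition Uq_index_decode n (c : 'I_n.-1 + 'I_n.-1 + bool * 'I_n) : Uq_index n :=
  match c with
  | inl (inl i) => UE i | inl (inr i) => UF i | inr (b, i) => UK b i end.
Lemma Uq_index_codeK n : cancel (@Uq_index_code n) (@Uq_index_decode n).
Proof. by case. Qed.
HB.instance Definition _ n := Choice.copy (Uq_index n) (can_type (@Uq_index_codeK n)).

(* For a simple root index [i : 'I_n.-1], [lo i] and [hi i] are [i] and [i+1]  *)
(* as elements of ['I_n].                                                       *)
Lemma hi_subproof n (i : 'I_n.-1) : (i.+1 < n)%N.
Proof. by case: n i => [[]|n] i //=; rewrite ltnS. Qed.
Definition lo n (i : 'I_n.-1) : 'I_n := widen_ord (leq_pred n) i.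
Definition hi n (i : 'I_n.-1) : 'I_n := Ordinal (hi_subproof i).

Section QuantumGroupRelations.
Variables (K : fieldType) (q : K) (n : nat).
Variables (A : algType K) (X : Uq_index n -> A).

Local Notation E i := (X (UE i)).
Local Notation F i := (X (UF i)).
Local Notation Ke i := (X (UK false i)).
Local Notation Ke' i := (X (UK true i)).

Inductive Uq_rel : A -> Prop :=
| Uq_KK (b c : bool) (i j : 'I_n) :
    Uq_rel (X (UK b i) * X (UK c j) - X (UK c j) * X (UK b i))
| Uq_KV (i : 'I_n) : Uq_rel (Ke i * Ke' i - 1)
| Uq_KE (i : 'I_n) (j : 'I_n.-1) :
    Uq_rel (Ke i * E j * Ke' i - (q ^+ (i == lo j) / q ^+ (i == hi j)) *: E j)
| Uq_KF (i : 'I_n) (j : 'I_n.-1) :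
    Uq_rel (Ke i * F j * Ke' i - (q ^+ (i == hi j) / q ^+ (i == lo j)) *: F j)
| Uq_EF (i j : 'I_n.-1) :
    Uq_rel (E i * F j - F j * E i
            - ((i == j)%:R / (q - q^-1)) *:
              (Ke (lo i) * Ke' (hi i) - Ke (hi i) * Ke' (lo i)))
| Uq_EE (i j : 'I_n.-1) : (i.+1 < j)%N -> Uq_rel (E i * E j - E j * E i)
| Uq_FF (i j : 'I_n.-1) : (i.+1 < j)%N -> Uq_rel (F i * F j - F j * F i)
| Uq_SerreE (i j : 'I_n.-1) : i.+1 = j :> nat \/ j.+1 = i :> nat ->
    Uq_rel (E i ^+ 2 * E j - (q + q^-1) *: (E i * E j * E i) + E j * E i ^+ 2)
| Uq_SerreF (i j : 'I_n.-1) : i.+1 = j :> nat \/ j.+1 = i :> nat ->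
    Uq_rel (F i ^+ 2 * F j - (q + q^-1) *: (F i * F j * F i) + F j * F i ^+ 2).

Definition Uq_chi (g : Uq_index n) : K :=
  match g with UK _ _ => 1 | _ => 0 end.

Variable ev : A -> K.
Hypothesis evD : {morph ev : x y / x + y}.
Hypothesis evN : {morph ev : x / - x}.
Hypothesis evM : {morph ev : x y / x * y}.
Hypothesis evZ : forall c, {morph ev : x / c *: x >-> c * x}.
Hypothesis ev1 : ev 1 = 1.
Hypothesis evX : forall g, ev (X g) = Uq_chi g.

Lemma Uq_chiP r : Uq_rel r -> ev r = 0.
Proof.
case=> [b c i j|i|i j|i j|i j|i j _|i j _|i j _|i j _]; rewrite ?expr2 !(evD, evN, evM, evZ, ev1, evX) /=.
- by rewrite subrr.
- by rewrite mulr1 subrr.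
- by rewrite !(mulr0, mul0r) subrr.
- by rewrite !(mulr0, mul0r) subrr.
- by rewrite !(mulr0, mulr1, subrr).
- by rewrite !(mulr0, subrr).
- by rewrite !(mulr0, subrr).
- by rewrite !(mulr0, mul0r, subrr, addr0).
- by rewrite !(mulr0, mul0r, subrr, addr0).
Qed.

End QuantumGroupRelations.

(* [inl (i, j)] is the index of t_(i+1,j+1), [inr (i, j)] that of              *)
(* d_(i+1,j+1).                                                                 *)
Definition PD_index (m n : nat) : Type := ('I_m * 'I_n + 'I_m * 'I_n)%type.
HB.instance Definition _ m n := Choice.on (PD_index m n).

Section QuantizedWeylRelations.
Variables (K : fieldType) (q : K) (m n : nat).
Variables (A : algType K) (X : PD_index m n -> A).

Local Notation t i j := (X (inl (i, j))).
Local Notation d i j := (X (inr (i, j))).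

Inductive PD_rel : A -> Prop :=
| PD_R1row k (i j : 'I_n) : (i < j)%N ->
    PD_rel (t k i * t k j - q *: (t k j * t k i))
| PD_R1col k (i j : 'I_m) : (i < j)%N ->
    PD_rel (t i k * t j k - q *: (t j k * t i k))
| PD_R2comm (i k : 'I_m) (j l : 'I_n) : (i < k)%N -> (j < l)%N ->
    PD_rel (t i l * t k j - t k j * t i l)
| PD_R2 (i k : 'I_m) (j l : 'I_n) : (i < k)%N -> (j < l)%N ->
    PD_rel (t i j * t k l - t k l * t i j - (q - q^-1) *: (t i l * t k j))
| PD_R1'row k (i j : 'I_n) : (i < j)%N ->
    PD_rel (d k j * d k i - q *: (d k i * d k j))
| PD_R1'col k (i j : 'I_m) : (i < j)%N ->
    PD_rel (d j k * d i k - q *: (d i k * d j k))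
| PD_R2'comm (i k : 'I_m) (j l : 'I_n) : (i < k)%N -> (j < l)%N ->
    PD_rel (d k j * d i l - d i l * d k j)
| PD_R2' (i k : 'I_m) (j l : 'I_n) : (i < k)%N -> (j < l)%N ->
    PD_rel (d k l * d i j - d i j * d k l - (q - q^-1) *: (d k j * d i l))
| PD_R3 (c e : 'I_m) (a b : 'I_n) : b != a -> c != e ->
    PD_rel (d c b * t e a - t e a * d c b)
| PD_R4 (c : 'I_m) (a b : 'I_n) : b != a ->
    PD_rel (d c b * t c a - q *: (t c a * d c b)
            - (q - q^-1) *: \sum_(c' < m | (c < c')%N) t c' a * d c' b)
| PD_R5 (c e : 'I_m) (a : 'I_n) : c != e ->
    PD_rel (d c a * t e a - q *: (t e a * d c a)
            - (q - q^-1) *: \sum_(a' < n | (a < a')%N) t e a' * d c a')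
| PD_R6 (c : 'I_m) (e : 'I_n) :
    PD_rel (d c e * t c e - 1
            - \sum_(c' < m | (c <= c')%N) \sum_(e' < n | (e <= e')%N)
                (q ^+ ((c == c') + (e == e'))%N
                 * (q - q^-1) ^+ (2 - (c == c') - (e == e'))%N)
                *: (t c' e' * d c' e')).

(* A character of PD: t_(i,j) and d_(i,j) are sent to 0 unless (i, j) lies on  *)
(* the diagonal through the last row and the last column.                      *)
Definition PD_diag (i : 'I_m) (j : 'I_n) : bool := (m - i.+1 == n - j.+1)%N.
Definition PD_diag_val (s : nat) : K := q^-1 ^+ s.*2 / (1 - q ^+ 2).
Definition PD_chi (g : PD_index m n) : K :=
  match g with
  | inl (i, j) => (PD_diag i j)%:R
  | inr (i, j) => (PD_diag i j)%:R * PD_diag_val (m - i.+1)%N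
  end.

Lemma PD_diag_row i (j j' : 'I_n) : j != j' -> PD_diag i j -> PD_diag i j' = false.
Proof.
move=> jj' /eqP ij; apply/eqP => ij'; case/eqP: jj'; apply/val_inj => /=.
by have := ltn_ord j; have := ltn_ord j'; lia.
Qed.

Lemma PD_diag_col (i i' : 'I_m) j : i != i' -> PD_diag i j -> PD_diag i' j = false.
Proof.
move=> ii' /eqP ij; apply/eqP => ij'; case/eqP: ii'; apply/val_inj => /=.
by have := ltn_ord i; have := ltn_ord i'; lia.
Qed.

Lemma PD_diag_anti (i k : 'I_m) (j l : 'I_n) : (i < k)%N -> (j < l)%N ->
  PD_diag i l -> PD_diag k j = false.
Proof.
move=> ik jl /eqP il; apply/eqP => kj.
by have := ltn_ord k; have := ltn_ord l; lia.
Qed.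

Hypothesis q0 : q != 0.
Hypothesis q21 : 1 - q ^+ 2 != 0.

Lemma PD_geom M :
  1 + \sum_(s < M) (q - q^-1) ^+ 2 * PD_diag_val s = q^-1 ^+ M.*2 :> K.
Proof.
elim: M => [|M IH]; first by rewrite big_ord0 addr0.
rewrite big_ord_recr /= addrA IH /PD_diag_val doubleS !exprS.
by field; rewrite q0 q21.
Qed.

Lemma PD_chi_R6 (c : 'I_m) (e : 'I_n) :
  (PD_diag c e)%:R * PD_diag_val (m - c.+1)%N =
  1 + \sum_(c' < m | (c <= c')%N) \sum_(e' < n | (e <= e')%N)
    (q ^+ ((c == c') + (e == e'))%N * (q - q^-1) ^+ (2 - (c == c') - (e == e'))%N)
    * ((PD_diag c' e')%:R * PD_diag_val (m - c'.+1)%N) :> K.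
Proof.
have cm := ltn_ord c; have en := ltn_ord e.
pose a := (m - c.+1)%N; pose b := (n - e.+1)%N; pose M := minn a b.
pose f s : K := (q ^+ ((s == a) + (s == b))%N *
  (q - q^-1) ^+ (2 - (s == a) - (s == b))%N) * PD_diag_val s.
have -> : \sum_(c' < m | (c <= c')%N) \sum_(e' < n | (e <= e')%N)
    (q ^+ ((c == c') + (e == e'))%N * (q - q^-1) ^+ (2 - (c == c') - (e == e'))%N)
    * ((PD_diag c' e')%:R * PD_diag_val (m - c'.+1)%N) = \sum_(s < M.+1) f s :> K.
  have Mm : (M.+1 <= m)%N by rewrite /M /a /b; lia.
  rewrite (big_ord_widen_cond _ xpredT f Mm) [LHS](reindex_inj rev_ord_inj) /=.
  rewrite big_mkcond [RHS]big_mkcond /=; apply: eq_bigr => s _.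
  have sm := ltn_ord s.
  have -> : (c <= m - s.+1)%N = (s <= a)%N by rewrite /a; apply/idP/idP; lia.
  have ms : (m - (m - s.+1).+1)%N = s by lia.
  rewrite ltnS leq_min; case: (leqP s a) => //= sa.
  have cs : (c == rev_ord s) = (s == a :> nat).
    by rewrite -val_eqE /= /a; apply/eqP/eqP; lia.
  case: (leqP s b) => sb; last first.
    apply: big1 => j ej; rewrite /PD_diag /= ms.
    have -> : (s == n - j.+1 :> nat)%N = false.
      by apply/eqP; move: ej sb; rewrite /b; have := ltn_ord j; lia.
    by rewrite mul0r mulr0.
  have sn : (s < n)%N by apply: (leq_ltn_trans sb); rewrite /b; lia.
  pose j0 := rev_ord (Ordinal sn).
  rewrite (bigD1 j0) /=; last by move: sb; rewrite /b; lia.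
  rewrite big1 ?addr0 => [|j /andP[_ jj0]]; last first.
    rewrite (@PD_diag_row _ j0) ?mul0r ?mulr0 1?eq_sym //.
    by rewrite /PD_diag /=; apply/eqP; lia.
  have -> : PD_diag (rev_ord s) j0 by rewrite /PD_diag /=; apply/eqP; lia.
  have es : (e == j0) = (s == b :> nat).
    by rewrite -val_eqE /= /b; apply/eqP/eqP; lia.
  by rewrite mul1r /= ms cs es.
rewrite big_ord_recr /= addrA.
have -> : \sum_(s < M) f s = \sum_(s < M) (q - q^-1) ^+ 2 * PD_diag_val s.
  apply: eq_bigr => s _; rewrite /f.
  have sM := ltn_ord s; have sa : (s < a)%N by apply: (leq_trans sM); rewrite geq_minl.
  have sb : (s < b)%N by apply: (leq_trans sM); rewrite geq_minr.
  by rewrite !ltn_eqF //= !subn0 expr0 mul1r.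
rewrite PD_geom /f /PD_diag -/a -/b /M.
case: (ltngtP a b) => [ab|ba|<-] /=.
- rewrite eqxx (ltn_eqF ab) /= mul0r expr1 expr1 /PD_diag_val.
  by field; rewrite q0 q21.
- rewrite eqxx (ltn_eqF ba) /= mul0r expr1 expr1 /PD_diag_val.
  by field; rewrite q0 q21.
- rewrite eqxx /= mul1r expr0 mulr1 /PD_diag_val.
  by field.
Qed.

Variable ev : A -> K.
Hypothesis evD : {morph ev : x y / x + y}.
Hypothesis evN : {morph ev : x / - x}.
Hypothesis evM : {morph ev : x y / x * y}.
Hypothesis evZ : forall c, {morph ev : x / c *: x >-> c * x}.
Hypothesis ev1 : ev 1 = 1.
Hypothesis evX : forall g, ev (X g) = PD_chi g.

Lemma PD_chiP r : PD_rel r -> ev r = 0.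
Proof.
have ev0 : ev 0 = 0 by rewrite -(scale0r 1) evZ mul0r.
have evS (J : finType) (Q : pred J) (g : J -> A) :
    ev (\sum_(j | Q j) g j) = \sum_(j | Q j) ev (g j).
  exact: (big_morph _ evD ev0).
case=> [k i j ij|k i j ij|i k j l ik jl|i k j l ik jl
       |k i j ij|k i j ij|i k j l ik jl|i k j l ik jl
       |c e a b ba ce|c a b ba|c e a ce|c e]; rewrite !(evD, evN, evM, evZ, ev1, evX, evS) /=.
- case: (boolP (PD_diag k i)) => ki; last by rewrite !(mul0r, mulr0) subrr.
  by rewrite (PD_diag_row _ ki) ?(ltn_eqF ij) ?(mul0r, mulr0, subrr) // -val_eqE neq_ltn ij.
- case: (boolP (PD_diag i k)) => ki; last by rewrite !(mul0r, mulr0) subrr.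
  by rewrite (PD_diag_col _ ki) ?(mul0r, mulr0, subrr) // -val_eqE neq_ltn ij.
- by rewrite mulrC subrr.
- case: (boolP (PD_diag i l)) => il; last by rewrite !(mul0r, mulr0) subr0 mulrC subrr.
  by rewrite (PD_diag_anti ik jl il) !mulr0 subr0 mulrC subrr.
- case: (boolP (PD_diag k i)) => ki; last by rewrite !(mul0r, mulr0) subrr.
  by rewrite (PD_diag_row _ ki) ?(mul0r, mulr0, subrr) // -val_eqE neq_ltn ij.
- case: (boolP (PD_diag i k)) => ki; last by rewrite !(mul0r, mulr0) subrr.
  by rewrite (PD_diag_col _ ki) ?(mul0r, mulr0, subrr) // -val_eqE neq_ltn ij.
- by rewrite mulrC subrr.
- case: (boolP (PD_diag i l)) => il; last by rewrite !(mul0r, mulr0) subr0 mulrC subrr.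
  by rewrite (PD_diag_anti ik jl il) !(mul0r, mulr0) subr0 mulrC subrr.
- by rewrite mulrC subrr.
- have Z (j : 'I_m) : (PD_diag j a)%:R * (PD_diag j b)%:R = 0 :> K.
    case: (boolP (PD_diag j a)) => ja; last by rewrite mul0r.
    by rewrite (PD_diag_row _ ja) ?mulr0 // eq_sym.
  rewrite mulrAC [_ * (PD_diag c a)%:R]mulrC mulrA Z !(mul0r, mulr0) subrr sub0r.
  rewrite big1 ?mulr0 ?oppr0 // => j _; rewrite evM !evX /=.
  by rewrite mulrA Z mul0r.
- have Z (j : 'I_n) : (PD_diag e j)%:R * (PD_diag c j)%:R = 0 :> K.
    case: (boolP (PD_diag c j)) => cj; last by rewrite mulr0.
    by rewrite (PD_diag_col ce cj) mul0r.
  rewrite mulrAC [_ * (PD_diag e a)%:R]mulrC mulrA Z !(mul0r, mulr0) subrr sub0r.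
  rewrite big1 ?mulr0 ?oppr0 // => j _; rewrite evM !evX /=.
  by rewrite mulrA Z mul0r.
- have Z i j : (PD_diag i j)%:R * ((PD_diag i j)%:R * PD_diag_val (m - i.+1)%N) =
      (PD_diag i j)%:R * PD_diag_val (m - i.+1)%N :> K.
    by case: PD_diag; rewrite ?mul1r ?mul0r.
  rewrite mulrC Z PD_chi_R6 -addrA -opprD; apply/eqP; rewrite subr_eq0; apply/eqP.
  congr (1 + _); apply: eq_bigr => c' _; rewrite evS.
  by apply: eq_bigr => e' _; rewrite evZ evM !evX /= Z.
Qed.

End QuantizedWeylRelations.

Definition Cq (R : realType) : Type := {fraction {poly R[i]}}.
HB.instance Definition _ (R : realType) := GRing.Field.on (Cq R).

Definition q (R : realType) : Cq R := tofrac ('X : {poly R[i]}).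
Arguments q {R}.

Lemma q_neq0 (R : realType) : (q : Cq R) != 0.
Proof. by rewrite tofrac_eq0 polyX_eq0. Qed.

Lemma q2_neq1 (R : realType) : (q ^+ 2 : Cq R) != 1.
Proof.
rewrite -tofracXn -tofrac1 tofrac_eq; apply/negP => /eqP /(congr1 (size : {poly R[i]} -> nat)).
by rewrite size_polyXn size_poly1.
Qed.

Section QuantumGroup.
Variables (R : realType) (n : nat).

Local Notation free_Uq := (@free_gen (Cq R) (Uq_index n)).

Lemma Uq_presentation_subproof r : Uq_rel q free_Uq r -> free_eval (@Uq_chi _ n) r = 0.
Proof.
apply: Uq_chiP.
- exact: free_evalD.
- exact: free_evalN.
- exact: free_evalM.
- exact: free_evalZ.
- exact: free_eval1.
- exact: free_eval_gen.
Qed.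

Definition Uq_presentation : presentation (Cq R) (Uq_index n) :=
  Presentation Uq_presentation_subproof.

Definition Uq : Type := presented Uq_presentation.
HB.instance Definition _ := GRing.Algebra.on Uq.

Definition Uq_E (i : 'I_n.-1) : Uq := pgen Uq_presentation (UE i).
Definition Uq_F (i : 'I_n.-1) : Uq := pgen Uq_presentation (UF i).
Definition Uq_Keps (b : bool) (i : 'I_n) : Uq := pgen Uq_presentation (UK b i).
Definition Uq_K (i : 'I_n.-1) : Uq := Uq_Keps false (lo i) * Uq_Keps true (hi i).
Definition Uq_K' (i : 'I_n.-1) : Uq := Uq_Keps false (hi i) * Uq_Keps true (lo i).

(* The character defined by [Uq_chi]: E_i, F_i are sent to 0 and K_(eps_i) and *)
(* its inverse to 1.                                                            *)
Definition Uq_counit (x : Uq) : Cq R := pchar x.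

Lemma Uq_KKV i : Uq_Keps false i * Uq_Keps true i = 1.
Proof.
rewrite -quot_piM -[RHS]/(quot_pi (pres_ideal Uq_presentation) 1); apply/quot_piP.
exact/ideal2_gen_in/Uq_KV.
Qed.

Lemma Uq_KVK i : Uq_Keps true i * Uq_Keps false i = 1.
Proof.
rewrite -(Uq_KKV i) -!quot_piM; apply/quot_piP.
exact/ideal2_gen_in/Uq_KK.
Qed.

(* [Uq_coproduct x s] means that the coproduct of [x] is the sum of the tensors *)
(* of the pairs in [s]: the coproduct is the algebra morphism from Uq to its    *)
(* tensor square with the prescribed values on generators. A given [x] has many *)
(* such expansions, all equal in the tensor square.                             *)
Inductive Uq_coproduct : Uq -> seq (Uq * Uq) -> Prop :=
| Delta_E i : Uq_coproduct (Uq_E i) [:: (Uq_E i, Uq_K i); (1, Uq_E i)]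
| Delta_F i : Uq_coproduct (Uq_F i) [:: (Uq_F i, 1); (Uq_K' i, Uq_F i)]
| Delta_K b i : Uq_coproduct (Uq_Keps b i) [:: (Uq_Keps b i, Uq_Keps b i)]
| Delta_1 : Uq_coproduct 1 [:: (1, 1)]
| Delta_D x y s s' : Uq_coproduct x s -> Uq_coproduct y s' ->
    Uq_coproduct (x + y) (s ++ s')
| Delta_Z c x s : Uq_coproduct x s ->
    Uq_coproduct (c *: x) [seq (c *: p.1, p.2) | p <- s]
| Delta_M x y s s' : Uq_coproduct x s -> Uq_coproduct y s' ->
    Uq_coproduct (x * y) [seq (p.1 * r.1, p.2 * r.2) | p <- s, r <- s'].

End QuantumGroup.

Section QuantizedWeylAlgebra.
Variables (R : realType) (m n : nat).

Local Notation free_PD := (@free_gen (Cq R) (PD_index m n)).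

Lemma PD_presentation_subproof r : PD_rel q free_PD r -> free_eval (@PD_chi _ q m n) r = 0.
Proof.
apply: PD_chiP.
- exact: q_neq0.
- by rewrite subr_eq0 eq_sym q2_neq1.
- exact: free_evalD.
- exact: free_evalN.
- exact: free_evalM.
- exact: free_evalZ.
- exact: free_eval1.
- exact: free_eval_gen.
Qed.

Definition PD_presentation : presentation (Cq R) (PD_index m n) :=
  Presentation PD_presentation_subproof.

Definition PD : Type := presented PD_presentation.
HB.instance Definition _ := GRing.Algebra.on PD.

Definition PD_t (i : 'I_m) (j : 'I_n) : PD := pgen PD_presentation (inl (i, j)).
Definition PD_d (i : 'I_m) (j : 'I_n) : PD := pgen PD_presentation (inr (i, j)).

(* The U_q(gl_n)-module algebra structure of PD; the values on generators      *)
(* determine it.                                                                *)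
Record PD_action := PDAction {
  PD_act :> module_algebra (@Uq_coproduct R n) (@Uq_counit R n) PD;
  PD_act_Ed : forall k i j, PD_act (Uq_E R k) (PD_d i j) = (hi k == j)%:R *: PD_d i (lo k);
  PD_act_Fd : forall k i j, PD_act (Uq_F R k) (PD_d i j) = (lo k == j)%:R *: PD_d i (hi k);
  PD_act_Kd : forall k i j, PD_act (Uq_Keps R false k) (PD_d i j) = q ^+ (k == j) *: PD_d i j;
  PD_act_Et : forall k i j,
    PD_act (Uq_E R k) (PD_t i j) = (- ((lo k == j)%:R * q^-1)) *: PD_t i (hi k);
  PD_act_Ft : forall k i j,
    PD_act (Uq_F R k) (PD_t i j) = (- ((hi k == j)%:R * q)) *: PD_t i (lo k);
  PD_act_Kt : forall k i j,
    PD_act (Uq_Keps R false k) (PD_t i j) = q ^- (k == j) *: PD_t i j }.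

End QuantizedWeylAlgebra.

Section InvariantAlgebra.
Variables (R : realType) (k l n : nat).
Local Notation m := (maxn k l).

Definition t_tilde (i : 'I_k) (j : 'I_n) : PD R m n :=
  PD_t R (rev_ord (widen_ord (leq_maxl k l) i)) (rev_ord j).
Definition d_tilde (i : 'I_l) (j : 'I_n) : PD R m n :=
  PD_d R (rev_ord (widen_ord (leq_maxr k l) i)) (rev_ord j).

Inductive Akl_gen : PD R m n -> Prop :=
| Akl_gen_t i j : Akl_gen (t_tilde i j)
| Akl_gen_d i j : Akl_gen (d_tilde i j).

Definition Akl : PD R m n -> Prop := subalg_gen Akl_gen.

(* The degree filtration of the subalgebra [Akl], as subspaces of [PD]. *)
Definition Akl_filtration : filtration (PD R m n) := degree_filtration Akl_gen.

Lemma Akl_filtrationE D : Akl D <-> exists d, Akl_filtration d D.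
Proof. exact: degree_filtrationE. Qed.

Definition gr_Akl : Type := gr Akl_filtration.
HB.instance Definition _ := GRing.Algebra.on gr_Akl.

Definition gr_t_tilde i j : gr_Akl := gr_class (degree_le_gen (Akl_gen_t i j)).
Definition gr_d_tilde i j : gr_Akl := gr_class (degree_le_gen (Akl_gen_d i j)).

Definition L_tilde (i : 'I_k) (j : 'I_l) : PD R m n := \sum_(r < n) t_tilde i r * d_tilde j r.
Definition gr_L_tilde (i : 'I_k) (j : 'I_l) : gr_Akl := \sum_(r < n) gr_t_tilde i r * gr_d_tilde j r.

Variable act : PD_action R m n.

Lemma Akl_filt_t i j : Akl_filtration 1 (PD_t R (rev_ord (widen_ord (leq_maxl k l) i)) j).
Proof. by rewrite -[j]rev_ordK; apply: degree_le_gen; apply: Akl_gen_t. Qed.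

Lemma Akl_filt_d i j : Akl_filtration 1 (PD_d R (rev_ord (widen_ord (leq_maxr k l) i)) j).
Proof. by rewrite -[j]rev_ordK; apply: degree_le_gen; apply: Akl_gen_d. Qed.

Lemma PD_act_Kinv b i u c : c != 0 ->
  act (Uq_Keps R false i) u = c *: u ->
  act (Uq_Keps R b i) u = (if b then c^-1 else c) *: u.
Proof.
by case: b => c0 Ku; [exact: (mact_inv (Uq_KVK R i) c0 Ku) | exact: Ku].
Qed.

Lemma Akl_gen_K b i u : Akl_gen u -> Akl_filtration 1 (act (Uq_Keps R b i) u).
Proof.
case=> i' j'.
  rewrite (@PD_act_Kinv b i _ (q ^- (i == rev_ord j'))) ?PD_act_Kt //.
    exact/filt_Z/Akl_filt_t.
  by rewrite invr_eq0 expf_neq0 // q_neq0.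
rewrite (@PD_act_Kinv b i _ (q ^+ (i == rev_ord j'))) ?PD_act_Kd //.
  exact/filt_Z/Akl_filt_d.
by rewrite expf_neq0 // q_neq0.
Qed.

Lemma Akl_filt_K b i d v :
  Akl_filtration d v -> Akl_filtration d (act (Uq_Keps R b i) v).
Proof.
move=> Fv; apply: (degree_filtration_coproduct (Delta_K R b i)) Fv => p.
by rewrite inE => /eqP-> /=; split; [apply: Akl_gen_K | left].
Qed.

Lemma Akl_filtration_stable x d v : Akl_filtration d v -> Akl_filtration d (act x v).
Proof.
elim: {x} (presented_gen x) d v => [x [g ->]||x y _ Fx _ Fy|c x _ Fx|x y _ Fx _ Fy] d v Fv.
- case: g => [i|i|b i]; last exact: Akl_filt_K.
    apply: (degree_filtration_coproduct (Delta_E R i)) Fv => p.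
    rewrite !inE => /orP[] /eqP-> /=; split.
    + by move=> u [] i' j'; rewrite ?PD_act_Et ?PD_act_Ed; apply: degree_le_Z;
        [apply: Akl_filt_t | apply: Akl_filt_d].
    + by right=> e u Fu; rewrite mact_M; do 2!apply: Akl_filt_K.
    + by move=> u Su; rewrite mact_1; apply: degree_le_gen.
    + by left.
  apply: (degree_filtration_coproduct (Delta_F R i)) Fv => p.
  rewrite !inE => /orP[] /eqP-> /=; split.
  + by move=> u [] i' j'; rewrite ?PD_act_Ft ?PD_act_Fd; apply: degree_le_Z;
      [apply: Akl_filt_t | apply: Akl_filt_d].
  + by right=> e u Fu; rewrite mact_1.
  + by move=> u Su; rewrite mact_M; do 2!apply: Akl_filt_K; apply: degree_le_gen.
  + by left.
- by rewrite mact_1.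
- by rewrite -[x]scale1r mact_linearl scale1r; apply: filt_D; [apply: Fx | apply: Fy].
- rewrite -[c *: x]addr0 mact_linearl.



  by rewrite mact_0l addr0; apply/filt_Z/Fx.
- by rewrite mact_M; apply/Fx/Fy.
Qed.

(* The structure of U_q(gl_n)-module algebra on gr(A) induced by [act]: the    *)
(* class of [v] in [F d / F (d - 1)] is sent by [x] to the class of [act x v]. *)
Definition gr_Akl_act : module_algebra (@Uq_coproduct R n) (@Uq_counit R n) gr_Akl :=
  gr_act Akl_filtration_stable.

End InvariantAlgebra.

Arguments t_tilde R {k} l {n}.
Arguments d_tilde R k {l n}.
Arguments Akl : clear implicits.
Arguments gr_Akl : clear implicits.
Arguments L_tilde R {k l} n.
Arguments gr_L_tilde R {k l} n.
Arguments gr_Akl_act {R} k l {n}.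

(* Main.v *)
Require Import Defs.
From HB Require Import structures.
From mathcomp Require Import all_boot all_order all_algebra.
From mathcomp Require Import generic_quotient fraction complex.
From mathcomp Require Import boolp reals.
From mathcomp Require Import ring zify.

(** That products of the elements L_ij are invariant is a direct computation.  For
the converse it suffices to work in one filtration degree d at a time: if x
has degree d and is invariant modulo degree d - 1, then x agrees modulo degree
d - 1 with a combination of products of d/2 elements L_ij
([gr_invariant_quad_span]).  This is the graded statement, and the filtered
one follows from it by induction on d.

The proof specializes q to 1, using lattices where one might expect a basis of
ordered monomials.  Let O be the local ring of C(q) at q = 1, and let [lat d]
be the O-span of the words of length d in the generators, plus everything of
degree d - 1.  Modulo q - 1 the generators commute up to lower degree
([Akl_letter_comm]), and E_i, F_i and (K_a - 1)/(q - 1) act on words as the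
derivations that extend the action of the matrix units of gl_n on letters
([ev_skew], [wder_gr_invariant]).  So an invariant in the lattice reduces to a
tensor, that is, a complex function on words, which every E_ab sends to a
relation.

On tensors the first fundamental theorem is proved with a Casimir element
([gl_invariant_span]).  For the standard Hermitian form E_ab and E_ba are
adjoint.  Let J be the space of tensors whose value is congruent to a
combination of products of the L_ij, and let g be the component orthogonal to
J of a tensor to be treated; since gl_n maps J into itself, g is killed by
gl_n.  Split E_ab = X_ab + Y_ab into its actions on the letters t and on the
letters d.  As g is invariant, the sum of all E_ab E_ba kills it, so
(sum of X_ab X_ba + Y_ab Y_ba) g = - 2 (sum of X_ab Y_ba) g ([gl_casimir]).
The right-hand side contracts one t with one d and multiplies by L_ij
([ev_mixed_casimir]), hence lies in J by induction on the degree.  The left-hand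
side is therefore orthogonal to g, and <(X_ab X_ba) g, g> is the squared norm of
X_ba g: every X_ab and Y_ab kills g.  But the sum of all Y_aa - X_aa multiplies
a tensor by its degree d, so g = 0.

Thus an invariant x in the lattice is a combination of products of the L_ij
plus (q - 1) times another invariant in the lattice ([inv_step]).  Iterating,
x lies in the span of these products plus (q - 1)^e times the lattice for every
e, and a Krull intersection argument in finite dimension ([lattice_krull])
concludes. *)

Set Implicit Arguments.
Unset Strict Implicit.
Unset Printing Implicit Defensive.

Import Order.TTheory GRing.Theory Num.Theory.
Local Open Scope ring_scope.
Local Open Scope quotient_scope.

(** * Functions on words and derivations *)

Section Words.
Variables (C : comNzRingType) (L : finType).
Implicit Types (f g : seq L -> C) (M N : L -> L -> C) (w u : seq L) (x y z : L).

(** The tensor with coefficients [f] is the formal sum of the [f w] times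
the word [w].  A matrix [M] sends the letter [y] to the sum of the [M x y]
times the letter [x]; [wder M] is the derivation of the tensor algebra that
extends it, written on coefficients. *)
Fixpoint wder M f w : C :=
  if w is x :: u then
    \sum_y M x y * f (y :: u) + wder M (fun v => f (x :: v)) u
  else 0.

(** On tensors this is the derivation that maps the letter [y] to 1 and the
other letters to 0: a word collects the coefficients of the words from which it
is obtained by deleting one [y]. *)
Fixpoint ins y f w : C :=
  f (y :: w) + if w is x :: u then ins y (fun v => f (x :: v)) u else 0.

Lemma eq_wder d M f g w : (forall v, size v = d -> f v = g v) ->
  size w = d -> wder M f w = wder M g w.
Proof.
elim: w d f g => [|x w IHw] [|d] f g fg //= [wd].
congr (_ + _); last by apply: (IHw d) => // v vd; apply: fg; rewrite /= vd.
by apply: eq_bigr => y _; rewrite fg //= wd.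
Qed.

Lemma wder_comb (I : Type) (r : seq I) (a : I -> C) (h : I -> seq L -> C) M w :
  wder M (fun v => \sum_(i <- r) a i * h i v) w = \sum_(i <- r) a i * wder M (h i) w.
Proof.
elim: w h => [|x w IHw] h /=; first by rewrite big1 // => i _; rewrite mulr0.
rewrite IHw; under [RHS]eq_bigr do rewrite mulrDr.
rewrite big_split /=; congr (_ + _).
under eq_bigr do rewrite mulr_sumr.
rewrite exchange_big /=; apply: eq_bigr => i _.
by rewrite mulr_sumr; apply: eq_bigr => y _; rewrite mulrCA.
Qed.

Lemma wderD M f g w : wder M (fun v => f v + g v) w = wder M f w + wder M g w.
Proof.
elim: w f g => [|x w IHw] f g /=; first by rewrite addr0.
rewrite IHw addrACA -big_split /=; congr (_ + _).
by apply: eq_bigr => y _; rewrite mulrDr.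
Qed.

Lemma wderZ M c f w : wder M (fun v => c * f v) w = c * wder M f w.
Proof.
elim: w f => [|x w IHw] f /=; first by rewrite mulr0.
rewrite IHw mulrDr mulr_sumr; congr (_ + _).
by apply: eq_bigr => y _; rewrite mulrCA.
Qed.

Lemma wder0 M w : wder M (fun=> 0) w = 0.
Proof.
elim: w => [|x w IHw] //=.
by rewrite IHw addr0 big1 // => y _; rewrite mulr0.
Qed.

Lemma wder_sum (I : finType) (h : I -> seq L -> C) M w :
  wder M (fun v => \sum_i h i v) w = \sum_i wder M (h i) w.
Proof.
have := wder_comb (index_enum I) (fun=> 1) h M w.
under [X in _ = X -> _]eq_bigr do rewrite mul1r.
by move=> <-; congr wder; apply/funext => v; apply: eq_bigr => i _; rewrite mul1r.
Qed.

Lemma wder_mxD M N f w : wder (fun x y => M x y + N x y) f w = wder M f w + wder N f w.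
Proof.
elim: w f => [|x w IHw] f /=; first by rewrite addr0.
rewrite IHw addrACA -big_split /=; congr (_ + _).
by apply: eq_bigr => y _; rewrite mulrDl.
Qed.

Lemma wder_mxB M N f w : wder (fun x y => M x y - N x y) f w = wder M f w - wder N f w.
Proof.
elim: w f => [|x w IHw] f /=; first by rewrite subr0.
rewrite IHw opprD addrACA -sumrB; congr (_ + _).
by apply: eq_bigr => y _; rewrite mulrBl.
Qed.

Lemma wder_mx_sum (I : finType) (h : I -> L -> L -> C) f w :
  wder (fun x y => \sum_i h i x y) f w = \sum_i wder (h i) f w.
Proof.
elim: w f => [|x w IHw] f /=; first by rewrite big1.
rewrite IHw big_split /=; congr (_ + _).
rewrite exchange_big; apply: eq_bigr => y _ /=.
by rewrite mulr_suml.
Qed.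

Definition mcomm M N x y := \sum_z (M x z * N z y - N x z * M z y).

(** Extending matrices to derivations is a morphism of Lie algebras. *)
Lemma wder_comm M N f w :
  wder M (wder N f) w - wder N (wder M f) w = wder (mcomm M N) f w.
Proof.
elim: w f => [|x w IHw] f /=; first by rewrite subr0.
have step (A B : L -> L -> C) :
   wder A (fun v => \sum_y B x y * f (y :: v) + wder B (fun v0 => f (x :: v0)) v) w
   = \sum_y B x y * wder A (fun v => f (y :: v)) w
     + wder A (wder B (fun v => f (x :: v))) w.
  by rewrite wderD wder_comb.
rewrite !step -IHw.
under eq_bigr do rewrite mulrDr.
under [X in _ - (X + _)]eq_bigr do rewrite mulrDr.
rewrite !big_split /=.
set S1 := \sum_i M x i * \sum_y _; set S2 := \sum_i M x i * wder _ _ _.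
set S3 := \sum_i N x i * wder _ _ _; set S4 := \sum_i N x i * \sum_y _.
set t := wder M _ _; set t' := wder N _ _.
have -> : \sum_y mcomm M N x y * f (y :: w) = S1 - S4.
  under eq_bigr do rewrite /mcomm mulr_suml.
  rewrite exchange_big -sumrB; apply: eq_bigr => z _ /=.
  rewrite !mulr_sumr -sumrB; apply: eq_bigr => y _.
  by ring.
rewrite -/S2 -/S3; ring.
Qed.

Lemma insD y f g w : ins y (fun v => f v + g v) w = ins y f w + ins y g w.
Proof.
elim: w f g => [|z w IHw] f g /=; first by rewrite !addr0.
by rewrite IHw addrACA.
Qed.

Lemma insZ y c f w : ins y (fun v => c * f v) w = c * ins y f w.
Proof.
elim: w f => [|z w IHw] f /=; first by rewrite !addr0.
by rewrite IHw mulrDr.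
Qed.

Lemma ins0 y w : ins y (fun=> 0) w = 0.
Proof. by elim: w => [|x w IHw]; rewrite /= ?addr0 // IHw addr0. Qed.

(** Two derivations are commuted here: their bracket is again determined by
its values on letters, where it is a combination of the deletions. *)
Lemma ins_wder M f y w :
  ins y (wder M f) w = wder M (ins y f) w + \sum_z M y z * ins z f w.
Proof.
elim: w f => [|x w IHw] f /=; first by rewrite !addr0 add0r; under [RHS]eq_bigr do rewrite addr0.
have insS (h : L -> seq L -> C) u :
    ins y (fun v => \sum_z M x z * h z v) u = \sum_z M x z * ins y (h z) u.
  elim: u h => [|z u IHu] h /=.
    by rewrite addr0; apply: eq_bigr => z _; rewrite addr0.
  by rewrite IHu -big_split; apply: eq_bigr => v _; rewrite mulrDr.
rewrite insD insS IHw wderD.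
under [X in _ = X + _ + _]eq_bigr do rewrite mulrDr.
under [X in _ = _ + X]eq_bigr do rewrite mulrDr.
rewrite !big_split /=.
ring.
Qed.

Section Sum.
Variable V : nmodType.

(** Recursive rather than indexed by tuples, so that statements about words
can be proved by splitting off the first letter. *)
Fixpoint wsum d (F : seq L -> V) : V :=
  if d is d'.+1 then \sum_x wsum d' (fun u => F (x :: u)) else F [::].

Lemma eq_wsum d (F G : seq L -> V) :
  (forall w, size w = d -> F w = G w) -> wsum d F = wsum d G.
Proof.
elim: d F G => [|d IHd] F G FG /=; first exact: FG.
by apply: eq_bigr => x _; apply: IHd => w wd; apply: FG; rewrite /= wd.
Qed.

Lemma wsum_tuple d (F : seq L -> V) : wsum d F = \sum_(w : d.-tuple L) F w.
Proof.
elim: d F => [|d IHd] F /=.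
  by rewrite (big_pred1 [tuple]) // => w; apply/esym/eqP; exact: tuple0.
under eq_bigr do rewrite IHd.
rewrite pair_bigA /=.
rewrite [RHS](reindex (fun p : L * d.-tuple L => [tuple of p.1 :: p.2])) //=.
exists (fun w : d.+1.-tuple L => (thead w, [tuple of behead w])) => [[x w] _|w _] /=.
  by congr pair; apply/val_inj.
by rewrite -tuple_eta.
Qed.

End Sum.

End Words.

Lemma wsum_morph (L : finType) (V W : nmodType) (phi : V -> W) d (F : seq L -> V) :
  {morph phi : x y / x + y} -> phi 0 = 0 ->
  phi (wsum d F) = wsum d (fun w => phi (F w)).
Proof.
move=> phiD phi0; rewrite !wsum_tuple.
exact: (big_morph phi phiD phi0).
Qed.

Section Hermitian.
Variables (C : numClosedFieldType).

(** A matrix of maximal rank among those with rows in the subspace. *)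
Lemma subspace_mx (K : fieldType) N (J : 'rV[K]_N -> Prop) :
  J 0 -> (forall u v, J u -> J v -> J (u + v)) -> (forall c u, J u -> J (c *: u)) ->
  exists B : 'M[K]_N, forall v, J v <-> (v <= B)%MS.
Proof.
move=> J0 JD JZ.
pose inJ (B : 'M[K]_N) := forall v, (v <= B)%MS -> J v.
pose P r := `[< exists B, inJ B /\ \rank B = r >].
have ex : exists r, P r.
  exists 0%N; apply/asboolP; exists 0; split; last exact: mxrank0.
  by move=> v; rewrite submx0 => /eqP->.
have ub r : P r -> (r <= N)%N.
  by move=> /asboolP[B [_ <-]]; apply: rank_leq_row.
case: (ex_maxnP ex ub) => r /asboolP[B [JB rB]] maxr.
exists B => v; split; last exact: JB.
move=> Jv; have JBv : inJ (B + v)%MS.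
  move=> u /sub_addsmxP[[a b] /= ->]; apply: JD; first by apply/JB/submxMl.
  by rewrite [b]mx11_scalar mul_scalar_mx; apply: JZ.
have rr : (\rank (B + v)%MS <= r)%N by apply: maxr; apply/asboolP; exists (B + v)%MS.
have := mxrank_leqif_sup (addsmxSl B v); case=> le e.
by apply: (submx_trans (addsmxSr B v)); rewrite -e eqn_leq le rB.
Qed.

(** The Gram matrix of a basis of the subspace is invertible because the
Hermitian form is definite; it yields the orthogonal projection. *)
Lemma row_orth_decomp N (J : 'rV[C]_N -> Prop) (v : 'rV[C]_N) :
  J 0 -> (forall u v, J u -> J v -> J (u + v)) -> (forall c u, J u -> J (c *: u)) ->
  exists g : 'rV[C]_N, J (v - g) /\ forall j, J j -> \sum_i g 0 i * (j 0 i)^* = 0.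
Proof.
move=> J0 JD JZ; have [B JB] := subspace_mx J0 JD JZ.
pose D := row_base B; pose Dc := (map_mx Num.conj D)^T.
have normE (u : 'rV[C]_N) : u *m (map_mx Num.conj u)^T = 0 -> u = 0.
  move=> /(congr1 (fun m : 'M_1 => m 0 0)); rewrite !mxE => u0.
  have {}u0 : \sum_i `|u 0 i| ^+ 2 = 0.
    by rewrite -[RHS]u0; apply: eq_bigr => i _; rewrite !mxE normCK.
  apply/rowP => i; rewrite mxE.
  have /(_ i isT)/eqP : forall j, true -> `|u 0 j| ^+ 2 = 0.
    by move=> j; apply: psumr_eq0P u0 j => j _; rewrite exprn_ge0.
  by rewrite sqrf_eq0 normr_eq0 => /eqP.
have G_unit : D *m Dc \in unitmx.
  rewrite -row_free_unit; apply/row_freeP.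
  apply/row_freeP; rewrite -kermx_eq0; apply/rowV0P => u /sub_kermxP uG.
  have uD : u *m D = 0.
    apply: normE; rewrite map_mxM trmx_mul -/Dc -mulmxA (mulmxA D) mulmxA uG.
    by rewrite mul0mx.
  by apply/eqP; rewrite -(mulmx_free_eq0 _ (row_base_free B)) uD.
pose j0 := v *m Dc *m invmx (D *m Dc) *m D.
exists (v - j0); split.
  by rewrite opprB addrC subrK; apply/JB; rewrite -(eq_row_base B) submxMl.
move=> j /JB; rewrite -(eq_row_base B) => /submxP[a ->].
have g0 : (v - j0) *m Dc = 0.
  by rewrite mulmxBl /j0 -[_ *m D *m Dc]mulmxA mulmxKV // subrr.
have : (v - j0) *m (map_mx Num.conj (a *m D))^T = 0.
  by rewrite map_mxM trmx_mul mulmxA g0 mul0mx.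
move/(congr1 (fun m : 'M_1 => m 0 0)); rewrite [RHS]mxE [LHS]mxE => eq0.
rewrite -[RHS]eq0; apply: eq_bigr => i _.
by rewrite [_^T _ _]mxE [map_mx _ _ _ _]mxE.
Qed.

Variable L : finType.
Implicit Types (f g j : seq L -> C) (M N : L -> L -> C).

(** The Hermitian form for which words of length [d] are orthonormal. *)
Definition wdot d f g : C := wsum d (fun w => f w * (g w)^*).

Lemma wdot_adjoint d M N f g : (forall x y, (N x y)^* = M y x) ->
  wdot d (wder M f) g = wdot d f (wder N g).
Proof.
move=> MN; elim: d f g => [|d IHd] f g; first by rewrite /wdot /= rmorph0 mul0r mulr0.
rewrite /wdot /=.
have split (I : finType) d' (F G : I -> seq L -> C) :
    \sum_x wsum d' (fun u => F x u + G x u) =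
    \sum_x wsum d' (F x) + \sum_x wsum d' (G x).
  rewrite -big_split; apply: eq_bigr => x _ /=.
  by rewrite !wsum_tuple -big_split.
transitivity (\sum_x wsum d (fun u => (\sum_y M x y * f (y :: u)) * (g (x :: u))^*)
  + \sum_x wdot d (wder M (fun v => f (x :: v))) (fun v => g (x :: v))).
  rewrite -split; apply: eq_bigr => x _; apply: eq_wsum => u _.
  by rewrite mulrDl.
transitivity (\sum_x wsum d (fun u => f (x :: u) * (\sum_y N x y * g (y :: u))^*)
  + \sum_x wdot d (fun v => f (x :: v)) (wder N (fun v => g (x :: v)))); last first.
  rewrite -split; apply: eq_bigr => x _; apply: eq_wsum => u _.
  by rewrite rmorphD mulrDr.
congr (_ + _); last by apply: eq_bigr => x _; apply: IHd.
under eq_bigr do rewrite wsum_tuple.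
under [RHS]eq_bigr do rewrite wsum_tuple.
rewrite exchange_big [RHS]exchange_big; apply: eq_bigr => u _ /=.
under eq_bigr do rewrite mulr_suml.
rewrite exchange_big; apply: eq_bigr => x _ /=.
rewrite rmorph_sum mulr_sumr; apply: eq_bigr => y _ /=.
by rewrite rmorphM /= MN; ring.
Qed.

Lemma wdot_ge0 d f : 0 <= wdot d f f.
Proof.
by rewrite /wdot wsum_tuple; apply: sumr_ge0 => w _; rewrite -normCK exprn_ge0.
Qed.

Lemma wdot_eq0 d f : wdot d f f = 0 -> forall w, size w = d -> f w = 0.
Proof.
rewrite /wdot wsum_tuple => f0 w /eqP wd.
have /(_ (Tuple wd) isT)/eqP : forall v : d.-tuple L, true -> f v * (f v)^* = 0.
  by move=> v; apply: psumr_eq0P f0 v => v _; rewrite mul_conjC_ge0.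
rewrite /= -normCK.
by rewrite sqrf_eq0 normr_eq0 => /eqP.
Qed.

Lemma wdot_orth_decomp d (J : (seq L -> C) -> Prop) f :
  (forall g h, (forall w, size w = d -> g w = h w) -> J g -> J h) ->
  J (fun=> 0) -> (forall g h, J g -> J h -> J (fun w => g w + h w)) ->
  (forall c g, J g -> J (fun w => c * g w)) ->
  exists g, [/\ J (fun w => f w - g w), forall j, J j -> wdot d g j = 0 &
                forall w, size w != d -> g w = 0].
Proof.
move=> Jext J0 JD JZ.
pose fn (v : 'rV[C]_#|{: d.-tuple L}|) (w : seq L) : C :=
  if insub w is Some t then v 0 (enum_rank (t : d.-tuple L)) else 0.
have fnT v (t : d.-tuple L) : fn v t = v 0 (enum_rank t) by rewrite /fn valK.
pose vec g : 'rV[C]_#|{: d.-tuple L}| := \row_i g (enum_val i : d.-tuple L).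
have vecK g w : size w = d -> fn (vec g) w = g w.
  move=> /eqP wd; rewrite -[w]/(val (Tuple wd)) fnT mxE enum_rankK //.
have [] := @row_orth_decomp _ (fun v => J (fn v)) (vec f).
- by apply: Jext J0 => w _; rewrite /fn; case: insub => [t|]; rewrite ?mxE.
- move=> u v Ju Jv; apply: Jext (JD _ _ Ju Jv) => w _.
  by rewrite /fn; case: insub => [t|]; rewrite ?mxE ?addr0.
- move=> c u Ju; apply: Jext (JZ c _ Ju) => w _.
  by rewrite /fn; case: insub => [t|]; rewrite ?mxE ?mulr0.
move=> g [Jg orth]; exists (fn g); split.
- apply: Jext Jg => w /[dup] /eqP wd wd'; rewrite -(vecK f w wd').
  by rewrite -[w]/(val (Tuple wd)) !fnT !mxE.
- move=> j Jj; rewrite /wdot wsum_tuple.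
  have /orth orthj : J (fn (vec j)) by apply: Jext Jj => w wd; rewrite vecK.
  rewrite -[RHS]orthj.
  rewrite (reindex (@enum_val _ {: d.-tuple L})) /=; last exact/onW_bij/enum_val_bij.
  by apply: eq_bigr => i _; rewrite fnT enum_valK mxE.
- by move=> w wd; rewrite /fn insubF //; apply/negbTE.
Qed.

End Hermitian.

(** * The Lie algebra gl_n acting on words *)

(** [inl (i, r)] stands for a generator t in row i and column r, and
[inr (j, r)] for a generator d in row j and column r. *)
Definition letter (k l n : nat) : finType := ('I_k * 'I_n + 'I_l * 'I_n)%type.

Section GlLetters.
Variables (C : comNzRingType) (k l n : nat).
Local Notation L := (letter k l n).
Implicit Types (f : seq L -> C) (w : seq L) (x y z : L) (a b c : 'I_n).

(** The matrix unit E_ab of gl_n on the letters t, whose columns span the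
dual of the vector representation. *)
Definition glX a b x y : C :=
  match x, y with
  | inl p, inl s => - ([&& p.1 == s.1, p.2 == b & s.2 == a])%:R
  | _, _ => 0
  end.

(** The matrix unit E_ab of gl_n on the letters d, whose columns span the
vector representation. *)
Definition glY a b x y : C :=
  match x, y with
  | inr p, inr s => ([&& p.1 == s.1, p.2 == a & s.2 == b])%:R
  | _, _ => 0
  end.

Definition gl a b x y : C := glX a b x y + glY a b x y.

Lemma sum_glX (V : nmodType) (F : C -> L -> V) a b x :
  (forall y, F 0 y = 0) ->
  \sum_y F (glX a b x y) y =
    if x is inl p then if p.2 == b then F (-1) (inl (p.1, a)) else 0 else 0.
Proof.
move=> F0; case: x => [[i r]|p] /=; last first.
  by rewrite big1 // => -[y|y] _; rewrite F0.
rewrite big_sumType /= addrC big1 ?add0r => [|y _]; last by rewrite F0.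
case: eqP => [_|_]; last by rewrite big1 // => s _; rewrite andbF oppr0 F0.
rewrite (bigD1 (i, a)) //= !eqxx big1 ?addr0 // => -[i' s] /= si.
case: eqP => [ii|_] /=; last by rewrite oppr0 F0.
case: eqP => [sa|_] /=; last by rewrite oppr0 F0.
by rewrite ii sa eqxx in si.
Qed.

Lemma sum_glY (V : nmodType) (F : C -> L -> V) a b x :
  (forall y, F 0 y = 0) ->
  \sum_y F (glY a b x y) y =
    if x is inr p then if p.2 == a then F 1 (inr (p.1, b)) else 0 else 0.
Proof.
move=> F0; case: x => [p|[i r]] /=.
  by rewrite big1 // => -[y|y] _; rewrite F0.
rewrite big_sumType /= big1 ?add0r => [|y _]; last by rewrite F0.
case: eqP => [_|_]; last by rewrite big1 // => s _; rewrite andbF F0.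
rewrite (bigD1 (i, b)) //= !eqxx big1 ?addr0 // => -[i' s] /= si.
case: eqP => [ii|_] /=; last by rewrite F0.
case: eqP => [sa|_] /=; last by rewrite F0.
by rewrite ii sa eqxx in si.
Qed.

Lemma sum2_glX (V : nmodType) (F : C -> L -> L -> V) a b :
  (forall x y, F 0 x y = 0) ->
  \sum_x \sum_y F (glX a b x y) x y = \sum_i F (-1) (inl (i, b)) (inl (i, a)).
Proof.
move=> F0; under eq_bigr => x _ do rewrite (sum_glX (F := fun u y => F u x y)) //.
rewrite big_sumType /= [X in _ + X]big1 // addr0.
transitivity (\sum_i \sum_r if r == b then F (-1) (inl (i, r)) (inl (i, a)) else 0).
  by rewrite pair_bigA; apply: eq_bigr => -[].
by apply: eq_bigr => i _; rewrite -big_mkcond big_pred1_eq.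
Qed.

Lemma sum2_glY (V : nmodType) (F : C -> L -> L -> V) a b :
  (forall x y, F 0 x y = 0) ->
  \sum_x \sum_y F (glY a b x y) x y = \sum_j F 1 (inr (j, a)) (inr (j, b)).
Proof.
move=> F0; under eq_bigr => x _ do rewrite (sum_glY (F := fun u y => F u x y)) //.
rewrite big_sumType /= [X in X + _]big1 // add0r.
transitivity (\sum_i \sum_r if r == a then F 1 (inr (i, r)) (inr (i, b)) else 0).
  by rewrite pair_bigA; apply: eq_bigr => -[].
by apply: eq_bigr => i _; rewrite -big_mkcond big_pred1_eq.
Qed.

Lemma glX_mul a b c d x y :
  \sum_z glX a b x z * glX c d z y = - ((a == d)%:R * glX c b x y).
Proof.
rewrite (sum_glX (F := fun u z => u * glX c d z y)) => [|z]; last by rewrite mul0r.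
case: x y => [[i r]|p] [[i' s]|p'] /=; try by case: ifP; rewrite !(mulr0, oppr0).
- by case: (r == b) (i == i') (a == d) (s == c) => [] [] [] [] /=; ring.
- by rewrite mulr0 oppr0.
- by rewrite mulr0 oppr0.
Qed.

Lemma glY_mul a b c d x y :
  \sum_z glY a b x z * glY c d z y = (b == c)%:R * glY a d x y.
Proof.
rewrite (sum_glY (F := fun u z => u * glY c d z y)) => [|z]; last by rewrite mul0r.
case: x y => [p|[i r]] [p'|[i' s]] /=; try by case: ifP; rewrite !(mulr0).
- by rewrite mulr0.
- by rewrite mulr0.
- by case: (r == a) (i == i') (b == c) (s == d) => [] [] [] [] /=; ring.
Qed.

Lemma glXY_mul a b c d x y : \sum_z glX a b x z * glY c d z y = 0.
Proof. by apply: big1 => -[p|p] _; case: x y => [x|x] [y|y] /=; rewrite ?(mulr0, mul0r). Qed.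

Lemma glYX_mul a b c d x y : \sum_z glY a b x z * glX c d z y = 0.
Proof. by apply: big1 => -[p|p] _; case: x y => [x|x] [y|y] /=; rewrite ?(mulr0, mul0r). Qed.

Lemma gl_mul a b c d x y : \sum_z gl a b x z * gl c d z y =
  (b == c)%:R * glY a d x y - (a == d)%:R * glX c b x y.
Proof.
under eq_bigr do rewrite mulrDr !mulrDl.
by rewrite !big_split /= glX_mul glY_mul glXY_mul glYX_mul addr0 add0r addrC.
Qed.

Lemma mcomm_gl a b c : a != c -> mcomm (gl a b) (gl b c) = gl a c.
Proof.
move=> ac; apply/funext => x; apply/funext => y.
rewrite /mcomm big_split /= sumrN !gl_mul !eqxx (negPf ac) eq_sym (negPf ac).
by rewrite !mul0r !mul1r subr0 sub0r opprK addrC.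
Qed.

Lemma wder_glXY a b c d f w :
  wder (glX a b) (wder (glY c d) f) w = wder (glY c d) (wder (glX a b) f) w.
Proof.
apply/eqP; rewrite -subr_eq0 wder_comm; apply/eqP.
rewrite (_ : mcomm _ _ = fun _ _ => 0); last first.
  apply/funext => x; apply/funext => y.
  by rewrite /mcomm big_split /= sumrN glXY_mul glYX_mul subr0.
elim: w f => [|x w IHw] f //=.
by rewrite IHw addr0 big1 // => y _; rewrite mul0r.
Qed.

(** The Casimir element, the sum of all E_ab E_ba, kills an invariant; its
two mixed parts are equal because [glX] and [glY] commute. *)
Lemma gl_casimir f : (forall a b, wder (gl a b) f = fun=> 0) -> forall w,
  \sum_a \sum_b (wder (glX a b) (wder (glX b a) f) w
                 + wder (glY a b) (wder (glY b a) f) w)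
  = - (2%:R * \sum_a \sum_b wder (glX a b) (wder (glY b a) f) w).
Proof.
move=> f0 w; apply/eqP; rewrite -addr_eq0; apply/eqP.
rewrite mulr_natl mulr2n; set S := \sum_a \sum_b wder (glX a b) (wder (glY b a) f) w.
have -> : S + S = \sum_a \sum_b (wder (glX a b) (wder (glY b a) f) w
     + wder (glY a b) (wder (glX b a) f) w).
  rewrite {2}/S exchange_big -big_split; apply: eq_bigr => a _ /=.
  by rewrite -big_split; apply: eq_bigr => b _; rewrite /= -wder_glXY.
rewrite -big_split big1 // => a _ /=; rewrite -big_split big1 // => b _ /=.
transitivity (wder (gl a b) (wder (gl b a) f) w); last by rewrite f0 wder0.
rewrite [RHS]wder_mxD.
have -> : wder (gl b a) f = fun v => wder (glX b a) f v + wder (glY b a) f v.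
  by apply/funext => v; rewrite -wder_mxD.
by rewrite !wderD addrACA [X in _ + X]addrC.
Qed.

(** The sum of the Y_aa counts the letters d in a word, and that of the
X_aa is minus the number of letters t. *)
Lemma gl_size f w :
  \sum_a (wder (glY a a) f w - wder (glX a a) f w) = (size w)%:R * f w.
Proof.
under eq_bigr do rewrite -wder_mxB.
rewrite -wder_mx_sum; set M := fun _ _ => _.
have ME x y : M x y = (x == y)%:R.
  rewrite /M; case: x y => [[i r]|[i r]] [[i' s]|[i' s]] /=.
  - rewrite (bigD1 r) //= eqxx big1 ?addr0 => [|a ar].
      by rewrite sub0r opprK [s == r]eq_sym.
    by rewrite [r == a]eq_sym (negPf ar) andbF oppr0 subr0.
  - by rewrite big1 // => a _; rewrite subrr.
  - by rewrite big1 // => a _; rewrite subrr.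
  - rewrite (bigD1 r) //= eqxx big1 ?addr0 => [|a ar].
      by rewrite subr0 [s == r]eq_sym.
    by rewrite [r == a]eq_sym (negPf ar) andbF subr0.
elim: w f => [|x w IHw] f /=; first by rewrite mul0r.
rewrite IHw (bigD1 x) //= ME eqxx mul1r big1 ?addr0 => [|y yx].
  by rewrite mulrSr mulrDl mul1r addrC.
by rewrite ME eq_sym (negPf yx) mul0r.
Qed.

(** Contraction of a letter t in row i with a letter d in row j, over all
pairs of places and all common columns. *)
Definition contract i j f w : C :=
  \sum_r ins (inr (j, r)) (ins (inl (i, r)) f) w.

(** Contraction pairs the vector representation with its dual, so gl_n
commutes with it. *)
Lemma contract_wder a b i j f : wder (gl a b) (contract i j f) = contract i j (wder (gl a b) f).
Proof.
apply/funext => w; rewrite wder_sum /contract.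
under [RHS]eq_bigr => r _.
  rewrite (_ : ins (inl (i, r)) (wder (gl a b) f) = fun v =>
     wder (gl a b) (ins (inl (i, r)) f) v
     + (- (r == b)%:R) * ins (inl (i, a)) f v); last first.
    apply/funext => v; rewrite ins_wder; congr (_ + _).
    transitivity (\sum_z glX a b (inl (i, r)) z * ins z f v
                  + \sum_z glY a b (inl (i, r)) z * ins z f v).
      by rewrite -big_split; apply: eq_bigr => z _; exact: mulrDl.
    rewrite (sum_glX (F := fun u z => u * ins z f v)) => [|z]; last by rewrite mul0r.
    rewrite [X in _ + X]big1 ?addr0 => [|z _]; last by rewrite mul0r.
    by rewrite /=; case: eqP => _; rewrite ?oppr0 ?mul0r.
  rewrite insD ins_wder.
  rewrite (_ : \sum_z _ = (r == a)%:R * ins (inr (j, b)) (ins (inl (i, r)) f) w); last first.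
    set g := ins (inl (i, r)) f.
    transitivity (\sum_z glX a b (inr (j, r)) z * ins z g w
                  + \sum_z glY a b (inr (j, r)) z * ins z g w).
      by rewrite -big_split; apply: eq_bigr => z _; exact: mulrDl.
    rewrite big1 ?add0r => [|z _]; last by rewrite mul0r.
    rewrite (sum_glY (F := fun u z => u * ins z g w)) => [|z]; last by rewrite mul0r.
    by rewrite /=; case: eqP => _; rewrite ?mul1r ?mul0r.
  over.
rewrite /= !big_split /= -[LHS]addr0 -addrA; congr (_ + _).
under [X in _ = _ + X]eq_bigr do rewrite insZ.
rewrite (bigD1 a) //= eqxx mul1r big1 ?addr0 => [|r ra]; last by rewrite (negPf ra) mul0r.
rewrite (bigD1 b) //= eqxx mulN1r big1 ?addr0 ?addrN // => r rb.
by rewrite (negPf rb) oppr0 mul0r.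
Qed.

End GlLetters.

Lemma glX_conj (C : numClosedFieldType) k l n a b (x y : letter k l n) :
  (glX C b a x y)^* = glX C a b y x.
Proof.
case: x y => [[i r]|p] [[i' s]|p'] /=; rewrite ?rmorph0 //.
by rewrite rmorphN rmorph_nat eq_sym [X in _ && X]andbC.
Qed.

Lemma glY_conj (C : numClosedFieldType) k l n a b (x y : letter k l n) :
  (glY C b a x y)^* = glY C a b y x.
Proof.
case: x y => [p|[i r]] [p'|[i' s]] /=; rewrite ?rmorph0 //.
by rewrite rmorph_nat eq_sym [X in _ && X]andbC.
Qed.

(** * The local ring at q = 1 *)

Lemma fracE (D : idomainType) (c : {fraction D}) :
  exists p r : D, r != 0 /\ c = tofrac p / tofrac r.
Proof.
elim/quotW: c => x; exists \n_x, \d_x.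
have d0 := denom_ratioP x; split=> //.
apply: (canRL (mulfK _)); first by rewrite tofrac_eq0.
change (FracField.mul (\pi x) (FracField.tofrac \d_x) = FracField.tofrac \n_x).
rewrite !piE; apply/eqmodP; rewrite /= FracField.equivfE.
by rewrite !numden_Ratio ?(oner_eq0, mulf_neq0) // !mulr1 mulrC.
Qed.

Lemma frac_crossmul (D : idomainType) (p r x a b : D) : r != 0 -> b != 0 ->
  tofrac p / tofrac r = tofrac x * (tofrac a / tofrac b) -> p * b = x * a * r.
Proof.
move=> r0 b0; have r0' : tofrac r != 0 by rewrite tofrac_eq0.
have b0' : tofrac b != 0 by rewrite tofrac_eq0.
move=> e; apply/eqP; rewrite -tofrac_eq !tofracM -[tofrac p](divfK r0') e.
apply/eqP; set X := tofrac x; set A := tofrac a; set B := tofrac b; set C := tofrac r.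
rewrite -!mulrA; congr (_ * _); congr (_ * _).
by rewrite mulrCA mulVf ?mulr1.
Qed.

Section LocalRing.
Variable R : realType.
Local Notation K := (Cq R).
Local Notation C := R[i].

Definition cst : C -> K := @tofrac {poly C} \o polyC.
HB.instance Definition _ := GRing.RMorphism.on cst.

(** Rational functions of q without pole at q = 1. *)
Definition local1 (c : K) : Prop :=
  exists p r : {poly C}, r.[1] != 0 /\ c = tofrac p / tofrac r.

Lemma horner1_tofrac_neq0 (r : {poly C}) : r.[1] != 0 -> tofrac r != 0 :> K.
Proof. by rewrite tofrac_eq0; apply: contraNneq => ->; rewrite horner0. Qed.

Lemma local1_tofrac p : local1 (tofrac p).
Proof. by exists p, 1; rewrite hornerC oner_neq0 tofrac1 divr1. Qed.

Lemma local1_cst c : local1 (cst c).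
Proof. exact: local1_tofrac. Qed.

Lemma local1_0 : local1 0.
Proof. by rewrite -tofrac0; apply: local1_tofrac. Qed.

Lemma local1_1 : local1 1.
Proof. by rewrite -tofrac1; apply: local1_tofrac. Qed.

Lemma local1_D a b : local1 a -> local1 b -> local1 (a + b).
Proof.
move=> [p [r [r1 ->]]] [p' [r' [r1' ->]]].
exists (p * r' + p' * r), (r * r'); split; first by rewrite hornerM mulf_neq0.
by rewrite tofracD !tofracM addf_div ?horner1_tofrac_neq0.
Qed.

Lemma local1_M a b : local1 a -> local1 b -> local1 (a * b).
Proof.
move=> [p [r [r1 ->]]] [p' [r' [r1' ->]]].
exists (p * p'), (r * r'); split; first by rewrite hornerM mulf_neq0.
by rewrite !tofracM mulf_div.
Qed.

Lemma local1_N a : local1 a -> local1 (- a).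
Proof.
move=> [p [r [r1 ->]]]; exists (- p), r; split=> //.
by rewrite tofracN mulNr.
Qed.

Lemma local1_sum (I : Type) (r : seq I) (f : I -> K) :
  (forall i, local1 (f i)) -> local1 (\sum_(i <- r) f i).
Proof.
by move=> f1; elim/big_rec: _ => [|i x _ x1]; [exact: local1_0 | exact: local1_D].
Qed.

Lemma local1_q : local1 q.
Proof. exact: local1_tofrac. Qed.

Lemma local1_qV : local1 q^-1.
Proof.
by exists 1, 'X; rewrite hornerX oner_neq0 tofrac1 mul1r.
Qed.

Lemma q1_tofrac : q - 1 = tofrac ('X - 1%:P) :> K.
Proof. by rewrite tofracB tofrac1. Qed.

Lemma q1_neq0 : q - 1 != 0 :> K.
Proof. by rewrite q1_tofrac tofrac_eq0 polyXsubC_eq0. Qed.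

(** The constant is the value at q = 1. *)
Lemma local1_res c : local1 c ->
  exists a c', local1 c' /\ c = cst a + (q - 1) * c'.
Proof.
move=> [p [r [r1 ->]]]; pose a := p.[1] / r.[1].
have : root (p - a%:P * r) 1.
  by rewrite /root hornerD hornerN hornerM hornerC /a divfK // subrr.
move/factor_theorem => [s ps]; exists a, (tofrac s / tofrac r); split.
  by exists s, r.
have r0 := horner1_tofrac_neq0 r1.
rewrite q1_tofrac mulrA -tofracM [('X - _) * s]mulrC -ps tofracB tofracM.
by rewrite mulrBl mulfK // addrC subrK.
Qed.

(** The exponent is the multiplicity of 1 as a root of a denominator. *)
Lemma local1_scale c : exists e, local1 ((q - 1) ^+ e * c).
Proof.
have [p [r [r0 ->]]] := fracE c.
have [e [s]] := multiplicity_XsubC r 1; rewrite r0 /= => s1 rs.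
exists e, p, s; split=> //.
have Q0 : (q - 1) ^+ e != 0 :> K by rewrite expf_neq0 // q1_neq0.
rewrite rs tofracM tofracXn -q1_tofrac mulrCA; congr (_ * _).
by rewrite invfM mulrCA mulfV // mulr1.
Qed.

(** The numerator would be divisible by every power of q - 1. *)
Lemma local1_inter c : (forall e, exists2 c', local1 c' & c = (q - 1) ^+ e * c') ->
  c = 0.
Proof.
have [p [r [r0 ->]]] := fracE c => pe.
suff -> : p = 0 by rewrite tofrac0 mul0r.
apply: contraTeq isT => p0.
have [_ [a [b [b1 ->]]]] := pe (size p).
rewrite q1_tofrac -tofracXn => pab.
have b0 : b != 0 by apply: contraNneq b1 => ->; rewrite horner0.
have e := frac_crossmul r0 b0 pab.
have cop : coprimep (('X - 1%:P) ^+ size p) b.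
  by rewrite coprimep_expl // coprimep_sym coprimep_XsubC.
have : ('X - 1%:P) ^+ size p %| p.
  rewrite -(Gauss_dvdpl p cop) e -mulrA dvdp_mulr //.
move/(dvdp_leq p0); rewrite size_exp_XsubC ltnn //.
Qed.
End LocalRing.

(** * Relations of the quantized Weyl algebra *)

(** The defining relations are expressions in the generators, so they
commute with algebra morphisms; applied to the projection from the free
algebra. *)
Lemma PD_rel_morph (K : fieldType) (c0 : K) m n (A B : algType K) (phi : A -> B)
    (X : PD_index m n -> A) (Y : PD_index m n -> B) :
  {morph phi : x y / x + y} -> {morph phi : x y / x * y} ->
  (forall c, {morph phi : x / c *: x}) -> phi 1 = 1 -> (forall g, phi (X g) = Y g) ->
  forall s, PD_rel c0 Y s -> exists2 r, PD_rel c0 X r & phi r = s.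
Proof.
move=> phiD phiM phiZ phi1 phiX.
have phiN : {morph phi : x / - x} by move=> x; rewrite -scaleN1r phiZ scaleN1r.
have phi0 : phi 0 = 0 by rewrite -(scale0r 1) phiZ scale0r.
have phiS (I : finType) (P : pred I) (f : I -> A) :
    phi (\sum_(i | P i) f i) = \sum_(i | P i) phi (f i).
  exact: (big_morph phi phiD phi0).
have phiE := (phiD, phiN, phiM, phiZ, phi1, phiS, phiX).
move=> s [k i j ij|k i j ij|i k j l ik jl|i k j l ik jl
       |k i j ij|k i j ij|i k j l ik jl|i k j l ik jl
       |c e a b ba ce|c a b ba|c e a ce|c e].
- by exists (X (inl (k, i)) * X (inl (k, j)) - c0 *: (X (inl (k, j)) * X (inl (k, i))));
    [apply: PD_R1row | rewrite !phiE].
- by eexists; [apply: (PD_R1col c0 X k ij) | rewrite !phiE].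
- by eexists; [apply: (PD_R2comm c0 X ik jl) | rewrite !phiE].
- by eexists; [apply: (PD_R2 c0 X ik jl) | rewrite !phiE].
- by eexists; [apply: (PD_R1'row c0 X k ij) | rewrite !phiE].
- by eexists; [apply: (PD_R1'col c0 X k ij) | rewrite !phiE].
- by eexists; [apply: (PD_R2'comm c0 X ik jl) | rewrite !phiE].
- by eexists; [apply: (PD_R2' c0 X ik jl) | rewrite !phiE].
- by eexists; [apply: (PD_R3 c0 X ba ce) | rewrite !phiE].
- eexists; [apply: (PD_R4 c0 X c ba) | rewrite !phiE].
  by congr (_ - _ *: _); apply: eq_bigr => i _; rewrite !phiE.
- eexists; [apply: (PD_R5 c0 X a ce) | rewrite !phiE].
  by congr (_ - _ *: _); apply: eq_bigr => i _; rewrite !phiE.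
- eexists; [apply: (PD_R6 c0 X c e) | rewrite !phiE].
  congr (_ - _); apply: eq_bigr => i _; rewrite !phiE; apply: eq_bigr => j _.
  by rewrite !phiE.
Qed.

Lemma PD_relP (R : realType) (m n : nat) (s : PD R m n) :
  PD_rel q (pgen (PD_presentation R m n)) s -> s = 0.
Proof.
case/(PD_rel_morph (quot_piD _) (quot_piM _) (@quot_piZ _ _ _) (quot_pi1 _)
        (fun g => erefl)) => r rel <-.
apply: etrans (quot_pi0 (pres_ideal _)).
by apply/quot_piP; rewrite subr0; apply: ideal2_gen_in.
Qed.

(** * Lattices spanned by words *)

Section Lattice.
Variables (R : realType) (A : algType (Cq R)) (F : filtration A).
Variables (L : finType) (gen : L -> A).
Hypothesis gen_filt : forall x, F 1 (gen x).
Local Notation K := (Cq R).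
Local Notation C := R[i].
Local Notation word w := (\prod_(x <- w) gen x).

(** An O-lattice in degree [d] of the graded algebra, pulled back to the
filtration: lower degree is included, without any integrality. *)
Inductive lat (d : nat) : A -> Prop :=
| lat_low x : filt_pred F d x -> lat d x
| lat_D x y : lat d x -> lat d y -> lat d (x + y)
| lat_Z c x : local1 c -> lat d x -> lat d (c *: x)
| lat_word (w : seq L) : size w = d -> lat d (word w).

(** Congruence to 0 at q = 1 in the graded algebra. *)
Definition latN d x := exists y z, [/\ lat d y, filt_pred F d z & x = (q - 1) *: y + z].

Lemma low_filt d x : filt_pred F d x -> F d x.
Proof. by case: d => [->|d]; [exact: filt_0 | exact: filt_S]. Qed.

Lemma lowZ d c x : filt_pred F d x -> filt_pred F d (c *: x).
Proof. by case: d => [->|d]; [rewrite /= scaler0 | exact: filt_Z]. Qed.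

Lemma word_filt w : F (size w) (word w).
Proof.
elim: w => [|x w IHw]; first by rewrite big_nil; apply: filt_1.
by rewrite big_cons /= -add1n; apply: filt_M.
Qed.

Lemma lat_filt d x : lat d x -> F d x.
Proof.
elim=> {x} [x /low_filt //|x y _ ? _ ?|c x _ _ ?|w <-].
- exact: filt_D.
- exact: filt_Z.
- exact: word_filt.
Qed.

Lemma lat_0 d : lat d 0.
Proof. exact/lat_low/filt_pred_0. Qed.

Lemma lat_sum d (I : Type) (r : seq I) (f : I -> A) :
  (forall i, lat d (f i)) -> lat d (\sum_(i <- r) f i).
Proof. by move=> fl; elim/big_rec: _ => [|i x _ xl]; [exact: lat_0 | exact: lat_D]. Qed.

Lemma lat_gen x : lat 1 (gen x).
Proof. by have := @lat_word 1 [:: x] erefl; rewrite big_seq1. Qed.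

Lemma lat_M d e x y : lat d x -> lat e y -> lat (d + e) (x * y).
Proof.
move=> lx ly; elim: lx => {x} [x lx|x x' _ ? _ ?|c x c1 _ ?|w wd].
- exact/lat_low/filt_predMr/lat_filt.
- by rewrite mulrDl; apply: lat_D.
- by rewrite -scalerAl; apply: lat_Z.
elim: ly => {y} [y ly|y y' _ ? _ ?|c y c1 _ ?|w' we].
- by apply: lat_low; apply: filt_predMl => //; rewrite -wd; apply: word_filt.
- by rewrite mulrDr; apply: lat_D.
- by rewrite -scalerAr; apply: lat_Z.
by rewrite -big_cat; apply: lat_word; rewrite size_cat wd we.
Qed.

Lemma local1_q1 : local1 (q - 1 : K).
Proof. by apply: local1_D; [exact: local1_q | exact/local1_N/local1_1]. Qed.

Lemma latN_lat d x : latN d x -> lat d x.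
Proof.
move=> [y [z [ly lz ->]]]; apply: lat_D; last exact: lat_low.
by apply: lat_Z => //; exact: local1_q1.
Qed.

Lemma latN_low d x : filt_pred F d x -> latN d x.
Proof. by move=> lx; exists 0, x; rewrite scaler0 add0r; split=> //; exact: lat_0. Qed.

Lemma latN_0 d : latN d 0.
Proof. exact/latN_low/filt_pred_0. Qed.

Lemma latN_q1 d c x : local1 c -> lat d x -> latN d (((q - 1) * c) *: x).
Proof.
move=> c1 lx; exists (c *: x), 0; rewrite addr0 scalerA; split=> //; first exact: lat_Z.
exact: filt_pred_0.
Qed.

Lemma latN_D d x y : latN d x -> latN d y -> latN d (x + y).
Proof.
move=> [u [z [lu lz ->]]] [u' [z' [lu' lz' ->]]]; exists (u + u'), (z + z').
by rewrite addrACA scalerDr; split=> //; [exact: lat_D | exact: filt_predD].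
Qed.

Lemma latN_Z d c x : local1 c -> latN d x -> latN d (c *: x).
Proof.
move=> c1 [u [z [lu lz ->]]]; exists (c *: u), (c *: z).
by rewrite scalerDr !scalerA mulrC; split=> //; [exact: lat_Z | exact: lowZ].
Qed.

Lemma latN_N d x : latN d x -> latN d (- x).
Proof. by rewrite -scaleN1r; apply: latN_Z; apply/local1_N/local1_1. Qed.

Lemma latN_sum d (I : Type) (r : seq I) (f : I -> A) :
  (forall i, latN d (f i)) -> latN d (\sum_(i <- r) f i).
Proof. by move=> fl; elim/big_rec: _ => [|i x _ xl]; [exact: latN_0 | exact: latN_D]. Qed.

Lemma latN_Ml d e x y : lat d x -> latN e y -> latN (d + e) (x * y).
Proof.
move=> lx [u [z [lu lz ->]]]; exists (x * u), (x * z).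
by rewrite mulrDr scalerAr; split=> //; [exact: lat_M | apply: filt_predMl => //; exact: lat_filt].
Qed.

Lemma latN_Mr d e x y : latN d x -> lat e y -> latN (d + e) (x * y).
Proof.
move=> [u [z [lu lz ->]]] ly; exists (u * y), (z * y).
by rewrite mulrDl scalerAl; split=> //; [exact: lat_M | apply: filt_predMr => //; exact: lat_filt].
Qed.

Lemma latN_mul d e x x' y y' : lat e y -> lat d x' ->
  latN d (x - x') -> latN e (y - y') -> latN (d + e) (x * y - x' * y').
Proof.
move=> ly lx' xx yy; have -> : x * y - x' * y' = (x - x') * y + x' * (y - y').
  by rewrite mulrBl mulrBr addrA subrK.
by apply: latN_D; [exact: latN_Mr | exact: latN_Ml].
Qed.

Lemma latN_trans d y x z : latN d (x - y) -> latN d (y - z) -> latN d (x - z).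
Proof. by move=> xy yz; rewrite -[x](subrK y) -addrA; apply: latN_D. Qed.

Definition evK d (f : seq L -> K) : A := wsum d (fun w => f w *: word w).
(** The value in the algebra of a tensor with constant coefficients. *)
Definition ev d (f : seq L -> C) : A := evK d (fun w => cst (f w)).

Lemma eq_evK d f g : (forall w, size w = d -> f w = g w) -> evK d f = evK d g.
Proof. by move=> fg; apply: eq_wsum => w wd; rewrite fg. Qed.

Lemma eq_ev d f g : (forall w, size w = d -> f w = g w) -> ev d f = ev d g.
Proof. by move=> fg; apply: eq_evK => w wd; rewrite fg. Qed.

Lemma evKD d f g : evK d (fun w => f w + g w) = evK d f + evK d g.
Proof.
by rewrite /evK !wsum_tuple -big_split; apply: eq_bigr => w _; rewrite scalerDl.
Qed.

Lemma evKZ d c f : evK d (fun w => c * f w) = c *: evK d f.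
Proof.
by rewrite /evK !wsum_tuple scaler_sumr; apply: eq_bigr => w _; rewrite scalerA.
Qed.

Lemma evD d f g : ev d (fun w => f w + g w) = ev d f + ev d g.
Proof. by rewrite /ev -evKD; apply: eq_evK => w _; rewrite rmorphD. Qed.

Lemma evZ d c f : ev d (fun w => c * f w) = cst c *: ev d f.
Proof. by rewrite /ev -evKZ; apply: eq_evK => w _; rewrite rmorphM. Qed.

Lemma ev0 d : ev d (fun=> 0) = 0.
Proof.
transitivity (ev d (fun w => 0 * 0)); first by apply: eq_ev => w _; rewrite mul0r.
by rewrite (evZ d 0 (fun=> 0)) rmorph0 scale0r.
Qed.

Lemma ev_sum d (I : Type) (r : seq I) (f : I -> seq L -> C) :
  ev d (fun w => \sum_(i <- r) f i w) = \sum_(i <- r) ev d (f i).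
Proof.
elim: r => [|i r IHr].
  by rewrite big_nil -(ev0 d); apply: eq_ev => w _; rewrite big_nil.
by rewrite big_cons -IHr -evD; apply: eq_ev => w _; rewrite big_cons.
Qed.

Lemma ev_cons d f : ev d.+1 f = \sum_x gen x * ev d (fun u => f (x :: u)).
Proof.
rewrite /ev /evK /=; apply: eq_bigr => x _.
rewrite (wsum_morph (phi := fun y => gen x * y)) ?mulr0 //; last first.
  by move=> y z; rewrite mulrDr.
by apply: eq_wsum => w _; rewrite big_cons scalerAr.
Qed.

Lemma ev_nil f : ev 0 f = cst (f [::]) *: 1.
Proof. by rewrite /ev /evK /= big_nil. Qed.

Lemma evK_delta w d (h : K) : size w = d ->
  evK d (fun v => if v == w then h else 0) = h *: word w.
Proof.
move=> /eqP wd; rewrite /evK wsum_tuple (bigD1 (Tuple wd)) //= eqxx [X in _ + X]big1 ?addr0 //.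
by move=> v; rewrite -val_eqE /= => /negPf->; rewrite scale0r.
Qed.

Lemma ev_delta w d : size w = d -> word w = ev d (fun v => (v == w)%:R).
Proof.
move=> wd; rewrite -[LHS]scale1r -(evK_delta 1 wd); apply: eq_evK => v _.
by case: eqP => _; rewrite ?rmorph1 ?rmorph0.
Qed.

Lemma lat_evKl d f : (forall w, local1 (f w)) -> lat d (evK d f).
Proof.
move=> f1; rewrite /evK wsum_tuple; apply: lat_sum => w; apply: lat_Z => //.
by apply: lat_word; rewrite size_tuple.
Qed.

Lemma lat_ev d f : lat d (ev d f).
Proof. by apply: lat_evKl => w; apply: local1_cst. Qed.

Lemma lat_evK d x : lat d x ->
  exists2 f, (forall w, local1 (f w)) & filt_pred F d (x - evK d f).
Proof.
elim=> {x} [x lx|x y _ [f f1 xf] _ [g g1 yg]|c x c1 _ [f f1 xf]|w wd].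
- exists (fun=> 0) => [w|]; first exact: local1_0.
  have -> : evK d (fun=> 0) = 0 by rewrite -[RHS](ev0 d); apply: eq_evK => w _; rewrite rmorph0.
  by rewrite subr0.
- exists (fun w => f w + g w) => [w|]; first exact: local1_D.
  by rewrite evKD opprD addrACA; apply: filt_predD.
- exists (fun w => c * f w) => [w|]; first exact: local1_M.
  by rewrite evKZ -scalerBr; apply: lowZ.
- exists (fun v => if v == w then 1 else 0) => [v|].
    by case: ifP => _; [exact: local1_1 | exact: local1_0].
  by rewrite (evK_delta 1 wd) scale1r subrr; apply: filt_pred_0.
Qed.

(** Tensors with constant coefficients represent the fibre of the lattice at
q = 1. *)
Lemma lat_res d x : lat d x -> exists f, latN d (x - ev d f).
Proof.
elim=> {x} [x lx|x y _ [f xf] _ [g yg]|c x c1 lx [f xf]|w wd].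
- by exists (fun=> 0); rewrite ev0 subr0; apply: latN_low.
- by exists (fun w => f w + g w); rewrite evD opprD addrACA; apply: latN_D.
- have [a [c' [c1' ->]]] := local1_res c1; exists (fun w => a * f w).
  rewrite evZ scalerDl addrAC -scalerBr; apply: latN_D; last exact: latN_q1.
  by apply: latN_Z => //; apply: local1_cst.
- by exists (fun v => (v == w)%:R); rewrite (ev_delta wd) subrr; apply: latN_0.
Qed.

Section SkewDerivation.
Variables (T P Q : A -> A) (M : L -> L -> C).
Hypotheses (TD : {morph T : x y / x + y}) (TZ : forall c, {morph T : x / c *: x}).
Hypotheses (PD : {morph P : x y / x + y}) (PZ : forall c, {morph P : x / c *: x}).
Hypothesis P1 : P 1 = 1.
Hypothesis PM : {morph P : x y / x * y}.
Hypothesis P_gen : forall x, latN 1 (P (gen x) - gen x).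
Hypothesis Q_gen : forall x, latN 1 (Q (gen x) - gen x).
Hypothesis TM : forall x y, T (x * y) = T x * P y + Q x * T y.
Hypothesis T1 : T 1 = 0.
Hypothesis T_gen : forall y, latN 1 (T (gen y) - \sum_x cst (M x y) *: gen x).

(** A group-like element that is close to 1 on letters is close to 1 on
words. *)
Lemma ev_grouplike d f : latN d (P (ev d f) - ev d f).
Proof.
elim: d f => [|d IHd] f.
  by rewrite ev_nil PZ P1 subrr; apply: latN_0.
have P0 : P 0 = 0 by have := PZ 0 0; rewrite !scale0r.
rewrite ev_cons (big_morph P PD P0) -sumrB; apply: latN_sum => x.
rewrite PM; apply: (@latN_mul 1 d _ _ _ _ _ (lat_gen x) (P_gen x) (IHd _)).
by rewrite -[P _](subrK (ev d (fun u => f (x :: u)))); apply: lat_D (lat_ev _ _); apply: latN_lat.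
Qed.

(** [T] is a skew derivation whose twists [P] and [Q] are trivial at q = 1:
there it becomes the derivation extending its values [M] on letters. *)
Lemma ev_skew d f : latN d (T (ev d f) - ev d (wder M f)).
Proof.
elim: d f => [|d IHd] f.
  by rewrite !ev_nil TZ T1 scaler0 /= rmorph0 scale0r subr0; apply: latN_0.
have T0 : T 0 = 0 by have := TZ 0 0; rewrite !scale0r.
have lP x : lat d (P (ev d (fun u => f (x :: u)))).
  by rewrite -[P _](subrK (ev d (fun u => f (x :: u)))); apply: lat_D (lat_ev _ _); apply/latN_lat/ev_grouplike.
have lT x : lat d (T (ev d (fun u => f (x :: u)))).
  by rewrite -[T _](subrK (ev d (wder M (fun u => f (x :: u))))); apply: lat_D (lat_ev _ _); apply/latN_lat.
rewrite [in X in T X]ev_cons (big_morph T TD T0).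
have -> : ev d.+1 (wder M f) =
    \sum_y ((\sum_x cst (M x y) *: gen x) * ev d (fun u => f (y :: u))
           + gen y * ev d (wder M (fun u => f (y :: u)))).
  rewrite ev_cons /=; under eq_bigr => x _.
    rewrite evD (ev_sum d (index_enum L) (fun y u => M x y * f (y :: u))) mulrDr mulr_sumr.
    over.
  rewrite !big_split /=; congr (_ + _).
  rewrite exchange_big; apply: eq_bigr => y _ /=.
  by rewrite mulr_suml; apply: eq_bigr => x _; rewrite evZ -scalerAr scalerAl.
rewrite -sumrB; apply: latN_sum => y; rewrite TM opprD addrACA.
apply: latN_D; apply: (@latN_mul 1 d) => //.
- by apply: lat_sum => x; apply: lat_Z (lat_gen x); apply: local1_cst.
- exact: ev_grouplike.
- exact: lat_gen.
Qed.

Hypothesis T_filt : forall d x, F d x -> F d (T x).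

Lemma skew_low d x : filt_pred F d x -> filt_pred F d (T x).
Proof.
case: d => [->|d]; last exact: T_filt.
by have := TZ 0 0; rewrite !scale0r.
Qed.

Lemma skew_lat d x : lat d x -> lat d (T x).
Proof.
elim=> {x} [x lx|x y _ ? _ ?|c x c1 _ ?|w wd].
- exact/lat_low/skew_low.
- by rewrite TD; apply: lat_D.
- by rewrite TZ; apply: lat_Z.
- rewrite (ev_delta wd); set f := fun v => _.
  rewrite -[T _](subrK (ev d (wder M f))); apply: lat_D (lat_ev _ _).
  exact/latN_lat/ev_skew.
Qed.

Lemma skew_latN d x : latN d x -> latN d (T x).
Proof.
move=> [y [z [ly lz ->]]]; exists (T y), (T z).
by rewrite TD TZ; split=> //; [exact: skew_lat | exact: skew_low].
Qed.

(** The form in which [ev_skew] is used: the derivation sends every tensor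
that represents an element killed by [T] to a relation at q = 1. *)
Lemma skew_invariant d y f : filt_pred F d (T y) -> latN d (ev d f - y) ->
  latN d (ev d (wder M f)).
Proof.
move=> Ty fy; have TB u v : T (u - v) = T u - T v.
  by rewrite TD -scaleN1r TZ scaleN1r.
rewrite -[ev d (wder M f)]subr0; apply: (latN_trans (y := T (ev d f))).
  by rewrite -opprB; apply/latN_N/ev_skew.
by rewrite subr0 -[T _](subrK (T y)) -TB; apply: latN_D; [exact: skew_latN | exact: latN_low].
Qed.

End SkewDerivation.

Hypothesis gen_comm : forall x y, latN 2 (gen x * gen y - gen y * gen x).

(** As letters commute at q = 1, the letter that a derivation replaces can
be moved to the front. *)
Lemma ev_wder (M : L -> L -> C) d f :
  latN d.+1 (ev d.+1 (wder M f) - \sum_x \sum_y cst (M x y) *: (gen x * ev d (ins y f))).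
Proof.
elim: d f => [|d IHd] f.
  rewrite ev_cons -sumrB; apply: latN_sum => x.
  rewrite ev_nil /= addr0 -scalerAr mulr1 rmorph_sum scaler_suml -sumrB.
  rewrite big1 => [|y _]; first exact: latN_0.
  by rewrite ev_nil /= addr0 rmorphM -scalerAr mulr1 scalerA subrr.
have evins y : ev d.+1 (ins y f) = ev d.+1 (fun u => f (y :: u))
    + \sum_z gen z * ev d (ins y (fun u => f (z :: u))).
  rewrite (_ : \sum_z _ =
      ev d.+1 (fun w => if w is z :: u then ins y (fun u => f (z :: u)) u else 0)).
    by rewrite -evD; apply: eq_ev => -[|z u].
  by rewrite [RHS]ev_cons.
have -> : \sum_x \sum_y cst (M x y) *: (gen x * ev d.+1 (ins y f)) =
   \sum_x \sum_y cst (M x y) *: (gen x * ev d.+1 (fun u => f (y :: u))) +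
   \sum_x \sum_y cst (M x y) *: (gen x * \sum_z gen z * ev d (ins y (fun u => f (z :: u)))).
  rewrite -big_split; apply: eq_bigr => x _; rewrite -big_split; apply: eq_bigr => y _ /=.
  by rewrite evins mulrDr scalerDr.
have -> : ev d.+2 (wder M f) =
   \sum_x \sum_y cst (M x y) *: (gen x * ev d.+1 (fun u => f (y :: u))) +
   \sum_z gen z * ev d.+1 (wder M (fun u => f (z :: u))).
  rewrite ev_cons -big_split; apply: eq_bigr => x _.
  rewrite evD (ev_sum d.+1 (index_enum L) (fun y u => M x y * f (y :: u))) mulrDr mulr_sumr.
  by congr (_ + _); apply: eq_bigr => y _; rewrite evZ -scalerAr.
rewrite opprD addrACA subrr add0r.
apply: (@latN_trans _ (\sum_z gen z *
    \sum_x \sum_y cst (M x y) *: (gen x * ev d (ins y (fun u => f (z :: u)))))).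
  by rewrite -sumrB; apply: latN_sum => z; rewrite -mulrBr -add1n; apply: latN_Ml (IHd _); apply: lat_gen.
(* What remains is the difference between z x and x z, for a first letter z. *)
rewrite (_ : \sum_x \sum_y cst (M x y) *: (gen x * \sum_z gen z * ev d (ins y (fun u => f (z :: u)))) =
  \sum_z \sum_x \sum_y cst (M x y) *: (gen x * (gen z * ev d (ins y (fun u => f (z :: u)))))); last first.
  rewrite [RHS]exchange_big; apply: eq_bigr => x _.
  rewrite [RHS]exchange_big; apply: eq_bigr => y _ /=.
  by rewrite mulr_sumr scaler_sumr.
rewrite -sumrB; apply: latN_sum => z; rewrite mulr_sumr -sumrB; apply: latN_sum => x.
rewrite mulr_sumr -sumrB; apply: latN_sum => y.
rewrite -scalerAr -scalerBr; apply: latN_Z; first exact: local1_cst.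
by rewrite !mulrA -mulrBl -add2n; apply: latN_Mr; [apply: gen_comm | apply: lat_ev].
Qed.

End Lattice.

(** * Classical invariants: the Casimir argument *)

Lemma wdotD (C : numClosedFieldType) (L : finType) d (f g h : seq L -> C) :
  wdot d (fun w => f w + g w) h = wdot d f h + wdot d g h.
Proof.
by rewrite /wdot !wsum_tuple -big_split; apply: eq_bigr => w _; rewrite mulrDl.
Qed.

Lemma wdot_sum (C : numClosedFieldType) (L I : finType) d (f : I -> seq L -> C) h :
  wdot d (fun w => \sum_i f i w) h = \sum_i wdot d (f i) h.
Proof.
rewrite /wdot wsum_tuple; under eq_bigr do rewrite mulr_suml.
by rewrite exchange_big; apply: eq_bigr => i _; rewrite wsum_tuple.
Qed.

Lemma wdot_conj (C : numClosedFieldType) (L : finType) d (f g : seq L -> C) :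
  (wdot d f g)^* = wdot d g f.
Proof.
rewrite /wdot !wsum_tuple rmorph_sum; apply: eq_bigr => w _ /=.
by rewrite rmorphM /= conjCK mulrC.
Qed.

Section Contraction.
Variables (R : realType) (A : algType (Cq R)) (F : filtration A) (k l n : nat).
Local Notation L := (letter k l n).
Variable (gen : L -> A).
Local Notation K := (Cq R).
Local Notation C := R[i].
Local Notation latN := (latN F gen).
Local Notation lat := (lat F gen).
Local Notation ev := (ev gen).
Hypothesis gen_filt : forall x, F 1 (gen x).
Hypothesis gen_comm : forall x y, latN 2 (gen x * gen y - gen y * gen x).

(** The elements L_ij, for an arbitrary family of generators. *)
Definition quad (i : 'I_k) (j : 'I_l) : A :=
  \sum_(r < n) gen (inl (i, r)) * gen (inr (j, r)).

(** The span of the products of d/2 elements L_ij, which is zero for odd d.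
Recording the degree d is what allows passing to the graded algebra. *)
Inductive quad_span : nat -> A -> Prop :=
| quad_span_0 d : quad_span d 0
| quad_span_D d x y : quad_span d x -> quad_span d y -> quad_span d (x + y)
| quad_span_Z d c x : quad_span d x -> quad_span d (c *: x)
| quad_span_1 : quad_span 0 1
| quad_span_M d i j x : quad_span d x -> quad_span d.+2 (quad i j * x).

Lemma quad_span_sum d (I : Type) (r : seq I) (f : I -> A) :
  (forall i, quad_span d (f i)) -> quad_span d (\sum_(i <- r) f i).
Proof.
move=> fl; elim/big_rec: _ => [|i x _ xl]; first exact: quad_span_0.
exact: quad_span_D.
Qed.

Lemma lat_quad i j : lat 2 (quad i j).
Proof.
by apply: lat_sum => r; rewrite -[2%N]/(1 + 1)%N; apply: lat_M => //; apply: lat_gen.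
Qed.

(** Up to sign, X_ab replaces a letter t in column a by one in column b, and
Y_ba a letter d in column a by one in column b.  Moving the two new letters to the
front and summing over b produces L_ij, while summing over a contracts the two
old letters. *)
Lemma ev_mixed_casimir d (g : seq L -> C) :
  latN d.+2 (ev d.+2 (fun w => \sum_a \sum_b wder (glX C a b) (wder (glY C b a) g) w)
             + \sum_i \sum_j quad i j * ev d (contract i j g)).
Proof.
have cst0 (x : A) : cst (0 : C) *: x = 0 by rewrite rmorph0 scale0r.
pose G a b i j : A := gen (inl (i, b)) * (gen (inr (j, b)) *
          ev d (ins (inr (j, a)) (ins (inl (i, a)) g))).
have XY a b : latN d.+2 (ev d.+2 (wder (glX C a b) (wder (glY C b a) g))
     + \sum_i \sum_j G a b i j).
  have := ev_wder gen_filt gen_comm (glX C a b) d.+1 (wder (glY C b a) g).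
  rewrite (sum2_glX (F := fun u x y => cst u *: (gen x * ev d.+1 (ins y _)))) // => XN.
  rewrite -[\sum_i _]opprK; apply: latN_trans XN _.
  rewrite -sumrN -sumrB; apply: latN_sum => i.
  rewrite rmorphN rmorph1 scaleN1r -opprD; apply/latN_N.
  rewrite -mulr_sumr -mulrBr -add1n; apply: latN_Ml; [exact: gen_filt|exact: lat_gen|].
  have := ev_wder gen_filt gen_comm (glY C b a) d (ins (inl (i, a)) g).
  rewrite (sum2_glY (F := fun u x y => cst u *: (gen x * ev d (ins y _)))) // => YN.
  under [X in _ - X]eq_bigr do rewrite -[_ * _]scale1r -(rmorph1 (@cst R)).
  rewrite (@eq_ev _ _ _ gen d.+1 _ (wder (glY C b a) (ins (inl (i, a)) g))) // => w _.
  by rewrite ins_wder [X in _ + X]big1 ?addr0 // => z _; rewrite mul0r.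
rewrite (ev_sum gen d.+2 (index_enum _) (fun a w => \sum_b _)).
under eq_bigr do rewrite (ev_sum gen d.+2 (index_enum _) (fun b w => _)).
have -> : \sum_i \sum_j quad i j * ev d (contract i j g) =
  \sum_a \sum_b \sum_i \sum_j G a b i j.
  transitivity (\sum_i \sum_j \sum_a \sum_b G a b i j).
    apply: eq_bigr => i _; apply: eq_bigr => j _.
    rewrite (ev_sum gen d (index_enum _) (fun a w => _)) mulr_sumr; apply: eq_bigr => a _.
    by rewrite mulr_suml; apply: eq_bigr => b _; rewrite -mulrA.
  under eq_bigr do rewrite exchange_big; rewrite exchange_big; apply: eq_bigr => a _ /=.
  under eq_bigr do rewrite exchange_big /=; rewrite exchange_big; apply: eq_bigr => b _ /=.
  by apply: eq_bigr => i _.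
rewrite -big_split; apply: latN_sum => a /=; rewrite -big_split; apply: latN_sum => b.
exact: XY.
Qed.

Variable inv : nat -> A -> Prop.
Hypothesis inv_span : forall d x, quad_span d x -> inv d x.
Hypothesis wder_inv : forall d y f (a b : 'I_n), inv d y -> latN d (ev d f - y) ->
  latN d (ev d (wder (gl C a b) f)).

Let J d f := exists2 y, quad_span d y & latN d (ev d f - y).

(** The first fundamental theorem at q = 1, by the Casimir argument.  The
predicate [inv] stands for invariance of an element of the quantum algebra; it
serves to show that gl_n maps J into the space of relations. *)
Lemma gl_invariant_span d (c : seq L -> C) :
  (forall a b, latN d (ev d (wder (gl C a b) c))) -> J d c.
Proof.
elim/ltn_ind: d c => d IHd c cN.
have JD f g : J d f -> J d g -> J d (fun w => f w + g w).
  move=> [y sy fy] [z sz gz]; exists (y + z); first exact: quad_span_D.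
  by rewrite evD opprD addrACA; apply: latN_D.
have JZ e f : J d f -> J d (fun w => e * f w).
  move=> [y sy fy]; exists (cst e *: y); first exact: quad_span_Z.
  by rewrite evZ -scalerBr; apply: latN_Z => //; apply: local1_cst.
have J0 : J d (fun=> 0).
  by exists 0; [exact: quad_span_0 | rewrite ev0 subr0; apply: latN_0].
have Jext f g : (forall w, size w = d -> f w = g w) -> J d f -> J d g.
  by move=> fg [y sy fy]; exists y => //; rewrite -(eq_ev gen fg).
have JN f : latN d (ev d f) -> J d f.
  by move=> fN; exists 0; [exact: quad_span_0 | rewrite subr0].
have Jgl a b f : J d f -> J d (wder (gl C a b) f).
  by move=> [y /inv_span iy fy]; apply/JN/(wder_inv _ _ iy fy).
case: d => [|d'] in IHd cN JD JZ J0 Jext JN Jgl *.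
  exists (ev 0 c); last by rewrite subrr; apply: latN_0.
  by rewrite ev_nil; apply/quad_span_Z/quad_span_1.
set d := d'.+1 in IHd cN JD JZ J0 Jext JN Jgl *.
(* The component g of c orthogonal to J; the goal is that it vanishes. *)
have [g [Jcg orth supp]] := wdot_orth_decomp c Jext J0 JD JZ.
suff g0 : forall v, size v = d -> g v = 0.
  by apply: Jext Jcg => w /g0->; rewrite subr0.
have gE a b : wder (gl C a b) g =
    fun w => wder (gl C a b) c w + -1 * wder (gl C a b) (fun v => c v - g v) w.
  apply/funext => w; rewrite -wderZ -wderD; congr wder; apply/funext => v.
  by rewrite mulN1r opprB addrC subrK.
have Jg a b : J d (wder (gl C a b) g).
  by rewrite gE; apply: JD; [apply/JN/cN | apply/JZ/Jgl].
have glg a b : wder (gl C a b) g = fun=> 0.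
  apply/funext => w; have [wd|wd] := eqVneq (size w) d; last first.
    rewrite (@eq_wder _ _ (size w) _ g (fun=> 0)) ?wder0 // => v vw.
    by apply: supp; rewrite vw.
  apply: wdot_eq0 wd.
  rewrite (@wdot_adjoint _ _ d _ (gl C b a)); first exact/orth/Jgl/Jg.
  by move=> x y; rewrite rmorphD /= glX_conj glY_conj.
(* The mixed part of the Casimir element. *)
pose XY w := \sum_a \sum_b wder (glX C a b) (wder (glY C b a) g) w.
have JXY : J d XY.
  (* With a single letter, t and d cannot both occur. *)
  case: d' => [|e] in d IHd cN JD JZ J0 Jext JN Jgl orth supp Jcg gE Jg glg *.
    apply: Jext J0 => -[|x []] // _; rewrite /XY /=.
    rewrite !big1 // => a _; rewrite big1 // => b _; rewrite addr0 big1 // => y _.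
    rewrite addr0 mulr_sumr big1 // => z _.
    by case: x y z => [x|x] [y|y] z; rewrite /= ?mul0r ?mulr0.
  have kN i j : J e (contract i j g).
    (* Contractions of g are killed by gl_n, and have degree d - 2. *)
    apply: IHd => // a b; rewrite contract_wder glg.
    rewrite (_ : contract i j _ = fun=> 0) ?ev0; first exact: latN_0.
    apply/funext => w; rewrite /contract big1 // => r _.
    by rewrite (_ : ins _ (fun=> 0) = fun=> 0) ?ins0 //; apply/funext => v; apply: ins0.
  have [y yP] : exists y : 'I_k -> 'I_l -> A, forall i j,
      quad_span e (y i j) /\ latN e (ev e (contract i j g) - y i j).
    have /choice[y yP] : forall p : 'I_k * 'I_l, exists y,
        quad_span e y /\ latN e (ev e (contract p.1 p.2 g) - y).
      by move=> [i j]; have [y ? ?] := kN i j; exists y.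
    by exists (fun i j => y (i, j)) => i j; apply: (yP (i, j)).
  exists (- \sum_i \sum_j quad i j * y i j).
    rewrite -scaleN1r; apply: quad_span_Z.
    apply: quad_span_sum => i; apply: quad_span_sum => j.
    by apply: quad_span_M; case: (yP i j).
  apply: (latN_trans (y := - \sum_i \sum_j quad i j * ev e (contract i j g))).
    by rewrite opprK; apply: ev_mixed_casimir.
  rewrite opprK addrC -sumrB; apply: latN_sum => i; rewrite -sumrB; apply: latN_sum => j.
  rewrite -mulrBr; apply: (latN_Ml gen_filt (d := 2) (e := e)); first exact: lat_quad.
  by rewrite -opprB; apply: latN_N; case: (yP i j).
pose P w := \sum_a \sum_b (wder (glX C a b) (wder (glX C b a) g) w
                 + wder (glY C a b) (wder (glY C b a) g) w).
have JP : J d P.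
  apply: Jext (JZ (- 2%:R) _ JXY) => w _.
  by rewrite /P (gl_casimir glg) mulNr.
(* P g lies in J, hence is orthogonal to g. *)
have Pg0 : \sum_a \sum_b (wdot d (wder (glX C b a) g) (wder (glX C b a) g)
                        + wdot d (wder (glY C b a) g) (wder (glY C b a) g)) = 0.
  transitivity (wdot d P g); last by rewrite -wdot_conj orth ?rmorph0.
  rewrite (wdot_sum d (fun a w => \sum_b _)); apply: eq_bigr => a _.
  rewrite (wdot_sum d (fun b w => _)); apply: eq_bigr => b _.
  by rewrite wdotD (wdot_adjoint d _ _ (@glX_conj C k l n a b)) (wdot_adjoint d _ _ (@glY_conj C k l n a b)).
have XYg0 a b w : size w = d -> wder (glX C b a) g w = 0 /\ wder (glY C b a) g w = 0.
  move=> wd.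
  have /(_ a isT) Pa : forall a, true -> \sum_b (wdot d (wder (glX C b a) g) (wder (glX C b a) g)
                        + wdot d (wder (glY C b a) g) (wder (glY C b a) g)) = 0.
    move=> a'; apply: psumr_eq0P Pg0 a' => a' _; apply: sumr_ge0 => b' _.
    by rewrite addr_ge0 // wdot_ge0.
  have /(_ b isT)/eqP : forall b, true -> wdot d (wder (glX C b a) g) (wder (glX C b a) g)
                        + wdot d (wder (glY C b a) g) (wder (glY C b a) g) = 0.
    by move=> b'; apply: psumr_eq0P Pa b' => b' _; rewrite addr_ge0 // wdot_ge0.
  rewrite paddr_eq0 ?wdot_ge0 // => /andP[/eqP X0 /eqP Y0].
  by split; apply: wdot_eq0 wd.
(* All X_aa and Y_aa kill g, so multiplication by the degree does too. *)
move=> w wd; have := gl_size g w; rewrite wd big1 => [/esym/eqP|a _]; last first.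
  by have [-> ->] := XYg0 a a w wd; rewrite subrr.
by rewrite mulf_eq0 pnatr_eq0 => /eqP.
Qed.
End Contraction.

(** * From q = 1 to generic q *)

Lemma local1_exp (R : realType) e : local1 ((q - 1) ^+ e : Cq R).
Proof.
elim: e => [|e IHe]; first by rewrite expr0; apply: local1_1.
by rewrite exprS; apply: local1_M => //; apply: local1_q1.
Qed.

Section Specialization.
Variables (R : realType) (A : algType (Cq R)) (F : filtration A).
Local Notation K := (Cq R).

(** In the finite-dimensional space of tensors, the elements with value in
[S] are the kernel of a matrix.  Once its denominators at q = 1 are cleared by
a power (q - 1)^N, it maps the coefficients of [x] into (q - 1)^e O for every
e, hence to 0. *)
Lemma lattice_krull (L : finType) (gen : L -> A) (S : A -> Prop) d x :
  S 0 -> (forall y z, S y -> S z -> S (y + z)) -> (forall c y, S y -> S (c *: y)) ->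
  (forall y, filt_pred F d y -> S y) -> lat F gen d x ->
  (forall e, exists2 z, lat F gen d z & S (x - (q - 1) ^+ e *: z)) -> S x.
Proof.
move=> S0 SD SZ Slow /lat_evK[f f1 xf] Sx.
have SB y z : S y -> S z -> S (y - z).
  by move=> Sy Sz; apply: SD => //; rewrite -scaleN1r; apply: SZ.
suff Sf : S (evK gen d f) by rewrite -[x](subrK (evK gen d f)); apply: SD => //; apply: Slow.
pose comb (v : 'rV[K]_#|{: d.-tuple L}|) : A :=
  \sum_i v 0 i *: \prod_(y <- (enum_val i : d.-tuple L)) gen y.
have combD u v : comb (u + v) = comb u + comb v.
  by rewrite /comb -big_split; apply: eq_bigr => i _; rewrite mxE scalerDl.
have combZ c v : comb (c *: v) = c *: comb v.
  by rewrite /comb scaler_sumr; apply: eq_bigr => i _; rewrite mxE scalerA.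
pose vec (g : seq L -> K) : 'rV[K]_#|{: d.-tuple L}| := \row_i g (enum_val i : d.-tuple L).
have combE g : comb (vec g) = evK gen d g.
  rewrite /evK wsum_tuple (reindex (@enum_val _ {: d.-tuple L})) /=; last exact/onW_bij/enum_val_bij.
  by apply: eq_bigr => i _; rewrite mxE.
have [|u v Su Sv|c u Su|B SB'] := @subspace_mx K _ (fun v => S (comb v)).
- by have := combZ 0 0; rewrite !scale0r => ->.
- by rewrite combD; apply: SD.
- by rewrite combZ; apply: SZ.
suff fQ : vec f *m cokermx B = 0.
  by rewrite -combE; apply/SB'; rewrite submxE fQ.
apply/rowP => j; rewrite [RHS]mxE.
(* A common denominator for the column j of the matrix. *)
have [N QN] : exists N, forall i, local1 ((q - 1) ^+ N * cokermx B i j).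
  have /choice[N NP] : forall i, exists N, local1 ((q - 1) ^+ N * cokermx B i j).
    by move=> i; apply: local1_scale.
  exists (\sum_i N i)%N => i; rewrite (bigD1 i) //= addnC exprD -mulrA.
  by apply: local1_M => //; apply: local1_exp.
apply: (mulfI (expf_neq0 N (q1_neq0 R))); rewrite mulr0.
apply: local1_inter => e; have [z /lat_evK[h h1 zh] xz] := Sx e.
exists (\sum_i vec h 0 i * ((q - 1) ^+ N * cokermx B i j)).
  by apply: local1_sum => i; apply: local1_M => //; rewrite mxE.
have : (vec f - (q - 1) ^+ e *: vec h) *m cokermx B = 0.
  apply/eqP; rewrite -submxE; apply/SB'.
  rewrite combD -scaleN1r !combZ scaleN1r !combE.
  have -> : evK gen d f - (q - 1) ^+ e *: evK gen d h =
      (x - (q - 1) ^+ e *: z) - (x - evK gen d f) + (q - 1) ^+ e *: (z - evK gen d h).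
    by rewrite scalerBr opprB [_ + (_ - x)]addrC subrKA subrKA.
  by apply: SD; [apply: SB => //; apply: Slow | apply/SZ/Slow].
rewrite mulmxBl -scalemxAl => /eqP; rewrite subr_eq0 => /eqP ->.
rewrite mxE [X in _ * (_ * X)]mxE mulrCA; congr (_ * _); rewrite mulr_sumr.
by apply: eq_bigr => i _; rewrite mulrCA.
Qed.

Variables (k l n : nat).
Local Notation L := (letter k l n).
Variable (gen : L -> A).
Local Notation latN := (latN F gen).
Local Notation lat := (lat F gen).
Local Notation ev := (ev gen).
Hypothesis gen_filt : forall x, F 1 (gen x).
Hypothesis gen_comm : forall x y, latN 2 (gen x * gen y - gen y * gen x).

Variable inv : nat -> A -> Prop.
Hypothesis invB : forall d x y, inv d x -> inv d y -> inv d (x - y).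
Hypothesis invZ : forall d c x, inv d x -> inv d (c *: x).
Hypothesis inv_low : forall d x, filt_pred F d x -> inv d x.
Hypothesis inv_span : forall d x, quad_span gen d x -> inv d x.
Hypothesis wder_inv : forall d y f (a b : 'I_n), inv d y -> latN d (ev d f - y) ->
  latN d (ev d (wder (gl R[i] a b) f)).

(** Up to lower degree, the quotient of [x - y] by q - 1 is again invariant
because [y] is. *)
Lemma inv_step d x : lat d x -> inv d x -> exists y z,
  [/\ quad_span gen d y, lat d z, inv d z & filt_pred F d (x - y - (q - 1) *: z)].
Proof.
move=> lx ix; have [f xf] := lat_res lx.
have fx : latN d (ev d f - x) by rewrite -opprB; apply: latN_N.
have [y sy fy] : exists2 y, quad_span gen d y & latN d (ev d f - y).
  apply: (gl_invariant_span gen_filt gen_comm inv_span wder_inv) => a b.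
  exact: wder_inv ix fx.
have [z [w [lz lw xyE]]] : latN d (x - y) by apply: latN_trans xf fy.
exists y, z; split=> //; last by rewrite xyE addrC addKr.
have -> : z = (q - 1)^-1 *: (x - y - w).
  by rewrite xyE addrK scalerA mulVf ?scale1r // q1_neq0.
by apply/invZ/invB; [apply: invB => //; apply: inv_span | apply: inv_low].
Qed.

Lemma inv_quad_span d x : lat d x -> inv d x ->
  exists2 y, quad_span gen d y & filt_pred F d (x - y).
Proof.
move=> lx ix; apply: (lattice_krull (gen := gen) (d := d)
  (S := fun x => exists2 y, quad_span gen d y & filt_pred F d (x - y))) => //.
- by exists 0; [exact: quad_span_0 | rewrite subr0; exact: filt_pred_0].
- move=> y z [u su yu] [v sv zv]; exists (u + v); first exact: quad_span_D.
  by rewrite opprD addrACA; apply: filt_predD.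
- move=> c y [u su yu]; exists (c *: u); first exact: quad_span_Z.
  by rewrite -scalerBr; apply: lowZ.
- by move=> y ly; exists 0; [exact: quad_span_0 | rewrite subr0].
move=> e; suff [z [lz _ Sz]] : exists z, [/\ lat d z, inv d z &
  exists2 y, quad_span gen d y & filt_pred F d (x - (q - 1) ^+ e *: z - y)] by exists z.
elim: e => [|e [z [lz iz [y sy xzy]]]].
  exists x; split=> //; exists 0; first exact: quad_span_0.
  by rewrite expr0 scale1r subrr subr0; apply: filt_pred_0.
have [u [v [su lv iv zuv]]] := inv_step lz iz; exists v; split=> //.
exists (y + (q - 1) ^+ e *: u); first by apply: quad_span_D => //; apply: quad_span_Z.
have -> : x - (q - 1) ^+ e.+1 *: v - (y + (q - 1) ^+ e *: u) =
   (x - (q - 1) ^+ e *: z - y) + (q - 1) ^+ e *: (z - u - (q - 1) *: v).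
  rewrite 2!scalerBr scalerA -exprSr; move: (_ *: z) (_ *: v) (_ *: u) => z' v' u'.
  by rewrite opprD addrACA [_ - z' - y]addrAC -[z' - _ - _]addrA subrKA [- v' - u']addrC.
by apply: filt_predD => //; apply: lowZ.
Qed.

End Specialization.

(** * The generators commute at q = 1 *)

Section Close.
Variable R : realType.

(** Rational functions of q vanishing at q = 1. *)
Definition vanish1 (c : Cq R) : Prop := exists2 c', local1 c' & c = (q - 1) * c'.

Lemma vanish1_0 : vanish1 0.
Proof. by exists 0; [exact: local1_0 | rewrite mulr0]. Qed.

Lemma vanish1_D a b : vanish1 a -> vanish1 b -> vanish1 (a + b).
Proof.
move=> [a' la ->] [b' lb ->]; exists (a' + b'); first exact: local1_D.
by rewrite mulrDr.
Qed.

Lemma vanish1_Ml a b : local1 a -> vanish1 b -> vanish1 (a * b).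
Proof.
move=> la [b' lb ->]; exists (a * b'); first exact: local1_M.
by rewrite mulrCA.
Qed.

Lemma vanish1_q : vanish1 (q - 1).
Proof. by exists 1; [exact: local1_1 | rewrite mulr1]. Qed.

Lemma vanish1_qV : vanish1 (q^-1 - 1).
Proof.
exists (- q^-1); first exact/local1_N/local1_qV.
by rewrite mulrN mulrBl mulfV ?q_neq0 // mul1r opprB.
Qed.

Lemma vanish1_qqV : vanish1 (q - q^-1).
Proof.
have -> : q - q^-1 = (q - 1) + -1 * (q^-1 - 1) :> Cq R by rewrite mulN1r opprB subrKA.
apply: vanish1_D vanish1_q _; apply: vanish1_Ml vanish1_qV.
exact/local1_N/local1_1.
Qed.

Lemma vanish1_local c : vanish1 c -> local1 c.
Proof. by move=> [c' l1 ->]; apply: local1_M => //; apply: local1_q1. Qed.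

Lemma vanish1_MB u v : vanish1 (u - 1) -> vanish1 (v - 1) -> vanish1 (u * v - 1).
Proof.
move=> vu vv; have lu : local1 u.
  by rewrite -[u](subrK 1); apply: local1_D (local1_1 R); apply: vanish1_local.
have -> : u * v - 1 = u * (v - 1) + (u - 1) by rewrite mulrBr mulr1 addrA subrK.
exact: vanish1_D (vanish1_Ml lu vv) vu.
Qed.

(** The coefficients on the right-hand side of the relation exchanging
d_ce and t_ce: at q = 1 only the term t_ce d_ce survives. *)
Lemma vanish1_R6 (b c : bool) :
  vanish1 (q ^+ (b + c) * (q - q^-1) ^+ (2 - b - c) - (b && c)%:R).
Proof.
have qq := vanish1_qqV; have lq : local1 (q : Cq R) := local1_q R.
case: b c => [] [].
- have -> : q ^+ (true + true) * (q - q^-1) ^+ (2 - true - true) - (true && true)%:R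
    = (q + 1) * (q - 1) :> Cq R.
    by rewrite expr0 mulr1 [LHS]subr_sqr_1 mulrC.
  by apply: vanish1_Ml vanish1_q; apply: local1_D => //; apply: local1_1.
- by rewrite subr0; apply: vanish1_Ml lq qq.
- by rewrite subr0; apply: vanish1_Ml lq qq.
- by rewrite subr0 expr0 mul1r expr2; apply: vanish1_Ml (vanish1_local qq) qq.
Qed.

Lemma latN_vanish (A : algType (Cq R)) F (L : finType) (gen : L -> A) d c x :
  vanish1 c -> lat F gen d x -> latN F gen d (c *: x).
Proof. by move=> [c' l1 ->] lx; apply: latN_q1. Qed.

Lemma latN_scale (A : algType (Cq R)) F (L : finType) (gen : L -> A) d c c' x :
  lat F gen d x -> vanish1 (c - c') -> latN F gen d (c *: x - c' *: x).
Proof. by move=> lx cc; rewrite -scalerBl; apply: latN_vanish. Qed.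

Lemma vanish1_delta (b : bool) c : vanish1 (c - 1) -> vanish1 (- (b%:R * c) - - b%:R).
Proof.
move=> vc; have -> : - (b%:R * c) - - b%:R = - b%:R * (c - 1) by rewrite mulrBr mulr1 mulNr.
apply: vanish1_Ml vc; apply: local1_N.
by case: b; [exact: local1_1 | exact: local1_0].
Qed.

Lemma vanish1_qdiff_t1 : vanish1 ((q - 1)^-1 * (q ^- true - 1) - - true%:R).
Proof.
have E (K : fieldType) (x : K) : x != 0 -> x - 1 != 0 ->
    (x - 1)^-1 * (x^-1 - 1) - - 1 = - (x^-1 - 1).
  by move=> x0 x1; field; rewrite x0 x1.
have -> : (q - 1)^-1 * (q ^- true - 1) - - true%:R = - (q^-1 - 1) :> Cq R.
  exact: E (q_neq0 R) (q1_neq0 R).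
by rewrite -[- _]mulN1r; apply: (vanish1_Ml (local1_N (local1_1 R)) vanish1_qV).
Qed.

Lemma vanish1_qdiff_t0 : vanish1 ((q - 1)^-1 * (q ^- false - 1) - - false%:R).
Proof.
have E (K : fieldType) (x : K) : (x - 1)^-1 * (1^-1 - 1) - - 0 = 0.
  by rewrite invr1 subrr mulr0 oppr0 subrr.
have -> : (q - 1)^-1 * (q ^- false - 1) - - false%:R = 0 :> Cq R by exact: E.
exact: vanish1_0.
Qed.

Lemma vanish1_qdiff_d1 : vanish1 ((q - 1)^-1 * (q ^+ true - 1) - true%:R).
Proof.
have -> : (q - 1)^-1 * (q ^+ true - 1) - true%:R = 0 :> Cq R.
  by rewrite expr1 mulVf ?q1_neq0 // subrr.
exact: vanish1_0.
Qed.

Lemma vanish1_qdiff_d0 : vanish1 ((q - 1)^-1 * (q ^+ false - 1) - false%:R).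
Proof.
have -> : (q - 1)^-1 * (q ^+ false - 1) - false%:R = 0 :> Cq R.
  by rewrite expr0 subrr mulr0 subrr.
exact: vanish1_0.
Qed.

Lemma latN_scale0 (A : algType (Cq R)) F (L : finType) (gen : L -> A) d c c' x v :
  lat F gen d x -> c' = 0 -> vanish1 (c - c') -> latN F gen d (c *: x - c' *: v).
Proof. by move=> lx -> cc; rewrite scale0r -(scale0r x); apply: latN_scale. Qed.

Lemma latN_scale1 (A : algType (Cq R)) F (L : finType) (gen : L -> A) d c x :
  lat F gen d x -> vanish1 (c - 1) -> latN F gen d (c *: x - x).
Proof. by move=> lx cc; rewrite -[X in _ - X]scale1r; apply: latN_scale. Qed.

End Close.

Lemma sum_corner (K : nzRingType) (V : lmodType K) m n (c : 'I_m) (s : 'I_n)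
    (G : 'I_m -> 'I_n -> V) :
  \sum_(c' < m | (c <= c')%N) \sum_(e' < n | (s <= e')%N)
      ((c == c') && (s == e'))%:R *: G c' e' = G c s.
Proof.
rewrite (bigD1 c) //= (bigD1 s) //= !eqxx scale1r.
rewrite big1 => [|e /andP[_ es]]; last by rewrite eq_sym (negPf es) scale0r.
rewrite addr0 big1 ?addr0 // => c' /andP[_ cc]; apply: big1 => e _.
by rewrite eq_sym (negPf cc) scale0r.
Qed.

Section Generators.
Variables (R : realType) (k l n : nat).
Local Notation m := (maxn k l).
Local Notation A := (PD R m n).
Local Notation L := (letter k l n).
Local Notation F := (@Akl_filtration R k l n).

(** Rows are counted from the last one, as in the definition of the
subalgebra, but columns are left as they are: the elements L_ij sum over all
columns. *)
Definition t_row (i : 'I_k) : 'I_m := rev_ord (widen_ord (leq_maxl k l) i).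
Definition d_row (i : 'I_l) : 'I_m := rev_ord (widen_ord (leq_maxr k l) i).

Definition Akl_letter (x : L) : A :=
  match x with inl p => PD_t R (t_row p.1) p.2 | inr p => PD_d R (d_row p.1) p.2 end.

Local Notation gen := Akl_letter.
Local Notation lat := (lat F gen).
Local Notation latN := (latN F gen).

Lemma Akl_letter_filt x : F 1 (gen x).
Proof. by case: x => [[i r]|[i r]]; [apply: Akl_filt_t | apply: Akl_filt_d]. Qed.

Lemma Akl_letterP x : Akl_gen x -> exists y, x = gen y.
Proof.
by case=> i j; [exists (inl (i, rev_ord j)) | exists (inr (i, rev_ord j))].
Qed.

Lemma lat_letters x y : lat 2 (gen x * gen y).
Proof. by apply: (lat_M Akl_letter_filt (d := 1) (e := 1)); apply: lat_gen. Qed.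

Lemma comm_q x y : gen x * gen y = q *: (gen y * gen x) ->
  latN 2 (gen x * gen y - gen y * gen x).
Proof.
move=> ->; rewrite -[X in _ - X]scale1r -scalerBl; apply: latN_vanish; first exact: vanish1_q.
exact: lat_letters.
Qed.

Lemma comm_qqV x y u : lat 2 u ->
  gen x * gen y - gen y * gen x - (q - q^-1) *: u = 0 ->
  latN 2 (gen x * gen y - gen y * gen x).
Proof.
move=> lu /eqP; rewrite subr_eq0 => /eqP ->; apply: latN_vanish lu.
exact: vanish1_qqV.
Qed.

Lemma comm_eq x y : gen x * gen y - gen y * gen x = 0 ->
  latN 2 (gen x * gen y - gen y * gen x).
Proof. by move=> ->; apply: latN_0. Qed.

Lemma comm_sym x y : latN 2 (gen x * gen y - gen y * gen x) ->
  latN 2 (gen y * gen x - gen x * gen y).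
Proof. by move=> xy; rewrite -opprB; apply: latN_N. Qed.

Lemma t_row_inj : injective t_row.
Proof. by move=> i j /rev_ord_inj/(congr1 val)/= ij; apply/val_inj. Qed.

Lemma d_row_inj : injective d_row.
Proof. by move=> i j /rev_ord_inj/(congr1 val)/= ij; apply/val_inj. Qed.

Lemma tt_comm i r i' s : latN 2 (gen (inl (i, r)) * gen (inl (i', s))
   - gen (inl (i', s)) * gen (inl (i, r))).
Proof.
wlog le_rows : i r i' s / (t_row i <= t_row i')%N.
  by move=> IH; case: (leqP (t_row i) (t_row i')) => [/IH //|/ltnW /IH tt]; apply: comm_sym.
case: (ltngtP (t_row i) (t_row i')) le_rows => // [lt _|/val_inj/t_row_inj <- _].
  case: (ltngtP r s) => [rs|rs|/val_inj <-].
  - apply: (@comm_qqV _ _ (gen (inl (i, s)) * gen (inl (i', r)))); first exact: lat_letters.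
    exact: PD_relP (PD_R2 _ _ lt rs).
  - by apply: comm_eq; apply: PD_relP (PD_R2comm _ _ lt rs).
  - by apply/comm_q/eqP; rewrite -subr_eq0; apply/eqP; apply: PD_relP (PD_R1col _ _ r lt).
case: (ltngtP r s) => [rs|rs|/val_inj <-]; last by rewrite subrr; apply: latN_0.
- by apply/comm_q/eqP; rewrite -subr_eq0; apply/eqP; apply: PD_relP (PD_R1row _ _ (t_row i) rs).
- apply/comm_sym/comm_q/eqP; rewrite -subr_eq0; apply/eqP.
  by apply: PD_relP (PD_R1row _ _ (t_row i) rs).
Qed.

Lemma dd_comm i r i' s : latN 2 (gen (inr (i, r)) * gen (inr (i', s))
   - gen (inr (i', s)) * gen (inr (i, r))).
Proof.
wlog le_rows : i r i' s / (d_row i' <= d_row i)%N.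
  by move=> IH; case: (leqP (d_row i') (d_row i)) => [/IH //|/ltnW /IH tt]; apply: comm_sym.
case: (ltngtP (d_row i') (d_row i)) le_rows => // [lt _|/val_inj/d_row_inj -> _].
  case: (ltngtP s r) => [rs|rs|/val_inj ->].
  - apply: (@comm_qqV _ _ (gen (inr (i, s)) * gen (inr (i', r)))); first exact: lat_letters.
    exact: PD_relP (PD_R2' _ _ lt rs).
  - by apply: comm_eq; apply: PD_relP (PD_R2'comm _ _ lt rs).
  - by apply/comm_q/eqP; rewrite -subr_eq0; apply/eqP; apply: PD_relP (PD_R1'col _ _ r lt).
case: (ltngtP s r) => [rs|rs|/val_inj ->]; last by rewrite subrr; apply: latN_0.
- by apply/comm_q/eqP; rewrite -subr_eq0; apply/eqP; apply: PD_relP (PD_R1'row _ _ (d_row i) rs).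
- apply/comm_sym/comm_q/eqP; rewrite -subr_eq0; apply/eqP.
  by apply: PD_relP (PD_R1'row _ _ (d_row i) rs).
Qed.

(** The relations involve rows further down, which the subalgebra contains
because it is built from the last rows. *)
Lemma t_row_gt i (c : 'I_m) : (t_row i <= c)%N -> exists i', c = t_row i'.
Proof.
move=> ic; have cm := ltn_ord c; have ik := ltn_ord i.
have lt : (m - c.+1 < k)%N by move: ic; rewrite /=; lia.
by exists (Ordinal lt); apply/val_inj => /=; lia.
Qed.

Lemma d_row_gt i (c : 'I_m) : (d_row i <= c)%N -> exists i', c = d_row i'.
Proof.
move=> ic; have cm := ltn_ord c; have ik := ltn_ord i.
have lt : (m - c.+1 < l)%N by move: ic; rewrite /=; lia.
by exists (Ordinal lt); apply/val_inj => /=; lia.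
Qed.

Lemma lat_td i j (c c' : 'I_m) r s : (t_row i <= c)%N -> (d_row j <= c')%N ->
  lat 2 (PD_t R c r * PD_d R c' s).
Proof.
move=> /t_row_gt[i' ->] /d_row_gt[j' ->].
exact: (lat_letters (inl (i', r)) (inr (j', s))).
Qed.

Lemma lat_cond_sum d (I : finType) (P : pred I) (f : I -> A) :
  (forall i, P i -> lat d (f i)) -> lat d (\sum_(i | P i) f i).
Proof.
move=> fl; rewrite big_mkcond; apply: lat_sum => i.
by case: ifP => [/fl //|_]; apply: lat_0.
Qed.

Lemma latN_cond_sum d (I : finType) (P : pred I) (f : I -> A) :
  (forall i, P i -> latN d (f i)) -> latN d (\sum_(i | P i) f i).
Proof.
move=> fl; rewrite big_mkcond; apply: latN_sum => i.
by case: ifP => [/fl //|_]; apply: latN_0.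
Qed.

(** The constant 1 in the last relation has degree 0, below the degree 2 of
the products. *)
Lemma dt_comm i r j s : latN 2 (gen (inr (j, s)) * gen (inl (i, r))
   - gen (inl (i, r)) * gen (inr (j, s))).
Proof.
have qcase (x y u : A) : lat 2 y -> lat 2 u ->
    x - q *: y - (q - q^-1) *: u = 0 -> latN 2 (x - y).
  move=> ly lu /eqP; rewrite subr_eq0 => /eqP xy.
  have -> : x - y = (q - 1) *: y + (q - q^-1) *: u.
    by rewrite -xy scalerBl scale1r [RHS]addrC subrKA.
  by apply: latN_D; apply: latN_vanish => //; [exact: vanish1_q | exact: vanish1_qqV].
have [cr|cr] := eqVneq (d_row j) (t_row i); have [<-|sr] := eqVneq s r.
- rewrite /= -cr; set c := d_row j.
  (* The product t d is written as a double sum over the same range as in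
     the relation, to compare the coefficients. *)
  have tdE : PD_t R c s * PD_d R c s = \sum_(c' < m | (c <= c')%N) \sum_(e' < n | (s <= e')%N)
      ((c == c') && (s == e'))%:R *: (PD_t R c' e' * PD_d R c' e').
    by rewrite (sum_corner c s (fun c' e' => PD_t R c' e' * PD_d R c' e')).
  have /eqP := PD_relP (PD_R6 q (pgen (PD_presentation R m n)) c s).
  rewrite subr_eq0 subr_eq addrC => /eqP dt.
  rewrite [X in latN 2 (X - _)](dt : PD_d R c s * PD_t R c s = _) [X in _ - X]tdE -addrA -sumrB.
  apply: latN_D.
    by apply: latN_low; apply: filt_S; apply: filt_1.
  apply: latN_cond_sum => c' cc; rewrite -sumrB; apply: latN_cond_sum => e se.
  rewrite -scalerBl; apply: latN_vanish; last by apply: (@lat_td i j) => //; rewrite -cr.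
  exact: vanish1_R6.
- apply: (qcase _ _ (\sum_(c' < m | (d_row j < c')%N) PD_t R c' r * PD_d R c' s)).
  + exact: lat_letters.
  + apply: lat_cond_sum => c' lt; apply: (@lat_td i j); last exact: ltnW.
    by rewrite -cr ltnW.
  + rewrite /= -cr; exact: PD_relP (PD_R4 _ _ (d_row j) sr).
- apply: (qcase _ _ (\sum_(e < n | (s < e)%N) PD_t R (t_row i) e * PD_d R (d_row j) e)).
  + exact: lat_letters.
  + by apply: lat_cond_sum => e _; apply: (@lat_td i j).
  + exact: PD_relP (PD_R5 _ _ s cr).
- by apply: comm_eq; apply: PD_relP (PD_R3 _ _ sr cr).
Qed.

Lemma Akl_letter_comm x y : latN 2 (gen x * gen y - gen y * gen x).
Proof.
case: x y => [[i r]|[i r]] [[j s]|[j s]]; first exact: tt_comm.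
- exact/comm_sym/dt_comm.
- exact: dt_comm.
- exact: dd_comm.
Qed.

End Generators.

(** * The action of the quantum group at q = 1 *)

(** The Chevalley generators and the diagonal generate gl_n. *)
Lemma gl_lo_hi_ind (n : nat) (G : 'I_n -> 'I_n -> Prop) :
  (forall a, G a a) -> (forall i : 'I_n.-1, G (lo i) (hi i)) ->
  (forall i : 'I_n.-1, G (hi i) (lo i)) ->
  (forall a b c, a != c -> G a b -> G b c -> G a c) -> forall a b, G a b.
Proof.
move=> Gd Gu Gl Gt.
have up N (a b : 'I_n) : (a + N.+1 = b)%N -> G a b /\ G b a.
  elim: N b => [|N IHN] b ab.
    have ai : (a < n.-1)%N by have := ltn_ord b; lia.
    have -> : a = lo (Ordinal ai) by apply/val_inj.
    have -> : b = hi (Ordinal ai) by apply/val_inj; rewrite /= -ab; lia.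
    by split.
  have b1 : (b.-1 < n.-1)%N by have := ltn_ord b; lia.
  have [Gab Gba] : G a (lo (Ordinal b1)) /\ G (lo (Ordinal b1)) a.
    by apply: IHN => /=; lia.
  have bE : b = hi (Ordinal b1) by apply/val_inj => /=; lia.
  rewrite bE; split.
    by apply: Gt Gab (Gu _); rewrite -bE; apply/eqP => /(congr1 val) /=; lia.
  by apply: Gt (Gl _) Gba; rewrite -bE; apply/eqP => /(congr1 val) /=; lia.
move=> a b; case: (ltngtP a b) => [ab|ba|/val_inj-> //].
  by have [] := up (b - a.+1)%N a b _; first lia.
by have [] := up (a - b.+1)%N b a _; first lia.
Qed.

Lemma subrACA (V : zmodType) (x y z t : V) : x - y - (z - t) = x - z - (y - t).
Proof. by rewrite opprD addrACA -opprD. Qed.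

Lemma glX_sym (C : comNzRingType) k l n a b (x y : letter k l n) : glX C a b x y = glX C b a y x.
Proof.
case: x y => [[i r]|p] [[i' s]|p'] //=.
by rewrite eq_sym [X in _ && X]andbC.
Qed.

Lemma glY_sym (C : comNzRingType) k l n a b (x y : letter k l n) : glY C a b x y = glY C b a y x.
Proof.
case: x y => [p|[i r]] [p'|[i' s]] //=.
by rewrite eq_sym [X in _ && X]andbC.
Qed.

Lemma sum_gl (R : realType) (V : lmodType (Cq R)) k l n (gen : letter k l n -> V) a b y :
  \sum_x cst (gl R[i] a b x y) *: gen x =
  match y with
  | inl p => - ((p.2 == a)%:R *: gen (inl (p.1, b)))
  | inr p => (p.2 == b)%:R *: gen (inr (p.1, a))
  end.
Proof.
have c0 (v : V) : cst (0 : R[i]) *: v = 0 by rewrite rmorph0 scale0r.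
transitivity (\sum_x cst (glX R[i] b a y x) *: gen x + \sum_x cst (glY R[i] b a y x) *: gen x).
  rewrite -big_split; apply: eq_bigr => x _.
  by rewrite /gl glX_sym glY_sym rmorphD scalerDl.
rewrite (sum_glX (F := fun u x => cst u *: gen x)) //.
rewrite (sum_glY (F := fun u x => cst u *: gen x)) //.
case: y => [[i r]|[i r]]; rewrite ?addr0 ?add0r /=.
  case: (r == a); last by rewrite scale0r oppr0.
  by rewrite rmorphN rmorph1 scaleN1r scale1r.
case: (r == b); last by rewrite scale0r.
by rewrite rmorph1.
Qed.

Section QDifference.
Variables (R : realType) (A : algType (Cq R)) (P : A -> A).

(** For P = K_a this is the element (K_a - 1)/(q - 1), which specializes to
the diagonal matrix unit E_aa. *)
Definition qdiff x : A := (q - 1)^-1 *: (P x - x).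

Lemma qdiffD : {morph P : x y / x + y} -> {morph qdiff : x y / x + y}.
Proof. by move=> PD x y; rewrite /qdiff -scalerDr PD opprD addrACA. Qed.

Lemma qdiffZ : (forall c, {morph P : x / c *: x}) -> forall c, {morph qdiff : x / c *: x}.
Proof. by move=> PZ c x; rewrite /qdiff PZ -scalerBr !scalerA mulrC. Qed.

Lemma qdiffM : {morph P : x y / x * y} -> forall x y, qdiff (x * y) = qdiff x * P y + x * qdiff y.
Proof.
move=> PM x y; rewrite /qdiff PM -scalerAl -scalerAr -scalerDr; congr (_ *: _).
by rewrite mulrBl mulrBr addrA subrK.
Qed.

Lemma qdiff1 : P 1 = 1 -> qdiff 1 = 0.
Proof. by rewrite /qdiff => ->; rewrite subrr scaler0. Qed.

Lemma qdiff_eigen c x : P x = c *: x -> qdiff x = ((q - 1)^-1 * (c - 1)) *: x.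
Proof. by rewrite /qdiff => ->; rewrite -{2}[x]scale1r -scalerBl scalerA. Qed.

End QDifference.

Lemma Uq_counit_gen (R : realType) n g :
  Uq_counit (pgen (Uq_presentation R n) g) = Uq_chi (Cq R) g.
Proof. exact: pchar_gen. Qed.

Section ActionOnWords.
Variables (R : realType) (k l n : nat).
Local Notation m := (maxn k l).
Local Notation A := (PD R m n).
Local Notation L := (letter k l n).
Local Notation F := (@Akl_filtration R k l n).
Local Notation gen := (@Akl_letter R k l n).
Local Notation lat := (lat F gen).
Local Notation latN := (latN F gen).
Local Notation ev := (ev gen).
Local Notation C := R[i].
Variable act : PD_action R m n.

(** Invariance of the class of [x] in degree [d] of the graded algebra. *)
Definition gr_invariant d (x : A) : Prop :=
  forall h, filt_pred F d (act h x - Uq_counit h *: x).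

Lemma gr_invariant_B d x y : gr_invariant d x -> gr_invariant d y -> gr_invariant d (x - y).
Proof.
move=> ix iy h; have hxy := filt_predD (ix h) (filt_predN (iy h)).
by rewrite mact_B scalerBr subrACA.
Qed.

Lemma act_filt h d x : F d x -> F d (act h x).
Proof. exact: Akl_filtration_stable. Qed.

Lemma act_low h d x : filt_pred F d x -> filt_pred F d (act h x).
Proof. by case: d => [->|d]; [rewrite mact_0 | apply: act_filt]. Qed.

Lemma gr_invariant_Z d c x : gr_invariant d x -> gr_invariant d (c *: x).
Proof.
by move=> ix h; rewrite mact_Z scalerA mulrC -scalerA -scalerBr; apply/lowZ/ix.
Qed.

Lemma gr_invariant_low d x : filt_pred F d x -> gr_invariant d x.
Proof.
by move=> lx h; apply: filt_predD; [exact: act_low | exact/filt_predN/lowZ].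
Qed.

Lemma act_Keps_letter b (a : 'I_n) x : exists2 c, vanish1 (c - 1) &
  act (Uq_Keps R b a) (gen x) = c *: gen x.
Proof.
have vq (s : bool) : vanish1 (q ^+ s - 1 : Cq R).
  by case: s; [exact: vanish1_q | rewrite expr0 subrr; exact: vanish1_0].
have vqV (s : bool) : vanish1 (q ^- s - 1 : Cq R).
  by case: s; [exact: vanish1_qV | rewrite expr0 invr1 subrr; exact: vanish1_0].
case: x => [[i r]|[i r]] /=.
  have Kt := PD_act_Kt act a (t_row l i) r.
  have q0 : q ^- (a == r) != 0 :> Cq R by rewrite invr_eq0 expf_neq0 // q_neq0.
  exists (if b then (q ^- (a == r))^-1 else q ^- (a == r)); last exact: PD_act_Kinv.
  by case: b; rewrite ?invrK.
have Kd := PD_act_Kd act a (d_row k i) r.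
have q0 : q ^+ (a == r) != 0 :> Cq R by rewrite expf_neq0 // q_neq0.
exists (if b then (q ^+ (a == r))^-1 else q ^+ (a == r)); last exact: PD_act_Kinv.
by case: b.
Qed.

Lemma act_KM b a : {morph act (Uq_Keps R b a) : x y / x * y}.
Proof. by move=> x y; rewrite (mact_Delta act (Delta_K R b a)) big_seq1. Qed.

Lemma act_K1 b a : act (Uq_Keps R b a) 1 = 1.
Proof. by rewrite mact_eps Uq_counit_gen scale1r. Qed.

Lemma act_KK_letter b c (a a' : 'I_n) x :
  latN 1 (act (Uq_Keps R b a * Uq_Keps R c a') (gen x) - gen x).
Proof.
rewrite mact_M; have [u vu ->] := act_Keps_letter c a' x.
have [v vv Kv] := act_Keps_letter b a x.
rewrite mact_Z Kv scalerA -[X in _ - X]scale1r -scalerBl.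
apply: latN_vanish (lat_gen _ _ _).
exact: vanish1_MB.
Qed.

Lemma act_KKM b c (a a' : 'I_n) : {morph act (Uq_Keps R b a * Uq_Keps R c a') : x y / x * y}.
Proof. by move=> x y; rewrite !mact_M !act_KM. Qed.

Lemma act_KK1 b c (a a' : 'I_n) : act (Uq_Keps R b a * Uq_Keps R c a') 1 = 1.
Proof. by rewrite mact_M !act_K1. Qed.

(** E_i is a skew derivation with twists K_i and 1; its coefficients on
letters are 1 and - q^-1, which give E_(i,i+1) at q = 1. *)
Lemma wder_E_invariant i d y f : gr_invariant d y -> latN d (ev d f - y) ->
  latN d (ev d (wder (gl C (lo i) (hi i)) f)).
Proof.
move=> iy fy.
apply: (skew_invariant (@Akl_letter_filt R k l n) (T := act (Uq_E R i)) (P := act (Uq_K R i))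
   (Q := id) _ _ _ _ _ _ _ _ _ _ _ _ _ fy).
- exact: mact_D.
- by move=> c x; apply: mact_Z.
- exact: mact_D.
- by move=> c x; apply: mact_Z.
- exact: act_KK1.
- exact: act_KKM.
- exact: act_KK_letter.
- by move=> x; rewrite subrr; apply: latN_0.
- move=> x x'; rewrite (mact_Delta act (Delta_E R i)) big_cons big_seq1 /=.
  by rewrite mact_1.
- by rewrite mact_eps Uq_counit_gen scale0r.
- move=> x; rewrite sum_gl; case: x => [[j r]|[j r]] /=.
    rewrite PD_act_Et eq_sym -scaleNr.
    have lx := lat_gen F gen (inl (j, hi i) : L).
    exact: (latN_scale lx (vanish1_delta (r == lo i) (vanish1_qV R))).
  by rewrite PD_act_Ed eq_sym subrr; apply: latN_0.
- by move=> *; apply: act_filt.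
- by have := iy (Uq_E R i); rewrite Uq_counit_gen scale0r subr0.
Qed.

(** F_i is a skew derivation with twists 1 and K_i^-1, and gives E_(i+1,i)
at q = 1. *)
Lemma wder_F_invariant i d y f : gr_invariant d y -> latN d (ev d f - y) ->
  latN d (ev d (wder (gl C (hi i) (lo i)) f)).
Proof.
move=> iy fy.
apply: (skew_invariant (@Akl_letter_filt R k l n) (T := act (Uq_F R i)) (P := id)
   (Q := act (Uq_K' R i)) _ _ _ _ _ _ _ _ _ _ _ _ _ fy) => //.
- exact: mact_D.
- by move=> c x; apply: mact_Z.
- by move=> x; rewrite subrr; apply: latN_0.
- exact: act_KK_letter.
- move=> x x'; rewrite (mact_Delta act (Delta_F R i)) big_cons big_seq1 /=.
  by rewrite mact_1.
- by rewrite mact_eps Uq_counit_gen scale0r.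
- move=> x; rewrite sum_gl; case: x => [[j r]|[j r]] /=.
    rewrite PD_act_Ft eq_sym -scaleNr.
    have lx := lat_gen F gen (inl (j, lo i) : L).
    exact: (latN_scale lx (vanish1_delta (r == hi i) (vanish1_q R))).
  by rewrite PD_act_Fd eq_sym subrr; apply: latN_0.
- by move=> *; apply: act_filt.
- by have := iy (Uq_F R i); rewrite Uq_counit_gen scale0r subr0.
Qed.

(** Here [qdiff] turns invariance under K_a into weight 0 for E_aa. *)
Lemma wder_K_invariant a d y f : gr_invariant d y -> latN d (ev d f - y) ->
  latN d (ev d (wder (gl C a a) f)).
Proof.
move=> iy fy; pose P := act (Uq_Keps R false a).
have PD : {morph P : x y / x + y} by exact: mact_D.
have PZ c : {morph P : x / c *: x} by move=> x; exact: mact_Z.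
apply: (skew_invariant (@Akl_letter_filt R k l n) (T := qdiff P) (P := P)
   (Q := id) (qdiffD PD) (qdiffZ PZ) PD PZ (act_K1 false a) (act_KM false a) _ _
   (qdiffM (act_KM false a)) (qdiff1 (act_K1 false a)) _ _ _ fy).
- move=> x; have [c vc Px] := act_Keps_letter false a x.
  by rewrite [P _]Px; exact: latN_scale1 (lat_gen F gen x) vc.
- by move=> x; rewrite subrr; apply: latN_0.
- move=> x; rewrite sum_gl; case: x => [[j r]|[j r]].
    have lx := lat_gen F gen (inl (j, r) : L).
    rewrite (qdiff_eigen (PD_act_Kt act a (t_row l j) r)) -scaleNr eq_sym.
    case: eqP => [<-|_]; first exact: (latN_scale lx (vanish1_qdiff_t1 R)).
    exact: (latN_scale0 _ lx (oppr0 _) (vanish1_qdiff_t0 R)).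
  have lx := lat_gen F gen (inr (j, r) : L).
  rewrite (qdiff_eigen (PD_act_Kd act a (d_row k j) r)) eq_sym.
  case: eqP => [<-|_]; first exact: (latN_scale lx (vanish1_qdiff_d1 R)).
  exact: (latN_scale0 _ lx (erefl _) (vanish1_qdiff_d0 R)).
- by move=> e x Fx; apply/filt_Z/filt_D; [exact: act_filt | exact: filt_N].
- by have := iy (Uq_Keps R false a); rewrite Uq_counit_gen scale1r; apply: lowZ.
Qed.

(** For the other matrix units, the commutator is split into two terms: the
first derivation already gives a relation, a representative of the invariant
0, and the second one preserves relations. *)
Lemma wder_gr_invariant d y f a b : gr_invariant d y -> latN d (ev d f - y) ->
  latN d (ev d (wder (gl C a b) f)).
Proof.
move: a b d y f; apply: gl_lo_hi_ind.
- exact: wder_K_invariant.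
- exact: wder_E_invariant.
- exact: wder_F_invariant.
move=> a b c ac Gab Gbc d y f iy fy.
rewrite -(mcomm_gl _ _ _ b ac) (_ : wder (mcomm _ _) f = fun w =>
  wder (gl C a b) (wder (gl C b c) f) w + -1 * wder (gl C b c) (wder (gl C a b) f) w); last first.
  by apply/funext => w; rewrite mulN1r wder_comm.
(* Tensors that give relations represent the invariant 0. *)
have i0 : gr_invariant d 0 by apply: gr_invariant_low; apply: filt_pred_0.
rewrite evD evZ; apply: latN_D.
  by apply: Gab i0 _; rewrite subr0; apply: Gbc iy fy.
apply: latN_Z; first exact: local1_cst.
by apply: Gbc i0 _; rewrite subr0; apply: Gab iy fy.
Qed.
End ActionOnWords.

(** * Invariants of module algebras and graded classes *)

Section UqInvariants.
Variables (R : realType) (n : nat) (B : algType (Cq R)).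
Variable act : module_algebra (@Uq_coproduct R n) (@Uq_counit R n) B.

(** An element on which the generators act through the counit is invariant,
since both the action and the counit are multiplicative. *)
Lemma action_invariantP v :
  (forall i, act (Uq_E R i) v = 0) -> (forall i, act (Uq_F R i) v = 0) ->
  (forall a, act (Uq_Keps R false a) v = v) -> action_invariant act v.
Proof.
move=> Ev Fv Kv x.
elim: (presented_gen x) => {x} [x [g ->]||x y _ IHx _ IHy|c x _ IHx|x y _ IHx _ IHy].
- rewrite Uq_counit_gen; case: g => [i|i|b a].
  + by rewrite scale0r; apply: Ev.
  + by rewrite scale0r; apply: Fv.
  rewrite scale1r; case: b; last exact: Kv.
  have /(mact_inv (Uq_KVK R a) (oner_neq0 _)) : act (Uq_Keps R false a) v = 1 *: v.
    by rewrite scale1r.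
  by rewrite invr1 scale1r.
- have -> : Uq_counit (1 : Uq R n) = 1 by exact: pchar1.
  by rewrite mact_1 scale1r.
- have -> : Uq_counit (x + y) = Uq_counit x + Uq_counit y by exact: pcharD.
  have := mact_linearl act v 1 x y; rewrite (scale1r x) => ->.
  by rewrite scale1r IHx IHy scalerDl.
- have -> : Uq_counit (c *: x) = c * Uq_counit x by exact: pcharZ.
  have := mact_linearl act v c x 0; rewrite (addr0 (c *: x)) => ->.
  by rewrite mact_0l addr0 IHx scalerA.
- have -> : Uq_counit (x * y) = Uq_counit x * Uq_counit y by exact: pcharM.
  by rewrite mact_M IHy mact_Z IHx scalerA mulrC.
Qed.

Lemma action_invariant_subalg (S : B -> Prop) v :
  (forall u, S u -> action_invariant act u) -> subalg_gen S v -> action_invariant act v.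
Proof.
move=> iS; elim=> {v} [v /iS //||u v _ iu _ iv|c v _ iv|u v _ iu _ iv] x.
- exact: mact_eps.
- by rewrite mact_D iu iv scalerDr.
- by rewrite mact_Z iv !scalerA mulrC.
have i0 w i : action_invariant act w -> act (Uq_E R i) w = 0 /\ act (Uq_F R i) w = 0.
  by move=> iw; split; rewrite iw Uq_counit_gen scale0r.
have iK w a : action_invariant act w -> act (Uq_Keps R false a) w = w.
  by move=> iw; rewrite iw Uq_counit_gen scale1r.
apply: action_invariantP => [i|i|a].
- rewrite (mact_Delta act (Delta_E R i)) big_cons big_seq1.
  by have [-> _] := i0 _ i iu; have [-> _] := i0 _ i iv; rewrite mul0r mulr0 addr0.
- rewrite (mact_Delta act (Delta_F R i)) big_cons big_seq1.
  by have [_ ->] := i0 _ i iu; have [_ ->] := i0 _ i iv; rewrite mul0r mulr0 addr0.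
- by rewrite (mact_Delta act (Delta_K R false a)) big_seq1 !iK.
Qed.

End UqInvariants.

Section GradedClasses.
Variables (K : fieldType) (A : algType K) (F : filtration A).

Lemma gr_class_ext d x y (Fx : F d x) (Fy : F d y) : x = y -> gr_class Fx = gr_class Fy.
Proof. by move=> xy; apply/gr_class_eq; rewrite xy subrr; apply: filt_pred_0. Qed.

Lemma gr_class0 d (F0 : F d 0) : gr_class F0 = 0.
Proof.
by rewrite /gr_class -[RHS](quot_pi0 (gr_ideal F)); congr quot_pi; apply/val_inj; rewrite /= scale0r.
Qed.

Lemma gr_class1 (F1 : F 0 1) : gr_class F1 = 1.
Proof.
rewrite /gr_class -[RHS](quot_pi1 (gr_ideal F)); congr quot_pi; apply/val_inj.
by rewrite /= expr0 scale1r.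
Qed.

Lemma gr_classD d x y (Fx : F d x) (Fy : F d y) :
  gr_class Fx + gr_class Fy = gr_class (filt_D Fx Fy).
Proof.
by rewrite /gr_class -quot_piD; congr quot_pi; apply/val_inj; rewrite /= scalerDl.
Qed.

Lemma gr_classZ d c x (Fx : F d x) : c *: gr_class Fx = gr_class (filt_Z c Fx).
Proof.
rewrite /gr_class -quot_piZ; congr quot_pi; apply/val_inj.
by rewrite /= scalerA mulr_algl.
Qed.

Lemma gr_classM d e x y (Fx : F d x) (Fy : F e y) :
  gr_class Fx * gr_class Fy = gr_class (filt_M Fx Fy).
Proof.
rewrite /gr_class -quot_piM; congr quot_pi; apply/val_inj => /=.
rewrite -!mul_polyC mulrA -[X in X * _ = _]mulrA -(commr_polyXn y%:P d) mulrA -polyCM.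
by rewrite -mulrA -exprD.
Qed.

Lemma gr_class_sum (J : finType) d (f : J -> A) (Ff : forall j, F d (f j)) :
  \sum_j gr_class (Ff j) = gr_class (filt_sum (index_enum J) Ff).
Proof.
rewrite /gr_class -(big_morph _ (quot_piD (gr_ideal F)) (quot_pi0 _)); congr quot_pi.
apply/val_inj; rewrite /= scaler_suml.
exact: (big_morph (@rees_val K A F)).
Qed.

(** An element of the Rees algebra is the sum of its monomials. *)
Lemma gr_decomp (g : gr F) : exists p : rees F,
  g = quot_pi (gr_ideal F) p /\ g = \sum_(d < size (rees_val p)) gr_class (reesP p d).
Proof.
elim/quot_ind: g => p; exists p; split=> //.
rewrite /gr_class -(big_morph _ (quot_piD (gr_ideal F)) (quot_pi0 _)); congr quot_pi.
apply/val_inj; rewrite /= (big_morph (@rees_val K A F) (id1 := 0) (op1 := +%R)) //.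
by rewrite -[LHS]coefK poly_def.
Qed.

End GradedClasses.

(** * Invariants of the filtered and of the graded algebra *)

Section Assembly.
Variables (R : realType) (k l n : nat).
Local Notation m := (maxn k l).
Local Notation A := (PD R m n).
Local Notation F := (@Akl_filtration R k l n).
Local Notation gen := (@Akl_letter R k l n).
Local Notation lat := (lat F gen).
Variable act : PD_action R m n.

(** The finitely many coefficients have bounded poles at q = 1. *)
Lemma filt_scale_lat d x : F d x -> exists e, lat d ((q - 1) ^+ e *: x).
Proof.
elim=> {x} [|x y _ [a xa] _ [b yb]|c x _ [a xa]|s sd sS].
- by exists 0%N; rewrite scaler0; apply: lat_0.
- exists (a + b)%N; rewrite scalerDr; apply: lat_D.
    by rewrite addnC exprD -scalerA; apply: lat_Z xa; apply: local1_exp.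
  by rewrite exprD -scalerA; apply: lat_Z yb; apply: local1_exp.
- have [b cb] := local1_scale c; exists (a + b)%N.
  by rewrite scalerA addnC exprD mulrAC -scalerA; apply: lat_Z xa.
- exists 0%N; rewrite expr0 scale1r.
  move: sd; rewrite leq_eqVlt => /orP[/eqP sd|lt]; last first.
    by apply: lat_low; case: d lt => // d lt; apply: degree_le_prod.
  have [w sw] : exists w, s = map gen w.
    elim: s sS {sd} => [|x s IHs] sS; first by exists [::].
    have [w ->] := IHs (fun y ys => sS y (mem_behead (s := x :: s) ys)).
    by have [z ->] := Akl_letterP (sS x (mem_head _ _)); exists (z :: w).
  by rewrite sw big_map; apply: lat_word; rewrite -sd sw size_map.
Qed.

Lemma L_tildeE i j : L_tilde R n i j = quad gen i j.
Proof.
rewrite /quad (reindex_inj rev_ord_inj) /=.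
by apply: eq_bigr => r _.
Qed.

Lemma quad_filt i j : F 2 (quad gen i j).
Proof. exact: (lat_filt (@Akl_letter_filt R k l n) (lat_quad (@Akl_letter_filt R k l n) i j)). Qed.

Lemma act_sum_quad h i j : act h (quad gen i j) =
  \sum_r act h (PD_t R (t_row l i) r * PD_d R (d_row k j) r).
Proof. exact: mact_sum. Qed.

Lemma lo_hi (i : 'I_n.-1) : (lo i == hi i) = false.
Proof. by apply/eqP => /(congr1 val) /=; lia. Qed.

Lemma act_K_d (a : 'I_n.-1) j : act (Uq_K R a) (PD_d R j (lo a)) = q *: PD_d R j (lo a).
Proof.
have K1 : act (Uq_Keps R true (hi a)) (PD_d R j (lo a)) = PD_d R j (lo a).
  rewrite (PD_act_Kinv true (expf_neq0 (hi a == lo a) (q_neq0 R)) (PD_act_Kd act _ _ _)).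
  by rewrite eq_sym lo_hi expr0 invr1 scale1r.
by rewrite mact_M K1 PD_act_Kd eqxx expr1.
Qed.

Lemma act_K'_t (a : 'I_n.-1) i : act (Uq_K' R a) (PD_t R i (lo a)) = q *: PD_t R i (lo a).
Proof.
have q0 : q ^- (lo a == lo a) != 0 :> Cq R by rewrite invr_eq0 expf_neq0 // q_neq0.
rewrite mact_M (PD_act_Kinv true q0 (PD_act_Kt act _ _ _)) eqxx expr1 mact_Z.
rewrite PD_act_Kt [hi a == _]eq_sym lo_hi expr0 invr1 scale1r.
by rewrite (invrK (q : Cq R)).
Qed.

Lemma sum_two (r0 r1 : 'I_n) (X Y : 'I_n -> A) :
  (forall r, r != r0 -> X r = 0) -> (forall r, r != r1 -> Y r = 0) ->
  X r0 + Y r1 = 0 -> \sum_r (X r + Y r) = 0.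
Proof.
move=> X0 Y0 XY; rewrite big_split (bigD1 r0) //= [X in _ + X + _]big1 // addr0.
by rewrite (bigD1 r1) //= [X in _ + (_ + X)]big1 // addr0.
Qed.

(** For E_a only the columns a and a + 1 contribute: E_a t_a K_a d_a and
t_(a+1) E_a d_(a+1) are opposite.  The same happens for F_a. *)
Lemma quad_invariant i j : action_invariant act (quad gen i j).
Proof.
apply: action_invariantP => [a|a|a]; rewrite act_sum_quad.
- under eq_bigr do rewrite (mact_Delta act (Delta_E R a)) big_cons big_seq1 mact_1.
  apply: (@sum_two (lo a) (hi a)) => [r ra|r ra|].
  + by rewrite PD_act_Et eq_sym (negPf ra) mul0r oppr0 scale0r mul0r.
  + by rewrite PD_act_Ed eq_sym (negPf ra) scale0r mulr0.
  rewrite PD_act_Et PD_act_Ed !eqxx act_K_d mul1r scale1r -scalerAr -scalerAl scalerA.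
  by rewrite mulrN mulfV ?q_neq0 // scaleN1r addNr.
- under eq_bigr do rewrite (mact_Delta act (Delta_F R a)) big_cons big_seq1 mact_1.
  apply: (@sum_two (hi a) (lo a)) => [r ra|r ra|].
  + by rewrite PD_act_Ft eq_sym (negPf ra) mul0r oppr0 scale0r mul0r.
  + by rewrite PD_act_Fd eq_sym (negPf ra) scale0r mulr0.
  rewrite PD_act_Ft PD_act_Fd !eqxx act_K'_t mul1r scale1r.
  by rewrite -mulrDl -scalerDl addNr scale0r mul0r.
- apply: eq_bigr => r _; rewrite (mact_Delta act (Delta_K R false a)) big_seq1.
  rewrite PD_act_Kt PD_act_Kd -scalerAr -scalerAl scalerA mulfV ?scale1r //.
  by rewrite expf_neq0 // q_neq0.
Qed.

Lemma quad_span_invariant d x : quad_span gen d x -> action_invariant act x.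
Proof.
move=> sx; apply: (action_invariant_subalg (S := fun y => exists i j, y = quad gen i j)).
  by move=> _ [i [j ->]]; apply: quad_invariant.
elim: sx => {d x} [d|d x y _ ? _ ?|d c x _ ?||d i j x _ ?].
- by rewrite -(scale0r 1); apply/subalg_gen_Z/subalg_gen_1.
- exact: subalg_gen_D.
- exact: subalg_gen_Z.
- exact: subalg_gen_1.
- by apply: subalg_gen_M => //; apply: subalg_gen_in; exists i, j.
Qed.

Lemma invariant_gr_invariant d x : action_invariant act x -> gr_invariant act d x.
Proof. by move=> ix h; rewrite ix subrr; apply: filt_pred_0. Qed.

(** The heart of the theorem: after rescaling into the lattice, this is
[inv_quad_span] for the quantum group action. *)
Lemma gr_invariant_quad_span d x : F d x -> gr_invariant act d x ->
  exists2 y, quad_span gen d y & filt_pred F d (x - y).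
Proof.
move=> /filt_scale_lat[e lx] ix; pose c : Cq R := (q - 1) ^+ e.
have c0 : c != 0 by rewrite expf_neq0 // q1_neq0.
have [] := @inv_quad_span R A F k l n gen (@Akl_letter_filt R k l n)
  (@Akl_letter_comm R k l n) (gr_invariant act) (@gr_invariant_B R k l n act)
  (@gr_invariant_Z R k l n act) (@gr_invariant_low R k l n act) _
  (@wder_gr_invariant R k l n act) d (c *: x) lx (gr_invariant_Z c ix).
  by move=> d' y /quad_span_invariant; apply: invariant_gr_invariant.
move=> y sy xy; exists (c^-1 *: y); first exact: quad_span_Z.
rewrite -[x](scale1r) -(mulVf c0) -scalerA -scalerBr.
exact: lowZ.
Qed.

Definition L_gen (x : A) : Prop := exists (i : 'I_k) (j : 'I_l), x = L_tilde R n i j.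
Definition gr_L_gen (g : gr_Akl R k l n) : Prop :=
  exists (i : 'I_k) (j : 'I_l), g = gr_L_tilde R n i j.

Lemma quad_span_subalg d x : quad_span gen d x -> subalg_gen L_gen x.
Proof.
elim=> {d x} [d|d x y _ ? _ ?|d c x _ ?||d i j x _ ?].
- by rewrite -(scale0r 1); apply/subalg_gen_Z/subalg_gen_1.
- exact: subalg_gen_D.
- exact: subalg_gen_Z.
- exact: subalg_gen_1.
- apply: subalg_gen_M => //; apply: subalg_gen_in; exists i, j.
  by rewrite L_tildeE.
Qed.

Lemma L_tilde_invariant i j : action_invariant act (L_tilde R n i j).
Proof. by rewrite L_tildeE; apply: quad_invariant. Qed.

(** Subtracting a combination of products of the L_ij lowers the degree of
an invariant. *)
Lemma Akl_invariants (D : A) :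
  Akl R k l n D /\ action_invariant act D <-> subalg_gen L_gen D.
Proof.
split=> [[/Akl_filtrationE[d]]|LD]; last first.
  split; last by apply: action_invariant_subalg LD => _ [i [j ->]]; apply: L_tilde_invariant.
  elim: LD => {D} [_ [i [j ->]]||x y _ ? _ ?|c x _ ?|x y _ ? _ ?].
  - rewrite L_tildeE; apply/Akl_filtrationE; exists 2%N; exact: quad_filt.
  - exact: subalg_gen_1.
  - exact: subalg_gen_D.
  - exact: subalg_gen_Z.
  - exact: subalg_gen_M.
elim: d D => [|d IHd] D FD iD.
  have [y sy] := gr_invariant_quad_span FD (invariant_gr_invariant 0 iD).
  by move=> /eqP; rewrite subr_eq0 => /eqP->; apply: quad_span_subalg sy.
have [y sy FDy] := gr_invariant_quad_span FD (invariant_gr_invariant d.+1 iD).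
rewrite -[D](subrK y); apply: subalg_gen_D; last exact: quad_span_subalg sy.
apply: IHd FDy _ => h; have iy := quad_span_invariant sy.
by rewrite mact_B (iD h) (iy h) scalerBr.
Qed.

Lemma gr_L_tildeE i j : gr_L_tilde R n i j = gr_class (quad_filt i j).
Proof.
rewrite /gr_L_tilde; under eq_bigr do rewrite gr_classM.
rewrite gr_class_sum; apply: gr_class_ext.
by rewrite -L_tildeE.
Qed.

(** An element of [quad_span d] has a class in degree exactly [d], whose
expression in the graded L_ij is the same. *)
Lemma quad_span_gr d x : quad_span gen d x -> exists Fx : F d x,
  subalg_gen gr_L_gen (gr_class Fx).
Proof.
elim=> {d x} [d|d x y _ [Fx gx] _ [Fy gy]|d c x _ [Fx gx]||d i j x _ [Fx gx]].
- exists (filt_0 F d); rewrite gr_class0 -(scale0r 1).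
  exact/subalg_gen_Z/subalg_gen_1.
- by exists (filt_D Fx Fy); rewrite -gr_classD; apply: subalg_gen_D.
- by exists (filt_Z c Fx); rewrite -gr_classZ; apply: subalg_gen_Z.
- exists (filt_1 F); rewrite (_ : gr_class _ = 1); first exact: subalg_gen_1.
  exact: gr_class1.
- exists (filt_M (quad_filt i j) Fx : F d.+2 _).
  have -> : gr_class (filt_M (quad_filt i j) Fx : F d.+2 _) =
    gr_class (quad_filt i j) * gr_class Fx by rewrite gr_classM.
  by apply: subalg_gen_M gx; apply: subalg_gen_in; exists i, j; rewrite gr_L_tildeE.
Qed.

(** The coefficients of a representative in the Rees algebra are treated
degree by degree. *)
Lemma gr_invariants (g : gr_Akl R k l n) :
  action_invariant (gr_Akl_act k l act) g <-> subalg_gen gr_L_gen g.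
Proof.
split=> [|Lg]; last first.
  apply: action_invariant_subalg Lg => _ [i [j ->]] h; rewrite gr_L_tildeE.
  rewrite [LHS]gr_act_class gr_classZ; apply: gr_class_ext.
  exact: quad_invariant.
have [p [gp gE]] := gr_decomp g; move=> ig.
have ip d : gr_invariant act d (rees_val p)`_d.
  move=> h; have := ig h; rewrite gp [LHS]gr_mactE -quot_piZ => /quot_piP /(_ d).
  by rewrite coefB [in X in X - _]rees_actE coefZ mulr_algl.
rewrite gE; elim/big_rec: _ => [|d x _ Lx].
  by rewrite -(scale0r 1); apply/subalg_gen_Z/subalg_gen_1.
apply: subalg_gen_D Lx.
have [y /quad_span_gr[Fy Ly] py] := gr_invariant_quad_span (reesP p d) (ip d).
by rewrite (_ : gr_class _ = gr_class Fy) //; apply/gr_class_eq.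
Qed.
End Assembly.

Theorem theorem2 (R : realType) (k l n : nat)
    (hk : (1 <= k)%N) (hl : (1 <= l)%N) (hn : (1 <= n)%N)
    (act : PD_action R (maxn k l) n) :
  (forall D : PD R (maxn k l) n,
     Akl R k l n D /\ action_invariant act D <->
     subalg_gen (fun x => exists (i : 'I_k) (j : 'I_l), x = L_tilde R n i j) D) /\
  (forall g : gr_Akl R k l n,
     action_invariant (gr_Akl_act k l act) g <->
     subalg_gen (fun x => exists (i : 'I_k) (j : 'I_l), x = gr_L_tilde R n i j) g).
Proof. by split=> [D|g]; [exact: Akl_invariants | exact: gr_invariants]. Qed.
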